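(* Let $n \ge 1$, let $\theta \in H^\infty(\mathbb{D}^n)$ be an inner function, let $\mathcal{Q}_\theta = H^2(\mathbb{D}^n) \ominus \theta H^2(\mathbb{D}^n)$, and let $A$ be a bounded linear operator on $\mathcal{Q}_\theta$. Then $C_{z_i}^{*} A C_{z_i} = A$ for all $i = 1, \ldots, n$ if and only if $A = 0$.
   Context: $\mathbb{D}^n$ is the open unit polydisc in $\mathbb{C}^n$ and $\mathbb{T}^n$ is its distinguished boundary. $H^2(\mathbb{D}^n)$ is the Hardy space of holomorphic functions $f$ on $\mathbb{D}^n$ with $\|f\|^2 = \sup_{0 \le r < 1} \int_{\mathbb{T}^n} |f(re^{i\theta_1}, \ldots, re^{i\theta_n})|^2 \, d\boldsymbol{\theta} < \infty$ (normalized Lebesgue measure), and $H^\infty(\mathbb{D}^n)$ is the space of bounded holomorphic functions on $\mathbb{D}^n$. A function $\theta \in H^\infty(\mathbb{D}^n)$ is inner if its radial limits satisfy $|\theta| = 1$ almost everywhere on $\mathbb{T}^n$. $T_{z_i}$ is the operator on $H^2(\mathbb{D}^n)$ of multiplication by the coordinate function $z_i$. With $P_{\mathcal{Q}_\theta}$ the orthogonal projection of $H^2(\mathbb{D}^n)$ onto $\mathcal{Q}_\theta$, set $C_{z_i} = P_{\mathcal{Q}_\theta} T_{z_i}|_{\mathcal{Q}_\theta}$, a bounded operator on $\mathcal{Q}_\theta$, for $i = 1, \ldots, n$. *)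

(* Defs.v *)
From HB Require Import structures.
From mathcomp Require Import all_boot all_order all_algebra.
From mathcomp Require Import complex.
From mathcomp Require Import all_classical all_reals all_analysis.
Import Order.TTheory GRing.Theory Num.Theory numFieldNormedType.Exports.

Set Implicit Arguments.
Unset Strict Implicit.
Unset Printing Implicit Defensive.

Local Open Scope classical_set_scope.
Local Open Scope ring_scope.
Local Open Scope complex_scope.

(* The library puts a norm and a topology on K and on 'rV[K]_n for an abstract
   numFieldType K; this makes R[i] inherit them from R[i]^o. *)
HB.instance Definition _ (R : rcfType) := NormedModule.copy R[i] R[i]^o.

Definition modulus (R : rcfType) (z : R[i]) : R := complex.Re `|z|.

Section torus.
Context (R : realType).
Local Notation RM := (measurableTypeR R).

Definition cons_angle n (p : RM * n.-tuple RM) : n.+1.-tuple RM :=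
  [the n.+1.-tuple RM of p.1 :: p.2].

Lemma measurable_cons_angle n : measurable_fun setT (@cons_angle n).
Proof. exact: measurable_cons. Qed.

HB.instance Definition _ n :=
  isMeasurableFun.Build _ _ _ _ (@cons_angle n) (@measurable_cons_angle n).

Lemma pi2_gt0 : 0 < pi *+ 2 :> R.
Proof. by rewrite mulrn_wgt0// pi_gt0. Qed.

(* Normalized Lebesgue measure on T^n in the angle coordinates
   (t_1, ..., t_n): the n-fold product of the uniform law on [0, 2 pi].  It
   lives on n.-tuple RM, which carries the product sigma-algebra. *)
Fixpoint torus_measure n : probability (n.-tuple RM) R :=
  match n with
  | 0 => \d_[tuple]
  | n'.+1 =>
      distribution (uniform_prob pi2_gt0 \x torus_measure n')%E (@cons_angle n')
  end.

(* The point (r e^(i t_1), ..., r e^(i t_n)). *)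
Definition torus_point n (r : R) (t : n.-tuple RM) : 'rV[R[i]]_n :=
  \row_(i < n) (r%:C * (cos (tnth t i) +i* sin (tnth t i))).

End torus.

Section hardy_space.
Context (R : realType) (n : nat).
Local Notation C := R[i].
Local Notation Cn := 'rV[R[i]]_n.
Implicit Types (f g h theta : Cn -> C) (M N Q : set (Cn -> C)).

Definition polydisc : set Cn := [set z | forall i, modulus (z 0 i) < 1].

Definition holomorphic f := forall z, polydisc z -> differentiable f z.

Definition hardy_normsq f : \bar R :=
  ereal_sup [set (\int[torus_measure R n]_t
                    (modulus (f (torus_point r t)) ^+ 2)%:E)%E
            | r in [set r : R | 0 <= r < 1]].

(* Functions on the polydisc are encoded as functions on C^n that vanish off
   the polydisc, so that equality in H^2 is equality of functions. *)
Definition H2 : set (Cn -> C) :=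
  [set f | [/\ holomorphic f, (hardy_normsq f < +oo)%E
             & forall z, ~ polydisc z -> f z = 0]].

Definition hardy_norm f : R := Num.sqrt (fine (hardy_normsq f)).

(* The inner product inducing the norm, recovered by polarization; it is linear
   in the first argument. *)
Definition hardy_dot f g : C :=
  4^-1 * \sum_(k < 4) 'i ^+ k * (hardy_norm (f + 'i ^+ k *: g) ^+ 2)%:C.

Definition Hinfty theta :=
  holomorphic theta /\
  exists M : R, forall z, polydisc z -> modulus (theta z) <= M.

Definition inner_function theta :=
  Hinfty theta /\
  {ae torus_measure R n, forall t, exists2 l : C,
     theta (torus_point r t) @[r --> (1 : R)^'-] --> l & modulus l = 1}.

Definition ominus M N : set (Cn -> C) :=
  [set f | M f /\ forall g, N g -> hardy_dot f g = 0].

Definition quotient_module theta : set (Cn -> C) :=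
  ominus H2 [set theta * g | g in H2].

(* For a closed subspace M of H^2, the unique g in M with f - g orthogonal
   to M. *)
Definition projection M f : Cn -> C :=
  xget 0 [set g | M g /\ forall h, M h -> hardy_dot (f - g) h = 0].

Definition mulz (i : 'I_n) f : Cn -> C := fun z => z 0 i * f z.

Definition compressed_shift theta (i : 'I_n) f : Cn -> C :=
  projection (quotient_module theta) (mulz i f).

(* Operators on a subspace Q of H^2 are functions of which only the values on Q
   matter. *)
Definition bounded_operator Q (T : (Cn -> C) -> (Cn -> C)) :=
  [/\ forall f, Q f -> Q (T f),
      forall (a : C) f g, Q f -> Q g -> T (a *: f + g) = a *: T f + T g
    & exists K : R, forall f, Q f -> hardy_norm (T f) <= K * hardy_norm f].

(* For a bounded operator T on a closed subspace Q, the unique h in Q with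
   <T f, g> = <f, h> for all f in Q. *)
Definition adjoint Q (T : (Cn -> C) -> (Cn -> C)) g : Cn -> C :=
  xget 0 [set h | Q h /\ forall f, Q f -> hardy_dot (T f) g = hardy_dot f h].

End hardy_space.

(* Main.v *)
Require Import Defs.
From HB Require Import structures.
From mathcomp Require Import all_boot all_order all_algebra.
From mathcomp Require Import complex.
From mathcomp Require Import all_classical all_reals all_analysis.
From mathcomp Require Import measurable_realfun.
From mathcomp Require Import ring lra.
Import Order.TTheory GRing.Theory Num.Theory numFieldNormedType.Exports.

(** Write Q for the quotient module of theta and C_i for the i-th compressed
    shift, and suppose that C_i^* A C_i = A for all i.  Then
    <g, A f> = <C_l g, A C_l f> for every word l in the variables, where C_l f
    is the projection on Q of the monomial z^l times f, because theta H^2 is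
    invariant under the z_i and compressions to Q therefore compose.  So
    |<g, A f>| is at most |A| |g| dist (z^l f, theta H^2), and the theorem
    follows once these distances can be made arbitrarily small (word_approx).

    They can because theta is inner.  On the torus z^l f is close to
    theta (z^l conj theta) f, and if theta were a polynomial of degree at most
    K in each variable then z^l conj theta would be, for l = (z_1 ... z_n)^K,
    again a polynomial (reverse_poly), which puts this element in theta H^2.
    In general theta is close in H^2 to its dilations (dil_approx) and these
    are uniform limits of polynomials (polynomial_approx), while bounded
    functions are dense in H^2, so that f may be taken bounded.  The remaining
    error is the product of z^l f and 1 - |theta|^2, whose mean square over
    the torus of radius r tends to 0 with r to 1 by bounded convergence
    (inner_defect).

    The projection and the adjoint of the statement are 0 when the element they
    should choose does not exist.  A default value makes C_i f, C_i g or A f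
    vanish, hence <g, A f> = 0 by linearity, so that the chain of equalities
    above either continues or ends with the value 0 (chain_step).

    The inner product is handled through the means mdot f g r s of
    f (r tau) conj (g (s tau)) over the torus; hardy_dot f g is the limit of
    mdot f g r r for r to 1 (cvg_dot).  By Cauchy's theorem on an annulus
    (cmean_const), applied in one variable at a time, these means only depend
    on r s (mdot_eq).  This makes the mean squares of f increase with the
    radius (msq_mono) and makes dilations of f converge to f.  The adjoint of
    multiplication by z_i is the backward shift (dot_mulz), built as a Cauchy
    integral (bshift) so that it is holomorphic on the polydisc; it maps Q to
    Q, so that the elements of H^2 orthogonal to Q are stable under the z_i
    (perp_mulz).  *)

Set Implicit Arguments.
Unset Strict Implicit.
Unset Printing Implicit Defensive.

Local Open Scope classical_set_scope.
Local Open Scope ring_scope.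
Local Open Scope complex_scope.

Local Notation Re := complex.Re.
Local Notation Im := complex.Im.

Local Notation "x ^*" := (conjc x) : ring_scope.

(** * Modulus and limits of complex numbers *)

Section modulus_theory.
Context {R : realType}.
Implicit Types (x y z : R[i]) (a b : R).

Lemma normC_modulus z : `|z| = (modulus z)%:C.
Proof. by rewrite /modulus normc_def. Qed.

Lemma modulusE z : modulus z = Num.sqrt (Re z ^+ 2 + Im z ^+ 2).
Proof. by rewrite /modulus normc_def. Qed.

Lemma modulus_ge0 z : 0 <= modulus z.
Proof. by rewrite modulusE sqrtr_ge0. Qed.
Hint Resolve modulus_ge0 : core.

Lemma modulus0 : modulus (0 : R[i]) = 0.
Proof. by rewrite /modulus normr0. Qed.

Lemma modulus1 : modulus (1 : R[i]) = 1.
Proof. by rewrite /modulus normr1. Qed.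

Lemma modulus_eq0 z : (modulus z == 0) = (z == 0).
Proof. by rewrite -(inj_eq (@complexI R)) -normC_modulus normr_eq0. Qed.

Lemma modulus_gt0 z : (0 < modulus z) = (z != 0).
Proof. by rewrite lt0r modulus_eq0 modulus_ge0 andbT. Qed.

Lemma modulusM x y : modulus (x * y) = modulus x * modulus y.
Proof. by apply: (@complexI R); rewrite rmorphM/= -!normC_modulus normrM. Qed.

Lemma modulusV x : modulus x^-1 = (modulus x)^-1.
Proof. by apply: (@complexI R); rewrite fmorphV/= -!normC_modulus normfV. Qed.

Lemma modulusX x k : modulus (x ^+ k) = modulus x ^+ k.
Proof. by apply: (@complexI R); rewrite rmorphXn/= -!normC_modulus normrX. Qed.

Lemma modulusN x : modulus (- x) = modulus x.
Proof. by rewrite /modulus normrN. Qed.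

Lemma modulusBC x y : modulus (x - y) = modulus (y - x).
Proof. by rewrite -modulusN opprB. Qed.

Lemma modulusD x y : modulus (x + y) <= modulus x + modulus y.
Proof. by rewrite -lecR rmorphD/= -!normC_modulus ler_normD. Qed.

Lemma modulusB x y : modulus (x - y) <= modulus x + modulus y.
Proof. by rewrite (le_trans (modulusD _ _))// modulusN. Qed.

Lemma modulus_sum (I : Type) (s : seq I) (P : pred I) (F : I -> R[i]) :
  modulus (\sum_(i <- s | P i) F i) <= \sum_(i <- s | P i) modulus (F i).
Proof.
elim/big_rec2: _ => [|i y1 y2 _]; first by rewrite modulus0.
by move=> h; rewrite (le_trans (modulusD _ _))// lerD2l.
Qed.

Lemma modulus_prod (I : Type) (s : seq I) (P : pred I) (F : I -> R[i]) :
  modulus (\prod_(i <- s | P i) F i) = \prod_(i <- s | P i) modulus (F i).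
Proof. by apply: (big_morph _ modulusM modulus1). Qed.

Lemma modulusJ z : modulus z^* = modulus z.
Proof. by rewrite /modulus normcJ. Qed.

Lemma modulusR a : modulus a%:C = `|a|.
Proof. by rewrite modulusE/= expr0n addr0 sqrtr_sqr. Qed.

Lemma modulus_real a : 0 <= a -> modulus a%:C = a.
Proof. by move=> a0; rewrite modulusR ger0_norm. Qed.

Lemma ler_Re_modulus z : `|Re z| <= modulus z.
Proof. by rewrite -lecR -normC_modulus normc_ge_Re. Qed.

Lemma ler_Im_modulus z : `|Im z| <= modulus z.
Proof.
rewrite modulusE -[leLHS]sqrtr_sqr ler_sqrt ?addr_ge0 ?sqr_ge0//.
by rewrite lerDr sqr_ge0.
Qed.

Lemma ler_modulus_ReIm z : modulus z <= `|Re z| + `|Im z|.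
Proof.
rewrite modulusE -[leRHS]ger0_norm// -sqrtr_sqr ler_sqrt ?sqr_ge0//.
rewrite sqrrD !real_normK ?num_real// -addrA [_ *+ 2 + _]addrC addrA lerDl.
by rewrite mulrn_wge0// mulr_ge0.
Qed.

Lemma mulcc_modulus z : z * z^* = (modulus z ^+ 2)%:C.
Proof. by rewrite -sqr_normc normC_modulus rmorphXn. Qed.

Lemma modulus_i : modulus ('i : R[i]) = 1.
Proof. by rewrite modulusE/= expr0n expr1n add0r sqrtr1. Qed.

Lemma cReM x y : Re (x * y) = Re x * Re y - Im x * Im y.
Proof. by case: x y => ? ? []. Qed.
Lemma cImM x y : Im (x * y) = Re x * Im y + Im x * Re y.
Proof. by case: x y => ? ? [] ? ? /=. Qed.
Lemma cReD x y : Re (x + y) = Re x + Re y. Proof. by case: x y => ? ? []. Qed.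
Lemma cImD x y : Im (x + y) = Im x + Im y. Proof. by case: x y => ? ? []. Qed.
Lemma cReB x y : Re (x - y) = Re x - Re y. Proof. by case: x y => ? ? []. Qed.
Lemma cImB x y : Im (x - y) = Im x - Im y. Proof. by case: x y => ? ? []. Qed.

Lemma cReJ z : Re z^* = Re z. Proof. by case: z. Qed.
Lemma cImJ z : Im z^* = - Im z. Proof. by case: z. Qed.

Definition expi (t : R) : R[i] := cos t +i* sin t.

Lemma modulus_expi t : modulus (expi t) = 1.
Proof. by rewrite modulusE/= cos2Dsin2 sqrtr1. Qed.

Lemma expi_neq0 t : expi t != 0.
Proof. by rewrite -modulus_gt0 modulus_expi. Qed.

Lemma expiJ t : (expi t)^* = (expi t)^-1.
Proof.
apply: (mulfI (expi_neq0 t)).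
by rewrite mulcc_modulus modulus_expi expr1n divff ?expi_neq0.
Qed.

End modulus_theory.
#[export] Hint Resolve modulus_ge0 : core.

Section modulus_topology.
Context {R : realType}.

Lemma ball_modulus (x y : R[i]) (e : R) :
  ball x e%:C y <-> modulus (x - y) < e.
Proof. by rewrite -ball_normE/= normC_modulus ltcR. Qed.

(** The norm of R[i] takes its values in R[i]; this moves limits to R, whose
    order is total. *)
Lemma cvgC_modulus (T : Type) (F : set_system T) {FF : Filter F}
    (f : T -> R[i]) (l : R[i]) :
  f @ F --> l <-> (fun x => modulus (l - f x)) @ F --> (0 : R).
Proof.
split=> [/cvgrPdist_lt fl|fl].
- apply/cvgrPdist_lt => e e0.
  have e0' : (0 : R[i]) < e%:C by rewrite ltcR.
  have := fl _ e0'; apply: filterS => x.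
  by rewrite normC_modulus ltcR sub0r normrN (ger0_norm (modulus_ge0 _)).
- apply/cvgrPdist_lt => e e0.
  have eE : e = (Re e)%:C by rewrite RRe_real// gtr0_real.
  have e0' : 0 < Re e by move: e0; rewrite eE ltcR.
  move/cvgrPdist_lt : fl => /(_ _ e0'); apply: filterS => x.
  by rewrite sub0r normrN (ger0_norm (modulus_ge0 _)) normC_modulus -ltcR -eE.
Qed.

Lemma cvgC_le (T : Type) (F : set_system T) {FF : Filter F}
    (f : T -> R[i]) (l : R[i]) (b : T -> R) :
  (\forall x \near F, modulus (f x - l) <= b x) -> b @ F --> (0 : R) ->
  f @ F --> l.
Proof.
move=> fb b0; apply/cvgC_modulus; apply: (@squeeze_cvgr _ _ _ _ (fun=> 0) b) => //.
  by apply: filterS fb => x; rewrite modulus_ge0/= modulusBC.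
exact: cvg_cst.
Qed.

Lemma cvg_Re (T : Type) (F : set_system T) {FF : Filter F}
    (f : T -> R[i]) (l : R[i]) : f @ F --> l -> (fun x => Re (f x)) @ F --> Re l.
Proof.
move=> /cvgC_modulus fl; apply/cvgrPdist_lt => e e0.
move/cvgrPdist_lt : fl => /(_ _ e0); apply: filterS => x.
rewrite sub0r normrN (ger0_norm (modulus_ge0 _)); apply: le_lt_trans.
by rewrite -cReB ler_Re_modulus.
Qed.

Lemma cvg_Im (T : Type) (F : set_system T) {FF : Filter F}
    (f : T -> R[i]) (l : R[i]) : f @ F --> l -> (fun x => Im (f x)) @ F --> Im l.
Proof.
move=> /cvgC_modulus fl; apply/cvgrPdist_lt => e e0.
move/cvgrPdist_lt : fl => /(_ _ e0); apply: filterS => x.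
rewrite sub0r normrN (ger0_norm (modulus_ge0 _)); apply: le_lt_trans.
by rewrite -cImB ler_Im_modulus.
Qed.

Lemma cvg_ReIm (T : Type) (F : set_system T) {FF : Filter F}
    (f : T -> R[i]) (l : R[i]) :
  (fun x => Re (f x)) @ F --> Re l -> (fun x => Im (f x)) @ F --> Im l ->
  f @ F --> l.
Proof.
move=> fr fi; apply: (@cvgC_le _ _ _ _ _
  (fun x => `|Re (f x) - Re l| + `|Im (f x) - Im l|)).
  by apply: nearW => x; rewrite -cReB -cImB ler_modulus_ReIm.
have -> : (0 : R) = `|Re l - Re l| + `|Im l - Im l|.
  by rewrite !subrr normr0 addr0.
by apply: cvgD; apply: cvg_norm; apply: cvgB => //; exact: cvg_cst.
Qed.

Lemma cvg_modulus (T : Type) (F : set_system T) {FF : Filter F}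
    (f : T -> R[i]) (l : R[i]) :
  f @ F --> l -> (fun x => modulus (f x)) @ F --> modulus l.
Proof.
move=> fl; rewrite modulusE; under eq_fun do rewrite modulusE.
apply: continuous_cvg; first exact: sqrt_continuous.
by apply: cvgD; rewrite expr2; under eq_fun do rewrite expr2;
  apply: cvgM; (exact: cvg_Re || exact: cvg_Im).
Qed.

Lemma cvg_conj (T : Type) (F : set_system T) {FF : Filter F}
    (f : T -> R[i]) (l : R[i]) : f @ F --> l -> (fun x => (f x)^*) @ F --> l^*.
Proof.
move=> /cvgC_modulus fl; apply/cvgC_modulus.
by under eq_fun do rewrite -rmorphB modulusJ.
Qed.

Lemma cvg_realC (T : Type) (F : set_system T) {FF : Filter F}
    (f : T -> R) (l : R) : f @ F --> l -> (fun x => (f x)%:C) @ F --> l%:C.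
Proof.
by move=> fl; apply: cvg_ReIm => //=; exact: cvg_cst.
Qed.

Lemma cvgC_unique (T : Type) (F : set_system T) {FF : ProperFilter F}
    (f : T -> R[i]) (x y : R[i]) : f @ F --> x -> f @ F --> y -> x = y.
Proof. by apply: cvg_unique; exact: norm_hausdorff. Qed.

Lemma continuous_conjc (x : R[i]) : {for x, continuous (@conjc R)}.
Proof. exact (@cvg_conj _ (nbhs x) _ id x (@cvg_id _ _)). Qed.

Lemma continuousC_cst (U : topologicalType) (c : R[i]) (x : U) :
  {for x, continuous (fun=> c)}.
Proof. exact: cvg_cst. Qed.

Lemma continuousC_id (x : R[i]) : {for x, continuous (fun y : R[i] => y)}.
Proof. exact: cvg_id. Qed.

Lemma continuousC_D (U : topologicalType) (f g : U -> R[i]) x :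
  {for x, continuous f} -> {for x, continuous g} ->
  {for x, continuous (fun y => f y + g y)}.
Proof. by move=> cf cg; exact: (cvgD cf cg). Qed.

Lemma continuousC_N (U : topologicalType) (f : U -> R[i]) x :
  {for x, continuous f} -> {for x, continuous (fun y => - f y)}.
Proof. by move=> cf; exact: (cvgN cf). Qed.

Lemma continuousC_B (U : topologicalType) (f g : U -> R[i]) x :
  {for x, continuous f} -> {for x, continuous g} ->
  {for x, continuous (fun y => f y - g y)}.
Proof. by move=> cf cg; exact: (cvgB cf cg). Qed.

Lemma continuousC_M (U : topologicalType) (f g : U -> R[i]) x :
  {for x, continuous f} -> {for x, continuous g} ->
  {for x, continuous (fun y => f y * g y)}.
Proof. by move=> cf cg; exact: (cvgM cf cg). Qed.

Lemma continuousC_V (U : topologicalType) (f : U -> R[i]) x :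
  {for x, continuous f} -> f x != 0 -> {for x, continuous (fun y => (f y)^-1)}.
Proof. by move=> cf fx; exact: (cvgV fx cf). Qed.

Lemma continuousC_X (U : topologicalType) (f : U -> R[i]) (x : U) k :
  {for x, continuous f} -> {for x, continuous (fun y => f y ^+ k)}.
Proof.
move=> cf; elim: k => [|k ih].
  rewrite (_ : (fun y => _) = fun=> 1); first exact: continuousC_cst.
  by apply/funext => y; rewrite expr0.
rewrite (_ : (fun y => _) = fun y => f y * f y ^+ k); first exact: (continuousC_M cf ih).
by apply/funext => y; rewrite exprS.
Qed.

End modulus_topology.

(** * Integrals of bounded complex functions *)

Section complex_integral.
Context d (T : measurableType d) (R : realType).
Variables (mu : {measure set T -> \bar R}) (D : set T).
Hypotheses (mD : measurable D) (muD : (mu D < +oo)%E).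
Implicit Types (F G : T -> R[i]) (f : T -> R).

(** A class closed under sums and products on which integrals over a finite
    measure always exist. *)
Definition bmeas F := [/\ measurable_fun D (fun x => Re (F x)),
  measurable_fun D (fun x => Im (F x)) &
  exists M : R, forall x, D x -> modulus (F x) <= M].

Definition Cint F : R[i] :=
  (\int[mu]_(x in D) Re (F x)) +i* (\int[mu]_(x in D) Im (F x)).

Lemma bmeas_ub F : bmeas F -> exists2 M : R, 0 < M & forall x, D x -> modulus (F x) <= M.
Proof.
move=> [_ _ [M FM]]; exists (`|M| + 1); first by rewrite ltr_wpDl.
by move=> x /FM /le_trans; apply; rewrite (le_trans (ler_norm _))// lerDl.
Qed.

Lemma bounded_integrable f (M : R) : measurable_fun D f ->
  (forall x, D x -> `|f x| <= M) -> mu.-integrable D (EFin \o f).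
Proof.
move=> mf fM; apply: measurable_bounded_integrable => //.
exists M; split; rewrite ?num_real// => y My x /fM /le_trans; apply; exact: ltW.
Qed.

Lemma bmeas_integrable_Re F : bmeas F -> mu.-integrable D (EFin \o (fun x => Re (F x))).
Proof.
move=> [mF _ [M FM]]; apply: (@bounded_integrable _ M) => // x /FM.
by apply: le_trans; exact: ler_Re_modulus.
Qed.

Lemma bmeas_integrable_Im F : bmeas F -> mu.-integrable D (EFin \o (fun x => Im (F x))).
Proof.
move=> [_ mF [M FM]]; apply: (@bounded_integrable _ M) => // x /FM.
by apply: le_trans; exact: ler_Im_modulus.
Qed.

Lemma bmeas_cst c : bmeas (fun=> c).
Proof. by split; [exact: measurable_cst|exact: measurable_cst|exists (modulus c)]. Qed.

Lemma bmeasD F G : bmeas F -> bmeas G -> bmeas (fun x => F x + G x).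
Proof.
move=> [rF iF [M FM]] [rG iG [N GN]]; split.
- by under eq_fun do rewrite cReD; exact: measurable_funD.
- by under eq_fun do rewrite cImD; exact: measurable_funD.
- by exists (M + N) => x Dx; rewrite (le_trans (modulusD _ _))// lerD ?FM ?GN.
Qed.

Lemma bmeasM F G : bmeas F -> bmeas G -> bmeas (fun x => F x * G x).
Proof.
move=> [rF iF [M FM]] [rG iG [N GN]]; split.
- by under eq_fun do rewrite cReM; apply: measurable_funB; exact: measurable_funM.
- by under eq_fun do rewrite cImM; apply: measurable_funD; exact: measurable_funM.
- exists (M * N) => x Dx; rewrite modulusM ler_pM ?modulus_ge0//; [exact: FM|exact: GN].
Qed.

Lemma bmeasJ F : bmeas F -> bmeas (fun x => (F x)^*).
Proof.
move=> [rF iF [M FM]]; split.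
- by under eq_fun do rewrite cReJ.
- by under eq_fun do rewrite cImJ; exact: measurableT_comp.
- by exists M => x /FM; rewrite modulusJ.
Qed.

Lemma bmeasN F : bmeas F -> bmeas (fun x => - F x).
Proof.
move=> mF; under eq_fun do rewrite -mulN1r.
by apply: bmeasM => //; exact: bmeas_cst.
Qed.

Lemma bmeasB F G : bmeas F -> bmeas G -> bmeas (fun x => F x - G x).
Proof. by move=> mF mG; apply: bmeasD => //; exact: bmeasN. Qed.

Lemma bmeasZ c F : bmeas F -> bmeas (fun x => c * F x).
Proof. by move=> mF; apply: bmeasM => //; exact: bmeas_cst. Qed.

Lemma bmeas_sum (I : Type) (s : seq I) (P : pred I) (F : I -> T -> R[i]) :
  (forall i, P i -> bmeas (F i)) -> bmeas (fun x => \sum_(i <- s | P i) F i x).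
Proof.
move=> mF; elim: s => [|i s ih].
  by under eq_fun do rewrite big_nil; exact: bmeas_cst.
case: (boolP (P i)) => Pi.
  under eq_fun do rewrite big_cons Pi.
  by apply: bmeasD => //; exact: mF.
by under eq_fun do rewrite big_cons (negbTE Pi).
Qed.

Lemma bmeas_prod (I : Type) (s : seq I) (P : pred I) (F : I -> T -> R[i]) :
  (forall i, P i -> bmeas (F i)) -> bmeas (fun x => \prod_(i <- s | P i) F i x).
Proof.
move=> mF; elim: s => [|i s ih].
  by under eq_fun do rewrite big_nil; exact: bmeas_cst.
case: (boolP (P i)) => Pi.
  under eq_fun do rewrite big_cons Pi.
  by apply: bmeasM => //; exact: mF.
by under eq_fun do rewrite big_cons (negbTE Pi).
Qed.

Lemma bmeas_modulus2 F : bmeas F -> bmeas (fun x => (modulus (F x) ^+ 2)%:C).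
Proof.
by move=> mF; under eq_fun do rewrite -mulcc_modulus; apply: bmeasM => //; exact: bmeasJ.
Qed.

Lemma eq_Cint F G : (forall x, D x -> F x = G x) -> Cint F = Cint G.
Proof.
by move=> FG; congr (_ +i* _); apply: eq_Rintegral => x /set_mem /FG ->.
Qed.

Lemma Cint_D F G : bmeas F -> bmeas G -> Cint (fun x => F x + G x) = Cint F + Cint G.
Proof.
move=> mF mG; apply/eqP; rewrite eq_complex/=; apply/andP; split; apply/eqP.
  under eq_Rintegral do rewrite cReD.
  by apply: RintegralD => //; exact: bmeas_integrable_Re.
under eq_Rintegral do rewrite cImD.
by apply: RintegralD => //; exact: bmeas_integrable_Im.
Qed.

Lemma Cint_Z c F : bmeas F -> Cint (fun x => c * F x) = c * Cint F.
Proof.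
move=> mF; have iR := bmeas_integrable_Re mF; have iI := bmeas_integrable_Im mF.
have iRZ k : mu.-integrable D (EFin \o (fun x => k * Re (F x))).
  exact: (integrableZl mD k iR).
have iIZ k : mu.-integrable D (EFin \o (fun x => k * Im (F x))).
  exact: (integrableZl mD k iI).
apply/eqP; rewrite eq_complex/= cReM cImM/=; apply/andP; split; apply/eqP.
  under eq_Rintegral do rewrite cReM.
  by rewrite RintegralB// !RintegralZl.
under eq_Rintegral do rewrite cImM.
by rewrite RintegralD// !RintegralZl// [in RHS]addrC [Im c * _]mulrC [in RHS]addrC.
Qed.

Lemma Cint_N F : bmeas F -> Cint (fun x => - F x) = - Cint F.
Proof. by move=> mF; rewrite -[RHS]mulN1r -Cint_Z//; apply: eq_Cint => x _; rewrite mulN1r. Qed.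

Lemma Cint_B F G : bmeas F -> bmeas G -> Cint (fun x => F x - G x) = Cint F - Cint G.
Proof. by move=> mF mG; rewrite Cint_D ?Cint_N//; exact: bmeasN. Qed.

Lemma Cint_sum (I : Type) (s : seq I) (P : pred I) (F : I -> T -> R[i]) :
  (forall i, P i -> bmeas (F i)) ->
  Cint (fun x => \sum_(i <- s | P i) F i x) = \sum_(i <- s | P i) Cint (F i).
Proof.
move=> mF; elim: s => [|i s ih].
  rewrite big_nil (eq_Cint (G := fun=> 0 * 0)); last by move=> x _; rewrite big_nil mul0r.
  by rewrite Cint_Z ?mul0r//; exact: bmeas_cst.
rewrite big_cons; case: ifPn => Pi.
  rewrite -ih -Cint_D; [|exact: mF|exact: bmeas_sum].
  by apply: eq_Cint => x _; rewrite big_cons Pi.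
by rewrite -ih; apply: eq_Cint => x _; rewrite big_cons (negbTE Pi).
Qed.

Lemma Cint_cst c : Cint (fun=> c) = c * (fine (mu D))%:C.
Proof.
rewrite /Cint !Rintegral_cst//; case: c => a b /=.
by apply/eqP; rewrite eq_complex/= !mulr0 subr0 add0r !eqxx.
Qed.

Lemma Cint_real f : Cint (fun x => (f x)%:C) = (\int[mu]_(x in D) f x)%:C.
Proof. by rewrite /Cint/= Rintegral_cst// mul0r. Qed.

Lemma Cint_conj F : bmeas F -> Cint (fun x => (F x)^*) = (Cint F)^*.
Proof.
move=> mF; apply/eqP; rewrite eq_complex/=; apply/andP; split; apply/eqP.
  by apply: eq_Rintegral => x _; case: (F x).
rewrite -[RHS]mulN1r -RintegralZl//; last exact: bmeas_integrable_Im.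
by apply: eq_Rintegral => x _; rewrite mulN1r; case: (F x).
Qed.

Lemma Rintegral_le_bound f (M : R) : measurable_fun D f ->
  (forall x, D x -> `|f x| <= M) -> `|\int[mu]_(x in D) f x| <= M * fine (mu D).
Proof.
move=> mf fM; have intf := bounded_integrable mf fM.
apply: le_trans (le_normr_Rintegral mD intf) _.
rewrite -Rintegral_cst//; apply: le_Rintegral => //.
  exact: integrable_norm.
apply: (@bounded_integrable _ `|M|) => //; exact: measurable_cst.
Qed.

(** The factor 2 comes from bounding the real and imaginary parts separately.
    *)
Lemma modulus_Cint F (M : R) : bmeas F -> (forall x, D x -> modulus (F x) <= M) ->
  modulus (Cint F) <= 2 * M * fine (mu D).
Proof.
move=> [rF iF _] FM; apply: le_trans (ler_modulus_ReIm _) _.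
rewrite -mulrA mulr2n mulrDl mul1r/= lerD//.
  by apply: Rintegral_le_bound => // x /FM; apply: le_trans; exact: ler_Re_modulus.
by apply: Rintegral_le_bound => // x /FM; apply: le_trans; exact: ler_Im_modulus.
Qed.

Lemma cvg_Rintegral (f_ : nat -> T -> R) f (M : R) :
  (forall k, measurable_fun D (f_ k)) -> measurable_fun D f ->
  {ae mu, forall x, D x -> f_ ^~ x @ \oo --> f x} ->
  (forall k x, D x -> `|f_ k x| <= M) ->
  (fun k => \int[mu]_(x in D) f_ k x) @ \oo --> \int[mu]_(x in D) f x.
Proof.
move=> mf_ mf cf fM.
have iM : mu.-integrable D (EFin \o (fun=> M)).
  by apply: (@bounded_integrable _ `|M|) => //; exact: measurable_cst.
have [||||i1 _ h] := @dominated_convergence _ T R mu D mD (fun k => EFin \o f_ k)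
  (EFin \o f) (EFin \o (fun=> M)) _ _ _ iM.
- by move=> k; exact/measurable_EFinP.
- exact/measurable_EFinP.
- by apply: filterS cf => x cx Dx; apply: cvg_EFin; [exact: nearW|exact: cx].
- by apply: aeW => x k Dx; rewrite lee_fin fM.
apply: fine_cvg; rewrite fineK//; exact: integrable_fin_num.
Qed.

Lemma cvg_Cint (F_ : nat -> T -> R[i]) F (M : R) :
  (forall k, bmeas (F_ k)) -> bmeas F ->
  (forall x, D x -> F_ ^~ x @ \oo --> F x) ->
  (forall k x, D x -> modulus (F_ k x) <= M) ->
  (fun k => Cint (F_ k)) @ \oo --> Cint F.
Proof.
move=> mF_ [rF iF _] cF FM; apply: cvg_ReIm => /=.
  apply: (@cvg_Rintegral _ _ M) => //.
  - by move=> k; case: (mF_ k).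
  - by apply: aeW => x Dx; apply: cvg_Re; exact: cF.
  - by move=> k x Dx; rewrite (le_trans (ler_Re_modulus _))// FM.
apply: (@cvg_Rintegral _ _ M) => //.
- by move=> k; case: (mF_ k).
- by apply: aeW => x Dx; apply: cvg_Im; exact: cF.
- by move=> k x Dx; rewrite (le_trans (ler_Im_modulus _))// FM.
Qed.

End complex_integral.

(** * Integration over the torus, one angle at a time *)

Section product_integral.
Context d1 d2 (X : measurableType d1) (Y : measurableType d2) (R : realType).
Variables (P : probability X R) (Q : probability Y R).
Implicit Type F : X * Y -> R[i].

Lemma probability_lty d (T : measurableType d) (mu : probability T R) :
  (mu setT < +oo)%E.
Proof. by rewrite probability_setT ltry. Qed.

Lemma bmeas_comp d d' (T : measurableType d) (T' : measurableType d')
  (phi : T -> T') (F : T' -> R[i]) : measurable_fun setT phi ->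
  bmeas setT F -> bmeas setT (fun x => F (phi x)).
Proof.
move=> mphi [rF iF [M FM]]; split; last by exists M => x _; exact: FM.
- exact: (measurableT_comp rF mphi).
- exact: (measurableT_comp iF mphi).
Qed.

Lemma bmeas_pair1 F x : bmeas setT F -> bmeas setT (fun y => F (x, y)).
Proof. exact: (bmeas_comp (pair1_measurable x)). Qed.

Lemma bmeas_pair2 F y : bmeas setT F -> bmeas setT (fun x => F (x, y)).
Proof. exact: (bmeas_comp (pair2_measurable y)). Qed.

Lemma measurable_Rintegral2 (f : X * Y -> R) (M : R) : measurable_fun setT f ->
  (forall z, `|f z| <= M) -> measurable_fun setT (fun y => \int[P]_x f (x, y)).
Proof.
move=> mf fM; have intf : (P \x Q)%E.-integrable setT (EFin \o f).
  apply: (@bounded_integrable _ _ _ _ _ _ _ _ M) => //; exact: probability_lty.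
have h := measurable_fubini_G intf.
exact: (measurableT_comp (fine_measurable _) h).
Qed.

Lemma Rintegral_prod1 (f : X * Y -> R) (M : R) : measurable_fun setT f ->
  (forall z, `|f z| <= M) ->
  \int[P]_x \int[Q]_y f (x, y) = \int[(P \x Q)%E]_z f z.
Proof.
move=> mf fM; have intf : (P \x Q)%E.-integrable setT (EFin \o f).
  apply: (@bounded_integrable _ _ _ _ _ _ _ _ M) => //; exact: probability_lty.
rewrite /Rintegral -(integral12_prod_meas1 intf); congr fine.
apply: eq_integral => x _; rewrite fineK//.
apply: integrable_fin_num => //.
apply: (@bounded_integrable _ _ _ _ _ _ _ _ M) => //; first exact: probability_lty.
exact: (measurableT_comp mf (pair1_measurable x)).
Qed.

Lemma Rintegral_prod2 (f : X * Y -> R) (M : R) : measurable_fun setT f ->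
  (forall z, `|f z| <= M) ->
  \int[Q]_y \int[P]_x f (x, y) = \int[(P \x Q)%E]_z f z.
Proof.
move=> mf fM; have intf : (P \x Q)%E.-integrable setT (EFin \o f).
  apply: (@bounded_integrable _ _ _ _ _ _ _ _ M) => //; exact: probability_lty.
rewrite /Rintegral -(integral21_prod_meas1 intf); congr fine.
apply: eq_integral => x _; rewrite fineK//.
apply: integrable_fin_num => //.
apply: (@bounded_integrable _ _ _ _ _ _ _ _ M) => //; first exact: probability_lty.
exact: (measurableT_comp mf (pair2_measurable x)).
Qed.

Lemma modulus_Cint_prob d (T : measurableType d) (mu : probability T R)
    (F : T -> R[i]) (M : R) :
  bmeas setT F -> (forall x, modulus (F x) <= M) ->
  modulus (Cint mu setT F) <= 2 * M.
Proof.
move=> mF FM.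
have := modulus_Cint measurableT (probability_lty mu) mF (fun x _ => FM x).
by rewrite [fine _](congr1 fine (probability_setT mu)) mulr1.
Qed.

Lemma Cint_cst_prob d (T : measurableType d) (mu : probability T R) (c : R[i]) :
  Cint mu setT (fun=> c) = c.
Proof. by rewrite Cint_cst// [fine _](congr1 fine (probability_setT mu)) mulr1. Qed.

Lemma bmeas_Cint2 F : bmeas setT F -> bmeas setT (fun y => Cint P setT (fun x => F (x, y))).
Proof.
move=> mF; have [rF iF [M FM]] := mF; split.
- apply: (@measurable_Rintegral2 (fun z => Re (F z)) M) => // z.
  by rewrite (le_trans (ler_Re_modulus _))// FM.
- apply: (@measurable_Rintegral2 (fun z => Im (F z)) M) => // z.
  by rewrite (le_trans (ler_Im_modulus _))// FM.
- exists (2 * M) => x _; apply: modulus_Cint_prob; first exact: bmeas_pair2.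
  by move=> y; exact: FM.
Qed.

Lemma Cint_prod1 F : bmeas setT F ->
  Cint (P \x Q)%E setT F = Cint P setT (fun x => Cint Q setT (fun y => F (x, y))).
Proof.
move=> [rF iF [M FM]]; rewrite /Cint/=; congr (_ +i* _); apply/esym.
- apply: (@Rintegral_prod1 (fun z => Re (F z)) M) => // z.
  by rewrite (le_trans (ler_Re_modulus _))// FM.
- apply: (@Rintegral_prod1 (fun z => Im (F z)) M) => // z.
  by rewrite (le_trans (ler_Im_modulus _))// FM.
Qed.

Lemma Cint_prod2 F : bmeas setT F ->
  Cint (P \x Q)%E setT F = Cint Q setT (fun y => Cint P setT (fun x => F (x, y))).
Proof.
move=> [rF iF [M FM]]; rewrite /Cint/=; congr (_ +i* _); apply/esym.
- apply: (@Rintegral_prod2 (fun z => Re (F z)) M) => // z.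
  by rewrite (le_trans (ler_Re_modulus _))// FM.
- apply: (@Rintegral_prod2 (fun z => Im (F z)) M) => // z.
  by rewrite (le_trans (ler_Im_modulus _))// FM.
Qed.

End product_integral.

Section torus_integral.
Context {R : realType}.
Local Notation RM := (measurableTypeR R).

Definition avg (F : RM -> R[i]) : R[i] := Cint (uniform_prob (@pi2_gt0 R)) setT F.

Definition Tint n (F : n.-tuple RM -> R[i]) : R[i] := Cint (torus_measure R n) setT F.

Lemma bmeas_cons n (F : n.+1.-tuple RM -> R[i]) : bmeas setT F ->
  bmeas setT (fun p : RM * n.-tuple RM => F (cons_angle p)).
Proof. by apply: bmeas_comp; exact: measurable_cons_angle. Qed.

Lemma Tint_cons n (F : n.+1.-tuple RM -> R[i]) : bmeas setT F ->
  Tint F = Cint (uniform_prob (@pi2_gt0 R) \x torus_measure R n)%E setT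
            (fun p => F (cons_angle p)).
Proof.
move=> mF; have := mF => -[rF iF [M FM]].
rewrite /Tint /Cint/=; congr (_ +i* _); rewrite /Rintegral; congr fine.
- rewrite -(@integral_distribution _ _ _ _ _ _ (@cons_angle R n)
    (EFin \o (fun x => Re (F x))))//.
    exact/measurable_EFinP.
  apply: (@bounded_integrable _ _ _ _ _ _ _ (fun p => Re (F (cons_angle p))) M) => //.
  + exact: probability_lty.
  + by case: (bmeas_cons mF).
  + by move=> x _; rewrite (le_trans (ler_Re_modulus _))// FM.
- rewrite -(@integral_distribution _ _ _ _ _ _ (@cons_angle R n)
    (EFin \o (fun x => Im (F x))))//.
    exact/measurable_EFinP.
  apply: (@bounded_integrable _ _ _ _ _ _ _ (fun p => Im (F (cons_angle p))) M) => //.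
  + exact: probability_lty.
  + by case: (bmeas_cons mF).
  + by move=> x _; rewrite (le_trans (ler_Im_modulus _))// FM.
Qed.

Definition set_angle n (i : 'I_n) (s : RM) (t : n.-tuple RM) : n.-tuple RM :=
  [tuple (if j == i then s else tnth t j) | j < n].

Lemma tnth_set_angle n (i : 'I_n) (s : RM) (t : n.-tuple RM) j :
  tnth (set_angle i s t) j = if j == i then s else tnth t j.
Proof. by rewrite tnth_mktuple. Qed.

Lemma measurable_set_angle n (i : 'I_n) d (T : measurableType d)
    (f : T -> RM) (g : T -> n.-tuple RM) :
  measurable_fun setT f -> measurable_fun setT g ->
  measurable_fun setT (fun x => set_angle i (f x) (g x)).
Proof.
move=> mf mg; apply/measurable_fun_tnthP => j.
rewrite (_ : _ \o _ = if j == i then f else fun x => tnth (g x) j).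
  case: ifPn => // _.
  exact: (measurableT_comp (measurable_tnth j) mg).
by apply/funext => x /=; rewrite tnth_set_angle; case: ifPn.
Qed.

Lemma cons_angle_set0 n (s0 s : RM) (t : n.-tuple RM) :
  set_angle ord0 s (cons_angle (s0, t)) = cons_angle (s, t).
Proof.
apply: eq_from_tnth => j; rewrite tnth_set_angle.
by case: (unliftP ord0 j) => [k ->|->]; rewrite ?eqxx//= !tnthS.
Qed.

Lemma cons_angle_setS n (i : 'I_n) (s0 s : RM) (t : n.-tuple RM) :
  set_angle (lift ord0 i) s (cons_angle (s0, t)) = cons_angle (s0, set_angle i s t).
Proof.
apply: eq_from_tnth => j; rewrite tnth_set_angle.
case: (unliftP ord0 j) => [k ->|->]//=; rewrite !tnthS tnth_set_angle.
by rewrite (inj_eq lift_inj).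
Qed.

Lemma bmeas_avg_set_angle n (i : 'I_n) (F : n.-tuple RM -> R[i]) : bmeas setT F ->
  bmeas setT (fun t => avg (fun s => F (set_angle i s t))).
Proof.
move=> mF; apply: (@bmeas_Cint2 _ _ RM (n.-tuple RM) R
  (uniform_prob (@pi2_gt0 R)) (torus_measure R n)
  (fun p => F (set_angle i p.1 p.2))).
by apply: bmeas_comp mF; apply: measurable_set_angle.
Qed.

(** Averaging in one angle keeps the integral over the torus, by Fubini. This
    is how facts on circle means are used in several variables. *)
Lemma Tint_avg n (i : 'I_n) (F : n.-tuple RM -> R[i]) : bmeas setT F ->
  Tint F = Tint (fun t => avg (fun s => F (set_angle i s t))).
Proof.
elim: n i F => [[]//|n ih] i F mF.
have mF' := bmeas_avg_set_angle i mF.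
rewrite !Tint_cons//; case: (unliftP ord0 i) mF' => [k ->|->] mF'.
  rewrite Cint_prod1; last exact: bmeas_cons.
  rewrite Cint_prod1; last exact: (bmeas_cons mF').
  apply: eq_Cint => s _.
  rewrite [LHS](ih k _ (bmeas_pair1 s (bmeas_cons mF))).
  apply: eq_Cint => t _; apply: eq_Cint => s' _.
  by rewrite cons_angle_setS.
rewrite Cint_prod2; last exact: bmeas_cons.
rewrite Cint_prod2; last exact: (bmeas_cons mF').
apply: eq_Cint => t _; rewrite -[LHS](Cint_cst_prob (uniform_prob (@pi2_gt0 R))).
apply: eq_Cint => s _; apply: eq_Cint => s' _.
by rewrite cons_angle_set0.
Qed.

End torus_integral.

(** * Compactness, and measurability from continuity *)

Section compactness.
Context {R : realType}.

Lemma compact_modulus_bounded (T : topologicalType) (K : set T) (f : T -> R[i]) :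
  compact K -> (forall x, K x -> {for x, continuous f}) ->
  exists2 M : R, 0 < M & forall x, K x -> modulus (f x) <= M.
Proof.
move=> cK cf.
have cg : {within K, continuous (fun x => modulus (f x) : R)}.
  apply: continuous_in_subspaceT => x /set_mem Kx.
  by apply: cvg_modulus; exact: cf.
have [M [_ MK]] := compact_bounded (continuous_compact cg cK).
exists (`|M| + 1); first by rewrite ltr_wpDl.
move=> x Kx; have := MK (`|M| + 1) _ (modulus (f x)) _.
rewrite /= (ger0_norm (modulus_ge0 _)); apply.
  by rewrite (le_lt_trans (ler_norm M))// ltrDl.
by exists x.
Qed.

(** A closed subset of the image of a square. *)
Lemma compact_disc (rho : R) : compact [set z : R[i] | modulus z <= rho].
Proof.
pose sq := `[- rho, rho]%classic `*` `[- rho, rho]%classic : set (R * R).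
have csq : compact sq by apply: compact_setX; exact: segment_compact.
pose g (p : R * R) : R[i] := p.1 +i* p.2.
have cg : continuous g.
  move=> p; apply: cvg_ReIm => /=; [exact: cvg_fst|exact: cvg_snd].
have cim : compact (g @` sq).
  by apply: continuous_compact csq; exact: continuous_subspaceT.
apply: subclosed_compact cim _.
- have -> : [set z : R[i] | modulus z <= rho] =
            (@modulus R) @^-1` [set x | x <= rho] by [].
  apply: closed_comp; last exact: closed_le.
  by move=> z _; apply: (@cvg_modulus _ _ (nbhs z) _ id z); exact: cvg_id.
- move=> z /= zr; exists (Re z, Im z); last by rewrite /g/=; case: (z).
  by split => /=; rewrite in_itv/= -ler_norml (le_trans _ zr)//
    ?ler_Re_modulus ?ler_Im_modulus.
Qed.

Lemma compact_polydisc n (rho : R) :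
  compact [set z : 'rV[R[i]]_n | forall i, modulus (z 0 i) <= rho].
Proof.
have := @rV_compact _ n (fun _ : 'I_n => [set z : R[i] | modulus z <= rho]).
by move=> /(_ (fun=> @compact_disc rho)); exact.
Qed.

Lemma cvg_rV (T : Type) (F : set_system T) {FF : Filter F} (U : topologicalType) n
    (f : T -> 'rV[U]_n) (l : 'rV[U]_n) :
  (forall i, (fun x => f x 0 i) @ F --> l 0 i) -> f @ F --> l.
Proof.
move=> fl A [P MP PA].
apply: (@filterS _ _ _ (fun x => forall i, P 0 i (f x 0 i))).
  by move=> x Px; apply: PA => i j; rewrite ord1.
by apply: filter_forall => i; apply: fl; exact: MP.
Qed.

End compactness.

Section measurability.
Context {R : realType}.
Local Notation RM := (measurableTypeR R).

Definition floor_tuple (k : nat) n (t : n.-tuple RM) : n.-tuple int :=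
  [tuple Num.floor (k.+1%:R * (tnth t i : R)) | i < n].

Definition unfloor (k : nat) n (v : n.-tuple int) : n.-tuple RM :=
  [tuple ((tnth v i)%:~R / k.+1%:R : R) | i < n].

Lemma measurable_floor_tuple k n (f : n.-tuple int -> R) :
  measurable_fun setT (fun t : n.-tuple RM => f (floor_tuple k t)).
Proof.
have mh v : measurable [set t : n.-tuple RM | floor_tuple k t = v].
  rewrite (_ : mkset _ = \bigcap_(i in setT)
    [set t : n.-tuple RM | tnth t i \in
      `[(tnth v i)%:~R / k.+1%:R, (tnth v i + 1)%:~R / k.+1%:R[ ]).
    apply: fin_bigcap_measurable; first exact: finite_finset.
    move=> i _.
    have := measurable_tnth (T := RM) i measurableT (measurable_itv
      `[(tnth v i)%:~R / k.+1%:R, (tnth v i + 1)%:~R / k.+1%:R[).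
    by rewrite setTI.
  have iff_i (t : n.-tuple RM) i : (Num.floor (k.+1%:R * (tnth t i : R)) == tnth v i) =
      ((tnth t i : R) \in `[(tnth v i)%:~R / k.+1%:R, (tnth v i + 1)%:~R / k.+1%:R[).
    by rewrite floor_eq in_itv/= ler_pdivrMr// ltr_pdivlMr// mulrC.
  apply/seteqP; split => t /=.
    by move=> tv i _ /=; rewrite -iff_i -tv tnth_mktuple.
  move=> tv; apply: eq_from_tnth => i; rewrite tnth_mktuple.
  by apply/eqP; rewrite iff_i; exact: tv.
move=> _ Y mY; rewrite setTI.
rewrite (_ : _ @^-1` _ = \bigcup_(v in setT)
  (if `[< Y (f v) >] then [set t : n.-tuple RM | floor_tuple k t = v] else set0)).
  apply: countable_bigcupT_measurable; first exact: countableP.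
  by move=> v; case: ifPn.
apply/seteqP; split => t /=.
  move=> Yt; exists (floor_tuple k t) => //.
  by rewrite ifT//; apply/asboolP.
by move=> [v _]; case: ifPn => // /asboolP Yv /= tv; rewrite tv.
Qed.

Lemma cvg_floor (x : R) :
  (fun k => (Num.floor (k.+1%:R * x))%:~R / k.+1%:R : R) @ \oo --> x.
Proof.
apply: (@squeeze_cvgr _ _ _ _ (fun k => x - harmonic k) (fun=> x)).
- apply: nearW => k; have /andP[h1 h2] := floor_itv (k.+1%:R * x).
  rewrite ler_pdivrMr// [x * _]mulrC h1 andbT ler_pdivlMr// mulrBl mulVf//.
  by rewrite [x * _]mulrC lerBlDr ltW//; rewrite intrD in h2.
- rewrite -[X in _ --> X](subr0 x); apply: cvgB; first exact: cvg_cst.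
  exact: cvg_harmonic.
- exact: cvg_cst.
Qed.

(** The sigma-algebra of the tuples is generated by the coordinates, so
    continuity is turned into measurability through the points floor (k t) /
    k, which approximate t and take countably many values. *)
Lemma seq_continuous_measurable n (f : n.-tuple RM -> R) :
  (forall (t : n.-tuple RM) (u : nat -> n.-tuple RM),
     (forall i, (fun k => tnth (u k) i : R) @ \oo --> (tnth t i : R)) ->
     (fun k => f (u k)) @ \oo --> f t) ->
  measurable_fun setT f.
Proof.
move=> cf.
apply: (@measurable_fun_cvg _ _ _ _ (fun k t => f (unfloor k (floor_tuple k t)))).
  by move=> k; exact: (measurable_floor_tuple k (fun v => f (unfloor k v))).
move=> t _; apply: cf => i.
under eq_fun do rewrite !tnth_mktuple.
exact: cvg_floor.
Qed.

Definition rpoint n (a : 'I_n -> R) (t : n.-tuple RM) : 'rV[R[i]]_n :=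
  \row_i ((a i)%:C * expi (tnth t i)).

Lemma modulus_rpoint n (a : 'I_n -> R) t i : 0 <= a i ->
  modulus (rpoint a t 0 i) = a i.
Proof. by move=> a0; rewrite mxE modulusM modulus_expi mulr1 modulus_real. Qed.

Lemma polydisc_rpoint n (a : 'I_n -> R) t : (forall i, 0 <= a i < 1) ->
  polydisc (rpoint a t).
Proof. by move=> a01 i; have /andP[a0 a1] := a01 i; rewrite modulus_rpoint. Qed.

Lemma cvg_expi (T : Type) (F : set_system T) {FF : Filter F} (f : T -> R) (l : R) :
  f @ F --> l -> (fun x => expi (f x)) @ F --> expi l.
Proof.
move=> fl; apply: cvg_ReIm => /=; apply: continuous_cvg => //.
- exact: continuous_cos.
- exact: continuous_sin.
Qed.

(** Measurability comes from sequential continuity, boundedness from the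
    compactness of the closed polydisc of radius rho. *)
Lemma bmeas_polydisc_comp m n (q : m.-tuple RM -> 'rV[R[i]]_n)
    (f : 'rV[R[i]]_n -> R[i]) (rho : R) :
  rho < 1 -> (forall t i, modulus (q t 0 i) <= rho) ->
  (forall (t : m.-tuple RM) (u : nat -> m.-tuple RM),
     (forall i, (fun k => tnth (u k) i : R) @ \oo --> (tnth t i : R)) ->
     forall i, (fun k => q (u k) 0 i) @ \oo --> q t 0 i) ->
  (forall z, polydisc z -> {for z, continuous f}) ->
  bmeas setT (fun t => f (q t)).
Proof.
move=> rho1 qrho cq cf.
have qp t : polydisc (q t) by move=> i; exact: le_lt_trans rho1.
have cft (t : m.-tuple RM) (u : nat -> m.-tuple RM) :
    (forall i, (fun k => tnth (u k) i : R) @ \oo --> (tnth t i : R)) ->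
    (fun k => f (q (u k))) @ \oo --> f (q t).
  move=> ut; apply: continuous_cvg; first exact: cf.
  by apply: cvg_rV => i; exact: cq.
split.
- by apply: seq_continuous_measurable => t u ut; apply: cvg_Re; exact: cft.
- by apply: seq_continuous_measurable => t u ut; apply: cvg_Im; exact: cft.
- have [M _ KM] := @compact_modulus_bounded _ _ _ f (@compact_polydisc _ n rho) (fun z Kz =>
     cf z (fun i => le_lt_trans (Kz i) rho1)).
  by exists M => t _; exact: KM.
Qed.

Lemma bmeas_rpoint n (a : 'I_n -> R) (f : 'rV[R[i]]_n -> R[i]) (rho : R) :
  rho < 1 -> (forall i, 0 <= a i <= rho) ->
  (forall z, polydisc z -> {for z, continuous f}) ->
  bmeas setT (fun t => f (rpoint a t)).
Proof.
move=> rho1 arho cf; apply: (bmeas_polydisc_comp rho1) => //.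
  by move=> t i; have /andP[a0 ar] := arho i; rewrite modulus_rpoint.
move=> t u ut i; rewrite mxE; under eq_fun do rewrite mxE.
by apply: cvgM; [exact: cvg_cst|exact: cvg_expi].
Qed.

End measurability.

(** * Goursat's theorem on a rectangle *)

Section real_lemmas.
Context {R : realType}.

Lemma is_derive_approx (f : R -> R) (x f' eta : R) : is_derive x 1 f f' -> 0 < eta ->
  exists2 delta : R, 0 < delta & forall h, `|h| < delta ->
    `|f (x + h) - f x - f' * h| <= eta * `|h|.
Proof.
move=> [df f'E] eta0.
have : (fun h : R => h^-1 *: (f (h *: (1 : R) + x) - f x)) @ (0 : R)^' --> f'.
  by rewrite -f'E; exact: df.
move=> /cvgrPdist_lt /(_ _ eta0) /nbhs_ballP[delta /= delta0 H].
exists delta => // h hd; have [->|h0] := eqVneq h 0.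
  by rewrite addr0 subrr mulr0 subr0 normr0 mulr0.
have := H h; rewrite /ball/= sub0r normrN => /(_ hd h0).
rewrite /GRing.scale/= mulr1 [h + x]addrC => h1.
rewrite -[_ - _ * h](mulfVK h0) normrM ler_pM2r ?normr_gt0//.
rewrite distrC in h1; apply: le_trans (ltW h1).
by rewrite mulrBl mulfK// mulrC.
Qed.

Lemma continuous_modulus_approx (psi : R[i] -> R[i]) (w : R[i]) (eta : R) :
  {for w, continuous psi} -> 0 < eta ->
  exists2 delta : R, 0 < delta & forall w', modulus (w' - w) < delta ->
    modulus (psi w' - psi w) < eta.
Proof.
move=> /cvgC_modulus /cvgrPdist_lt cpsi eta0.
have /nbhs_ballP[delta /= delta0 H] := cpsi _ eta0.
have dE : delta = (Re delta)%:C by rewrite RRe_real// gtr0_real.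
exists (Re delta); first by rewrite -ltcR -dE.
move=> w' w'd; have := H w'; rewrite {1}dE => /(_ _).
rewrite sub0r normrN (ger0_norm (modulus_ge0 _)) modulusBC; apply.
by apply/ball_modulus; rewrite modulusBC.
Qed.

Lemma continuous_itv_bmeas (a b : R) (f : R -> R[i]) :
  (forall x, a <= x <= b -> {for x, continuous f}) ->
  bmeas (T := measurableTypeR R) `[a, b]%classic f.
Proof.
move=> cf.
have [M _ FM] := @compact_modulus_bounded _ _ _ f (@segment_compact R a b)
  (fun x xab => cf x (ltac:(by move: xab; rewrite /= in_itv))).
split; last by exists M.
- apply: subspace_continuous_measurable_fun => //.
  apply: continuous_in_subspaceT => x /set_mem /=; rewrite in_itv/= => xab.
  by apply: cvg_Re; exact: cf.
- apply: subspace_continuous_measurable_fun => //.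
  apply: continuous_in_subspaceT => x /set_mem /=; rewrite in_itv/= => xab.
  by apply: cvg_Im; exact: cf.
Qed.

End real_lemmas.

Section goursat.
Context {R : realType}.
Local Notation RM := (measurableTypeR R).
Local Notation leb := (@lebesgue_measure R).
Implicit Types (g : R -> R -> R[i]) (a b c d : R).

Definition itv_int a b (f : R -> R[i]) : R[i] := Cint leb `[a, b]%classic (f : RM -> R[i]).

Lemma leb_itv a b : a <= b -> leb `[a, b]%classic = (b - a)%:E.
Proof.
rewrite le_eqVlt => /predU1P[->|ab].
  by rewrite set_itv1 lebesgue_measure_set1 subrr.
by rewrite lebesgue_measure_itv/= lte_fin ab.
Qed.

Lemma leb_itv_lty a b : (leb `[a, b]%classic < +oo)%E.
Proof. by rewrite lebesgue_measure_itv/=; case: ifPn => // _; rewrite -EFinB ltry. Qed.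

Lemma Rintegral_split a m b (f : RM -> R) : a <= m <= b ->
  leb.-integrable `[a, b]%classic (EFin \o f) ->
  \int[leb]_(x in `[a, b]) f x =
  \int[leb]_(x in `[a, m]) f x + \int[leb]_(x in `[m, b]) f x.
Proof.
move=> /andP[am mb] intf.
have := Rintegral_itvB (x := m) intf; rewrite !bnd_simp => /(_ am mb) E.
have <- := @Rintegral_itv_obnd_cbnd R m (BRight b) f.
  by rewrite -E addrC subrK.
apply: integrableS intf; [exact: measurable_itv|exact: measurable_itv|].
move=> x; rewrite /= !in_itv/= => /andP[mx xb].
by rewrite xb (le_trans am (ltW mx)).
Qed.

Lemma itv_int_split a m b f : a <= m <= b ->
  (forall x, a <= x <= b -> {for x, continuous f}) ->
  itv_int a b f = itv_int a m f + itv_int m b f.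
Proof.
move=> /andP[am mb] cf; have bf := continuous_itv_bmeas cf.
have iR := @bmeas_integrable_Re _ RM R leb _ (measurable_itv `[a, b]) (leb_itv_lty a b) f bf.
have iI := @bmeas_integrable_Im _ RM R leb _ (measurable_itv `[a, b]) (leb_itv_lty a b) f bf.
by apply/eqP; rewrite eq_complex/=; apply/andP; split; apply/eqP;
  apply: Rintegral_split; rewrite ?am ?mb.
Qed.

(** The integral of g (s + i t) d(s + i t) along the boundary of the rectangle
    [a, b] x [c, d]. *)
Definition rect g a b c d : R[i] :=
  itv_int a b (g ^~ c) - itv_int a b (g ^~ d) + 'i * (itv_int c d (g b) - itv_int c d (g a)).

Definition rcont g a b c d := forall s t, a <= s <= b -> c <= t <= d ->
  {for s, continuous (g ^~ t)} /\ {for t, continuous (g s)}.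

Lemma rect_split1 g a m b c d : a <= m <= b -> c <= d -> rcont g a b c d ->
  rect g a b c d = rect g a m c d + rect g m b c d.
Proof.
move=> amb cd cg; rewrite /rect.
rewrite (@itv_int_split a m b (g ^~ c))// => [|x xab]; last first.
  by have [] := cg x c xab; rewrite ?lexx.
rewrite (@itv_int_split a m b (g ^~ d))// => [|x xab]; last first.
  by have [] := cg x d xab; rewrite ?lexx ?cd.
ring.
Qed.

Lemma rect_split2 g a b c m d : a <= b -> c <= m <= d -> rcont g a b c d ->
  rect g a b c d = rect g a b c m + rect g a b m d.
Proof.
move=> ab cmd cg; rewrite /rect.
rewrite (@itv_int_split c m d (g a))// => [|x xab]; last first.
  by have [] := cg a x _ xab; rewrite ?lexx.
rewrite (@itv_int_split c m d (g b))// => [|x xab]; last first.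
  by have [] := cg b x _ xab; rewrite ?lexx ?ab.
ring.
Qed.

Lemma rcont_sub g a b c d a' b' c' d' : a <= a' -> b' <= b -> c <= c' -> d' <= d ->
  rcont g a b c d -> rcont g a' b' c' d'.
Proof.
move=> aa bb cc dd cg s t /andP[as_ sb] /andP[ct td].
by apply: cg; apply/andP; split; lra.
Qed.

Lemma rect_quarter g a b c d : a <= b -> c <= d -> rcont g a b c d ->
  let m := (a + b) / 2 in let k := (c + d) / 2 in
  rect g a b c d = rect g a m c k + rect g m b c k + rect g a m k d + rect g m b k d.
Proof.
move=> ab cd cg m k.
have amb : a <= m <= b by rewrite /m; apply/andP; split; lra.
have ckd : c <= k <= d by rewrite /k; apply/andP; split; lra.
have [/andP[am mb] /andP[ck kd]] := (amb, ckd).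
rewrite (rect_split2 ab ckd cg) !(rect_split1 amb)//; last 2 first.
- by apply: rcont_sub cg.
- by apply: rcont_sub cg.
by rewrite addrA.
Qed.

Lemma itv_int_B a b f1 f2 : (forall x, a <= x <= b -> {for x, continuous f1}) ->
  (forall x, a <= x <= b -> {for x, continuous f2}) ->
  itv_int a b f1 - itv_int a b f2 = itv_int a b (fun x => f1 x - f2 x).
Proof.
move=> c1 c2; rewrite /itv_int Cint_B//.
- exact: leb_itv_lty.
- exact: continuous_itv_bmeas.
- exact: continuous_itv_bmeas.
Qed.

Lemma modulus_itv_int a b f (M : R) : a <= b ->
  (forall x, a <= x <= b -> {for x, continuous f}) ->
  (forall x, a <= x <= b -> modulus (f x) <= M) ->
  modulus (itv_int a b f) <= 2 * M * (b - a).
Proof.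
move=> ab cf fM.
have := @modulus_Cint _ RM R leb `[a, b]%classic (measurable_itv _) (leb_itv_lty a b) f M.
rewrite [fine _](congr1 fine (leb_itv ab)); apply; first exact: continuous_itv_bmeas.
by move=> x /=; rewrite in_itv/=; exact: fM.
Qed.

Lemma itv_int_cst a b k : a <= b -> itv_int a b (fun=> k) = k * (b - a)%:C.
Proof. by move=> ab; rewrite /itv_int Cint_cst// [fine _](congr1 fine (leb_itv ab)). Qed.

(** An affine form alpha + beta z has zero integral along a closed curve, so
    only the distance of g to it counts. *)
Lemma rect_affine g a b c d (alpha beta : R[i]) (eta : R) : a <= b -> c <= d ->
  rcont g a b c d ->
  (forall s t, a <= s <= b -> c <= t <= d ->
    modulus (g s t - (alpha + beta * (s +i* t))) <= eta) ->
  modulus (rect g a b c d) <= 4 * eta * ((b - a) + (d - c)).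
Proof.
move=> ab cd cg gE.
have aab : a <= a <= b by rewrite lexx.
have bab : a <= b <= b by rewrite lexx ab.
have ccd : c <= c <= d by rewrite lexx.
have dcd : c <= d <= d by rewrite lexx cd.
pose e s t := g s t - (alpha + beta * (s +i* t)).
have eta0 : 0 <= eta by exact: le_trans (modulus_ge0 _) (gE a c aab ccd).
pose h := fun s => e s c - e s d.
pose v := fun t => e b t - e a t.
have ch x : a <= x <= b -> {for x, continuous h}.
  move=> xab; have [c1 _] := cg x c xab ccd; have [c2 _] := cg x d xab dcd.
  rewrite (_ : h = fun s => (g s c - g s d) - beta * (0 +i* (c - d))).
    exact: (continuousC_B (continuousC_B c1 c2) (@continuousC_cst _ _ _ _)).
  apply/funext => s; rewrite /h /e.
  have -> : s +i* c = (s +i* d) + (0 +i* (c - d)).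
    by apply/eqP; rewrite eq_complex/= addr0 addrC subrK !eqxx.
  ring.
have cv x : c <= x <= d -> {for x, continuous v}.
  move=> xcd; have [_ c1] := cg a x aab xcd; have [_ c2] := cg b x bab xcd.
  rewrite (_ : v = fun t => (g b t - g a t) - beta * ((b - a) +i* 0)).
    exact: (continuousC_B (continuousC_B c2 c1) (@continuousC_cst _ _ _ _)).
  apply/funext => t; rewrite /v /e.
  have -> : b +i* t = (a +i* t) + ((b - a) +i* 0).
    by apply/eqP; rewrite eq_complex/= addr0 addrC subrK !eqxx.
  ring.
have -> : rect g a b c d = itv_int a b h + 'i * itv_int c d v.
  rewrite /rect (itv_int_B (fun x xab => (cg x c xab ccd).1) (fun x xab => (cg x d xab dcd).1)).
  rewrite (itv_int_B (fun x xab => (cg b x bab xab).2) (fun x xab => (cg a x aab xab).2)).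
  have -> : itv_int a b h = itv_int a b (fun x => g x c - g x d) - itv_int a b (fun=> beta * (0 +i* (c - d))).
    rewrite itv_int_B; last 2 first.
    - by move=> x xab; exact: (continuousC_B (cg x c xab ccd).1 (cg x d xab dcd).1).
    - by move=> x _; exact: continuousC_cst.
    congr itv_int; apply/funext => s; rewrite /h /e.
    have -> : s +i* c = (s +i* d) + (0 +i* (c - d)).
      by apply/eqP; rewrite eq_complex/= addr0 addrC subrK !eqxx.
    ring.
  have -> : itv_int c d v = itv_int c d (fun x => g b x - g a x) - itv_int c d (fun=> beta * ((b - a) +i* 0)).
    rewrite itv_int_B; last 2 first.
    - by move=> x xab; exact: (continuousC_B (cg b x bab xab).2 (cg a x aab xab).2).
    - by move=> x _; exact: continuousC_cst.
    congr itv_int; apply/funext => t; rewrite /v /e.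
    have -> : b +i* t = (a +i* t) + ((b - a) +i* 0).
      by apply/eqP; rewrite eq_complex/= addr0 addrC subrK !eqxx.
    ring.
  rewrite !itv_int_cst//.
  have -> : 0 +i* (c - d) = - ('i * (d - c)%:C) :> R[i].
    by apply/eqP; rewrite eq_complex/=; apply/andP; split; apply/eqP; ring.
  rewrite complexr0; ring.
apply: le_trans (modulusD _ _) _; rewrite modulusM modulus_i mul1r mulrDr.
have -> : 4 * eta = 2 * (eta + eta) by ring.
apply: lerD; apply: modulus_itv_int => //.
- by move=> x xab; apply: le_trans (modulusB _ _) _; rewrite lerD// gE.
- by move=> x xab; apply: le_trans (modulusB _ _) _; rewrite lerD// gE.
Qed.

(** Complex differentiability of s + i t |-> g s t, D being the derivative. *)
Definition rdiff g s t := exists D : R[i], forall eps : R, 0 < eps ->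
  exists2 delta : R, 0 < delta & forall s' t', `|s' - s| < delta -> `|t' - t| < delta ->
    modulus (g s' t' - g s t - D * ((s' - s) +i* (t' - t))) <=
    eps * (`|s' - s| + `|t' - t|).

Lemma quarter_contra (x q1 q2 q3 q4 : R) : x <= q1 + q2 + q3 + q4 ->
  4 * q1 < x -> 4 * q2 < x -> 4 * q3 < x -> 4 * q4 < x -> False.
Proof. lra. Qed.

Section bisection.
Variables (g : R -> R -> R[i]) (a b c d : R).
Hypotheses (ab : a <= b) (cd : c <= d) (cg : rcont g a b c d).
Hypothesis dg : forall s t, a <= s <= b -> c <= t <= d -> rdiff g s t.

Let lx k : R := (b - a) / 2 ^+ k.
Let ly k : R := (d - c) / 2 ^+ k.
Let rk (p : R * R) k := rect g p.1 (p.1 + lx k) p.2 (p.2 + ly k).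

(* p and p' are lower left corners of rectangles of generations k and k.+1: p'
   is a quarter of p carrying at least a quarter of the boundary integral. *)
Let good k (p p' : R * R) :=
  [/\ p'.1 = p.1 \/ p'.1 = p.1 + lx k.+1, p'.2 = p.2 \/ p'.2 = p.2 + ly k.+1 &
      modulus (rk p k) <= 4 * modulus (rk p' k.+1)].

Let inside k (p : R * R) := [/\ a <= p.1, p.1 + lx k <= b, c <= p.2 & p.2 + ly k <= d].

Let lxS k : lx k = lx k.+1 + lx k.+1.
Proof. rewrite /lx exprS; field; exact: expf_neq0. Qed.

Let lyS k : ly k = ly k.+1 + ly k.+1.
Proof. rewrite /ly exprS; field; exact: expf_neq0. Qed.

Let lx_ge0 k : 0 <= lx k.
Proof. by rewrite divr_ge0 ?exprn_ge0// subr_ge0. Qed.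

Let ly_ge0 k : 0 <= ly k.
Proof. by rewrite divr_ge0 ?exprn_ge0// subr_ge0. Qed.

Let good_ex k p : inside k p -> exists p', good k p p'.
Proof.
move=> [h1 h2 h3 h4].
have := lx_ge0 k; have := ly_ge0 k; have := lx_ge0 k.+1; have := ly_ge0 k.+1.
move=> l1 l2 l3 l4.
have cg' : rcont g p.1 (p.1 + lx k) p.2 (p.2 + ly k) by apply: rcont_sub cg.
have /= := rect_quarter _ _ cg'.
rewrite !lerDl => /(_ l4 l3).
have -> : (p.1 + (p.1 + lx k)) / 2 = p.1 + lx k.+1 by rewrite lxS; field.
have -> : (p.2 + (p.2 + ly k)) / 2 = p.2 + ly k.+1 by rewrite lyS; field.
have e1 : p.1 + lx k.+1 + lx k.+1 = p.1 + lx k by rewrite -addrA -lxS.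
have e2 : p.2 + ly k.+1 + ly k.+1 = p.2 + ly k by rewrite -addrA -lyS.
pose q1 := rk (p.1, p.2) k.+1.
pose q2 := rk (p.1 + lx k.+1, p.2) k.+1.
pose q3 := rk (p.1, p.2 + ly k.+1) k.+1.
pose q4 := rk (p.1 + lx k.+1, p.2 + ly k.+1) k.+1.
move=> rE; have {}rE : rk p k = q1 + q2 + q3 + q4.
  by rewrite /rk rE /q1 /q2 /q3 /q4 /rk/= e1 e2.
have rk_le : modulus (rk p k) <= modulus q1 + modulus q2 + modulus q3 + modulus q4.
  rewrite rE; apply: le_trans (modulusD _ _) _; rewrite lerD2r.
  by apply: le_trans (modulusD _ _) _; rewrite lerD2r modulusD.
have [h|h'1] := leP (modulus (rk p k)) (4 * modulus q1).
  by exists (p.1, p.2); split => //=; left.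
have [h|h'2] := leP (modulus (rk p k)) (4 * modulus q2).
  by exists (p.1 + lx k.+1, p.2); split => //=; [right|left].
have [h|h'3] := leP (modulus (rk p k)) (4 * modulus q3).
  by exists (p.1, p.2 + ly k.+1); split => //=; [left|right].
have [h|h'4] := leP (modulus (rk p k)) (4 * modulus q4).
  by exists (p.1 + lx k.+1, p.2 + ly k.+1); split => //=; right.
by exfalso; exact: (quarter_contra rk_le h'1 h'2 h'3 h'4).
Qed.

Let u := fix u k := if k is k'.+1 then xget (u k') [set p' | good k' (u k') p'] else (a, c).

Let inside_u k : inside k (u k) /\ good k (u k) (u k.+1).
Proof.
suff iu : inside k (u k).
  split => //; have [p' gp'] := good_ex iu.
  by have := @xgetPex _ (u k) [set p' | good k (u k) p'] (ex_intro _ p' gp').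
elim: k => [|k [h1 h2 h3 h4]].
  by rewrite /inside/= /lx /ly expr0 !divr1 addrC subrK addrC subrK.
have [p' gp'] : exists p', good k (u k) p' by apply: good_ex.
have : good k (u k) (u k.+1).
  by have := @xgetPex _ (u k) [set p' | good k (u k) p'] (ex_intro _ p' gp').
rewrite /inside; move=> [].
have := lx_ge0 k.+1; have := ly_ge0 k.+1; have := lxS k; have := lyS k.
move: (u k) (u k.+1) h1 h2 h3 h4 => [x y] [x' y'] /=.
move: (lx k) (ly k) (lx k.+1) (ly k.+1) => l1 l2 l3 l4.
by move=> h1 h2 h3 h4 e1 e2 h5 h6 [->|->] [->|->] _; split; lra.
Qed.

Let corner_cvg (x : nat -> R) (l : nat -> R) : (forall k, 0 <= l k) ->
  (forall k, l k = l k.+1 + l k.+1) ->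
  (forall k, x k.+1 = x k \/ x k.+1 = x k + l k.+1) ->
  exists z, forall k, x k <= z <= x k + l k.
Proof.
move=> l0 lS xS.
have xnd k j : x k <= x (k + j)%N /\ x (k + j)%N + l (k + j)%N <= x k + l k.
  elim: j => [|j [ih1 ih2]]; first by rewrite addn0.
  rewrite addnS; have := l0 (k + j).+1; have := lS (k + j)%N.
  by move=> e1 e2; case: (xS (k + j)%N) => ->; split; lra.
have ub : has_sup (range x).
  split; first by exists (x 0); exists 0%N.
  exists (x 0 + l 0%N) => _ [k _ <-]; have := xnd 0%N k; rewrite add0n => -[_].
  by have := l0 k; lra.
exists (sup (range x)) => k; apply/andP; split.
  by apply: ub_le_sup; [exact: ub.2|exists k].
apply: ge_sup; first exact: ub.1.
move=> _ [j _ <-]; have [kj|jk] := leqP k j.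
  have := xnd k (j - k)%N; rewrite subnKC// => -[_].
  by have := l0 j; lra.
have := xnd j (k - j)%N; rewrite subnKC 1?ltnW// => -[h _].
by have := l0 k; lra.
Qed.

(** Goursat: the nested rectangles meet at a point, near which g is affine up
    to eps times the distance; the boundary integral on the k-th rectangle is
    then at most a constant times eps 4^-k. *)
Lemma rect_eq0 : rect g a b c d = 0.
Proof.
have [s sP] := corner_cvg (x := fun k => (u k).1) lx_ge0 lxS (fun k =>
  let: conj _ (And3 h _ _) := inside_u k in h).
have [t tP] := corner_cvg (x := fun k => (u k).2) ly_ge0 lyS (fun k =>
  let: conj _ (And3 _ h _) := inside_u k in h).
have rk0 k : modulus (rect g a b c d) <= 4 ^+ k * modulus (rk (u k) k).
  elim: k => [|k ih].
    by rewrite expr0 mul1r /rk/= /lx /ly expr0 !divr1 addrC subrK addrC subrK.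
  apply: le_trans ih _; have [_ [_ _ h]] := inside_u k.
  by rewrite exprSr -mulrA ler_pM2l// exprn_gt0.
have sab : a <= s <= b.
  have [[h1 h2 _ _] _] := inside_u 0; have /andP[h3 h4] := sP 0%N.
  by apply/andP; split; move: h2 h4 h3 h1 => /=; lra.
have tcd : c <= t <= d.
  have [[_ _ h1 h2] _] := inside_u 0; have /andP[h3 h4] := tP 0%N.
  by apply/andP; split; move: h2 h4 h3 h1 => /=; lra.
have [D HD] := dg sab tcd.
set S := (b - a) + (d - c).
have S0 : 0 <= S by rewrite addr_ge0// subr_ge0.
suff small eps : 0 < eps -> modulus (rect g a b c d) <= eps * (4 * S ^+ 2).
  apply/eqP; rewrite -modulus_eq0 eq_le modulus_ge0 andbT.
  apply/ler_addgt0Pl => e e0; rewrite addr0.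
  have e1 : 0 < e / (4 * S ^+ 2 + 1) by rewrite divr_gt0// ltr_wpDl// mulr_ge0// sqr_ge0.
  apply: le_trans (small _ e1) _; rewrite -mulrA.
  apply: ler_piMr; first exact: ltW.
  by rewrite ler_pdivrMl ?mulr1 ?lerDl// ltr_wpDl// mulr_ge0// sqr_ge0.
move=> eps0; have [delta delta0 Hd] := HD _ eps0.
have [k Sk] : exists k : nat, S / 2 ^+ k < delta.
  have : (fun k : nat => S / 2 ^+ k : R) @ \oo --> S * 0.
    apply: cvgM; first exact: cvg_cst.
    under eq_fun do rewrite -exprVn.
    by apply: cvg_expr; rewrite ger0_norm ?invr_ge0// invf_lt1// ltr1n.
  rewrite mulr0 => /cvgrPdist_lt /(_ _ delta0) /filter_ex[k].
  rewrite sub0r normrN ger0_norm ?divr_ge0 ?exprn_ge0//; exists k => //.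
have [[h1 h2 h3 h4] _] := inside_u k.
have /andP[s1 s2] := sP k; have /andP[t1 t2] := tP k.
have lx0 := lx_ge0 k; have ly0 := ly_ge0 k.
have lS : lx k + ly k = S / 2 ^+ k by rewrite /S [RHS]mulrDl.
apply: le_trans (rk0 k) _.
have : modulus (rk (u k) k) <= 4 * (eps * (lx k + ly k)) * (lx k + ly k).
  have -> : lx k + ly k = ((u k).1 + lx k - (u k).1) + ((u k).2 + ly k - (u k).2) by ring.
  apply: (@rect_affine _ _ _ _ _ (g s t - D * (s +i* t)) D).
  - by rewrite lerDl.
  - by rewrite lerDl.
  - exact: rcont_sub cg.
  - move=> s' t' /andP[s'1 s'2] /andP[t'1 t'2].
    have ds : `|s' - s| <= lx k by rewrite ler_norml; apply/andP; split; lra.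
    have dt : `|t' - t| <= ly k by rewrite ler_norml; apply/andP; split; lra.
    have -> : g s' t' - (g s t - D * (s +i* t) + D * (s' +i* t')) =
      g s' t' - g s t - D * ((s' - s) +i* (t' - t)).
      have -> : (s' - s) +i* (t' - t) = (s' +i* t') - (s +i* t) by [].
      ring.
    apply: le_trans (Hd _ _ _ _) _.
    + by apply: le_lt_trans ds _; apply: le_lt_trans Sk; rewrite -lS lerDl.
    + by apply: le_lt_trans dt _; apply: le_lt_trans Sk; rewrite -lS lerDr.
    + by rewrite ler_pM2l//; lra.
move=> h; have p4 : 0 < (4 : R) ^+ k by rewrite exprn_gt0.
have : 4 ^+ k * modulus (rk (u k) k) <=
       4 ^+ k * (4 * (eps * (lx k + ly k)) * (lx k + ly k)) by rewrite ler_pM2l.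
move/le_trans; apply; rewrite lS le_eqVlt; apply/orP; left; apply/eqP.
have -> : (4 : R) ^+ k = 2 ^+ k * 2 ^+ k by rewrite -exprMn -natrM.
by field; exact: expf_neq0.
Qed.

End bisection.

End goursat.

(** * Circle means and Cauchy's formula in one variable *)

Section complex_derivative.
Context {R : realType}.
Implicit Types (f g psi : R[i] -> R[i]) (w z : R[i]).

Lemma continuousC_near (U : topologicalType) (f g : U -> R[i]) x :
  (\forall y \near x, f y = g y) -> {for x, continuous f} -> {for x, continuous g}.
Proof.
move=> fg cf; rewrite /prop_for /continuous_at -(nbhs_singleton fg).
by apply: cvg_trans cf; exact: near_eq_cvg.
Qed.

Lemma near_neqC z w : z != w -> \forall z' \near z, z' != w.
Proof.
move=> zw; have := cvgr_neq0 _ (continuousC_B (@continuousC_id _ z) (@continuousC_cst _ _ w z)).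
by rewrite subr_eq0 => /(_ _ zw); apply: filterS => z'; rewrite subr_eq0.
Qed.

(** Differentiability in the form of Caratheodory: psi is the difference
    quotient, extended continuously at w by the derivative. *)
Definition cdiff f w := exists psi, {for w, continuous psi} /\
  forall z, f z = f w + (z - w) * psi z.

Lemma cdiff_continuous f w : cdiff f w -> {for w, continuous f}.
Proof.
move=> [psi [cpsi fE]].
rewrite (_ : f = fun z => f w + (z - w) * psi z); last exact/funext.
exact: (continuousC_D (@continuousC_cst _ _ _ _)
  (continuousC_M (continuousC_B (@continuousC_id _ _) (@continuousC_cst _ _ _ _)) cpsi)).
Qed.

Lemma cdiff_cst k w : cdiff (fun=> k) w.
Proof.
by exists (fun=> 0); split; [exact: continuousC_cst|move=> z; rewrite mulr0 addr0].
Qed.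

Lemma cdiff_id w : cdiff id w.
Proof.
by exists (fun=> 1); split; [exact: continuousC_cst|move=> z; rewrite mulr1 addrC subrK].
Qed.

Lemma cdiffD f g w : cdiff f w -> cdiff g w -> cdiff (fun z => f z + g z) w.
Proof.
move=> [p [cp fE]] [q [cq gE]]; exists (fun z => p z + q z); split.
  exact: (continuousC_D cp cq).
by move=> z; rewrite fE gE; ring.
Qed.

Lemma cdiffM f g w : cdiff f w -> cdiff g w -> cdiff (fun z => f z * g z) w.
Proof.
move=> df dg; have cf := cdiff_continuous df; move: df dg.
move=> [p [cp fE]] [q [cq gE]]; exists (fun z => p z * g w + f z * q z); split.
  exact: (continuousC_D (continuousC_M cp (@continuousC_cst _ _ _ _)) (continuousC_M cf cq)).
by move=> z; rewrite [in LHS]gE [in LHS]fE (fE z); ring.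
Qed.

Lemma cdiff_comp f g w : cdiff g w -> cdiff f (g w) -> cdiff (fun z => f (g z)) w.
Proof.
move=> dg; have cg := cdiff_continuous dg; move: dg.
move=> [p [cp gE]] [q [cq fE]]; exists (fun z => p z * q (g z)); split.
  exact: (continuousC_M cp (continuous_comp cg cq)).
by move=> z; rewrite (fE (g z)) [X in X - g w]gE; ring.
Qed.

Lemma cdiff_inv w : w != 0 -> cdiff (fun z => z^-1) w.
Proof.
move=> w0; exists (fun z => if z == 0 then w^-2 else - (w * z)^-1); split.
  have wz : w * w != 0 by rewrite mulf_neq0.
  have := continuousC_N (continuousC_V (continuousC_M
    (@continuousC_cst _ _ w w) (@continuousC_id _ w)) wz).
  apply: continuousC_near.
  by apply: filterS (near_neqC w0) => z /negbTE ->.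
move=> z; case: eqVneq => [->|z0].
  by rewrite invr0 sub0r mulNr -exprVn expr2 mulrA divff// mul1r subrr.
by field; rewrite w0 z0.
Qed.

Lemma cdiff_conj f w : cdiff f w^* -> cdiff (fun z => (f z^*)^*) w.
Proof.
move=> [p [cp fE]]; exists (fun z => (p z^*)^*); split.
  exact: (cvg_conj (continuous_comp (@continuous_conjc _ w) cp)).
by move=> z; rewrite fE rmorphD rmorphM rmorphB/= !conjcK.
Qed.

Lemma cdiff_near f g w : (\forall z \near w, f z = g z) -> cdiff f w -> cdiff g w.
Proof.
move=> fg [p [cp fE]]; have fgw := nbhs_singleton fg.
exists (fun z => if z == w then p w else (g z - g w) / (z - w)); split.
  apply: continuousC_near cp; apply: filterS fg => z fgz.
  case: eqVneq => [->//|zw].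
  by rewrite -fgz -fgw fE addrC addKr mulrC mulKf// subr_eq0.
move=> z; case: eqVneq => [->|zw]; first by rewrite subrr mul0r addr0.
by rewrite mulrC divfK ?subr_eq0// addrC subrK.
Qed.

End complex_derivative.

Section circle_mean.
Context {R : realType}.
Local Notation RM := (measurableTypeR R).
Implicit Types (f : R[i] -> R[i]).

Definition cmean f (r : R) : R[i] := avg (fun t : RM => f (r%:C * expi (t : R))).

Lemma compact_circle (r : R) : compact [set z : R[i] | modulus z = r].
Proof.
apply: subclosed_compact (@compact_disc R r) _; last by move=> z /= ->.
have -> : [set z : R[i] | modulus z = r] = (@modulus R) @^-1` [set x | x = r] by [].
apply: closed_comp; last exact: closed_eq.
by move=> z _; apply: (@cvg_modulus _ _ (nbhs z) _ id z); exact: cvg_id.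
Qed.

Lemma modulus_circle (r t : R) : 0 <= r -> modulus (r%:C * expi t) = r.
Proof. by move=> r0; rewrite modulusM modulus_expi mulr1 modulus_real. Qed.

Lemma circle_bmeas f (r : R) : 0 <= r ->
  (forall z, modulus z = r -> {for z, continuous f}) ->
  bmeas setT (fun t : RM => f (r%:C * expi (t : R))).
Proof.
move=> r0 cf.
have cft (t : R) : {for t, continuous (fun t => f (r%:C * expi t))}.
  apply: (@continuous_comp _ _ _ (fun t => r%:C * expi t) f).
    by apply: cvgM; [exact: cvg_cst|apply: cvg_expi; exact: cvg_id].
  by apply: cf; rewrite modulus_circle.
have [M _ FM] := @compact_modulus_bounded _ _ _ f (@compact_circle r) cf.
split.
- apply: continuous_measurable_fun => t; apply: cvg_Re; exact: cft.
- apply: continuous_measurable_fun => t; apply: cvg_Im; exact: cft.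
- by exists M => t _; apply: FM; rewrite /= modulus_circle.
Qed.

(** The density formula holds for nonnegative functions; adding the bound M
    reduces f to one. *)
Lemma Rintegral_uniform (f : RM -> R) (M : R) : measurable_fun setT f ->
  (forall x, `|f x| <= M) ->
  \int[uniform_prob (@pi2_gt0 R)]_x f x =
  (pi *+ 2)^-1 * \int[@lebesgue_measure R]_(x in `[0, pi *+ 2]) f x.
Proof.
move=> mf fM.
have M0 : 0 <= M by exact: le_trans (fM 0).
have mM : measurable_fun (setT : set RM) (fun=> M) by exact: measurable_cst.
have pi0 := @pi2_gt0 R.
have iU (h : RM -> R) K : measurable_fun setT h -> (forall x, `|h x| <= K) ->
    (uniform_prob (@pi2_gt0 R)).-integrable setT (EFin \o h).
  by move=> mh hK; apply: (@bounded_integrable _ _ _ _ _ measurableT _ h K) => //;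
    exact: probability_lty.
have iL (h : RM -> R) K : measurable_fun setT h -> (forall x, `|h x| <= K) ->
    (@lebesgue_measure R).-integrable `[0, pi *+ 2]%classic (EFin \o h).
  move=> mh hK.
  apply: (@bounded_integrable _ RM R (@lebesgue_measure R) _
    (measurable_itv `[0, pi *+ 2]) (leb_itv_lty _ _) h K) => //.
  exact: measurable_funTS.
have fE (x : RM) : f x = (f x + M) - M by rewrite addrK.
have fM0 x : 0 <= f x + M by have := fM x; rewrite ler_norml => /andP[]; lra.
have mfM : measurable_fun setT (fun x => f x + M) by exact: measurable_funD.
have fMM x : `|f x + M| <= M + M by rewrite (le_trans (ler_normD _ _))// lerD// ger0_norm.
have MM (x : RM) : `|M| <= M by rewrite ger0_norm.
have posE : \int[uniform_prob (@pi2_gt0 R)]_x (f x + M) =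
  (pi *+ 2)^-1 * \int[@lebesgue_measure R]_(x in `[0, pi *+ 2]) (f x + M).
  rewrite {1}/Rintegral (@integral_uniform _ _ _ _ (fun x => (f x + M)%:E)); last 2 first.
  - exact/measurable_EFinP.
  - by move=> x; rewrite lee_fin.
  rewrite subr0 fineM//.
  apply: integrable_fin_num; first exact: measurable_itv.
  exact: (iL _ (M + M)).
have -> : \int[uniform_prob (@pi2_gt0 R)]_x f x =
    \int[uniform_prob (@pi2_gt0 R)]_x (f x + M) - M.
  rewrite RintegralD//; [|exact: (iU _ M)|exact: (iU _ M)].
  by rewrite Rintegral_cst// [fine _](congr1 fine (probability_setT _)) mulr1 addrK.
rewrite posE RintegralD//; [|exact: (iL _ M)|exact: (iL _ M)].
rewrite Rintegral_cst; last exact: measurable_itv.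
rewrite [fine _](congr1 fine (leb_itv (ltW pi0))) subr0 mulrDr.
by rewrite [_ * (M * _)]mulrC mulfK ?addrK// gt_eqF.
Qed.

Lemma avg_itv_int (F : RM -> R[i]) : bmeas setT F ->
  avg F = ((pi *+ 2)^-1)%:C * itv_int 0 (pi *+ 2) F.
Proof.
move=> [rF iF [M FM]]; rewrite /avg /itv_int /Cint.
rewrite (Rintegral_uniform (M := M) rF); last first.
  by move=> x; apply: le_trans (ler_Re_modulus _) _; exact: FM.
rewrite (Rintegral_uniform (M := M) iF); last first.
  by move=> x; apply: le_trans (ler_Im_modulus _) _; exact: FM.
by apply/eqP; rewrite eq_complex/= !mul0r subr0 addr0 !eqxx.
Qed.

(** exp (s + i t): in these coordinates an annulus is a rectangle. *)
Definition cexp (s t : R) : R[i] := (expR s)%:C * expi t.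

Lemma cexpD s t h k : cexp (s + h) (t + k) = cexp s t * cexp h k.
Proof.
rewrite /cexp expRD rmorphM/= mulrACA; congr (_ * _).
by apply/eqP; rewrite eq_complex/= cosD sinD eqxx/= [eqbLHS]addrC.
Qed.

Lemma modulus_cexp s t : modulus (cexp s t) = expR s.
Proof. by rewrite /cexp modulus_circle// expR_ge0. Qed.

Lemma cexp_approx (eta : R) : 0 < eta -> exists2 delta : R, 0 < delta &
  forall h k, `|h| < delta -> `|k| < delta ->
    modulus (cexp h k - 1 - (h +i* k)) <= eta * (`|h| + `|k|).
Proof.
move=> eta0.
have [e [e0 e1 e8]] : exists e : R, [/\ 0 < e, e <= 1 & 8 * e <= eta].
  exists (Num.min 1 (eta / 8)); split; first by rewrite lt_min ltr01/= divr_gt0.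
    by rewrite ge_min lexx.
  by rewrite -ler_pdivlMl// ge_min [8^-1 * _]mulrC lexx orbT.
have [d1 d10 H1] := is_derive_approx (is_derive_expR (0 : R)) e0.
have [d2 d20 H2] := is_derive_approx (is_derive_cos (0 : R)) e0.
have [d3 d30 H3] := is_derive_approx (is_derive_sin (0 : R)) e0.
exists (Num.min (Num.min d1 d2) (Num.min d3 e)).
  by rewrite !lt_min d10 d20 d30 e0.
move=> h k; rewrite !lt_min => /andP[/andP[h1 h2] /andP[h3 h4]] /andP[/andP[k1 k2] /andP[k3 k4]].
have := H1 h h1; rewrite add0r expR0 mul1r => E1.
have := H2 k k2; rewrite add0r cos0 sin0 oppr0 mul0r subr0 => E2.
have := H3 k k3; rewrite add0r cos0 sin0 subr0 mul1r => E3.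
have eh : `|expR h - 1| <= 2 * e.
  have -> : expR h - 1 = (expR h - 1 - h) + h by ring.
  apply: le_trans (ler_normD _ _) _; rewrite mulr2n mulrDl mul1r lerD//; last exact: ltW.
  by apply: le_trans E1 _; rewrite ler_piMr ?ltW// (lt_le_trans h4).
have eh3 : `|expR h| <= 3.
  have -> : expR h = (expR h - 1) + 1 by ring.
  by apply: le_trans (ler_normD _ _) _; rewrite normr1; lra.
have -> : cexp h k - 1 - (h +i* k) =
    (expR h)%:C * ((cos k - 1) +i* (sin k - k)) + (expR h - 1 - h)%:C
    + ('i * k%:C) * (expR h - 1)%:C.
  by apply/eqP; rewrite eq_complex/=; apply/andP; split; apply/eqP; ring.
apply: le_trans (modulusD _ _) _.
have M1 : modulus ((expR h)%:C * ((cos k - 1) +i* (sin k - k))) <= 3 * (2 * (e * `|k|)).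
  rewrite modulusM modulusR ler_pM ?modulus_ge0//.
  apply: le_trans (ler_modulus_ReIm _) _ => /=.
  by rewrite mulr2n mulrDl mul1r lerD.
have M2 : modulus (('i * k%:C) * (expR h - 1)%:C) <= `|k| * (2 * e).
  by rewrite !modulusM modulus_i mul1r !modulusR ler_wpM2l.
have M3 := modulusD ((expR h)%:C * ((cos k - 1) +i* (sin k - k))) (expR h - 1 - h)%:C.
rewrite (modulusR (expR h - 1 - h)) in M3.
have hk : 8 * e * (`|h| + `|k|) <= eta * (`|h| + `|k|) by rewrite ler_wpM2r ?addr_ge0.
apply: le_trans hk.
have : 0 <= e * `|h| by rewrite mulr_ge0// ltW.
have : 0 <= e * `|k| by rewrite mulr_ge0// ltW.
set A := modulus _ in M1 M3 *; set B := modulus _ in M2 *; set D := modulus _ in M3 *.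
by move: E1 M1 M2 M3; lra.
Qed.

Lemma rdiff_cexp f (s t : R) : cdiff f (cexp s t) -> rdiff (fun s t => f (cexp s t)) s t.
Proof.
move=> [psi [cpsi fE]]; set w := cexp s t in cpsi fE *.
exists (psi w * w) => eps eps0.
pose W := modulus w; have W0 : 0 <= W by exact: modulus_ge0.
pose P := modulus (psi w); have P0 : 0 <= P by exact: modulus_ge0.
have PW : 0 < P * W + 1 by rewrite ltr_wpDl// mulr_ge0.
have W2 : 0 < 2 * W + 1 by rewrite ltr_wpDl// mulr_ge0.
pose e := eps / 2 / (P * W + 1).
have e0 : 0 < e by rewrite !divr_gt0.
pose e' := eps / 2 / (2 * W + 1).
have e'0 : 0 < e' by rewrite !divr_gt0.
have [d1 d10 H1] := cexp_approx e0.
have [d2 d20 H2] := cexp_approx (ltr01 : 0 < (1 : R)).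
have [d3 d30 H3] := continuous_modulus_approx cpsi e'0.
pose d4 := d3 / (2 * (2 * W + 1)).
have d40 : 0 < d4 by rewrite divr_gt0// mulr_gt0.
(* d1 makes cexp h k - 1 - (h + i k) small, d2 bounds cexp h k - 1, and d4
   keeps cexp s' t' where psi is close to psi w. *)
exists (Num.min (Num.min d1 d2) d4); first by rewrite !lt_min d10 d20 d40.
move=> s' t'; set h := s' - s; set k := t' - t.
rewrite !lt_min => /andP[/andP[h1 h2] h4] /andP[/andP[k1 k2] k4].
have w'E : cexp s' t' = w * cexp h k.
  by rewrite /w -cexpD /h /k addrC subrK [t + _]addrC subrK.
rewrite -[cexp s t]/w; clearbody w.
set N := `|h| + `|k|; have N0 : 0 <= N by rewrite addr_ge0.
have E1 := H1 _ _ h1 k1; rewrite -/N in E1.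
have E2 : modulus (cexp h k - 1) <= 2 * N.
  have -> : cexp h k - 1 = (cexp h k - 1 - (h +i* k)) + (h +i* k) by rewrite subrK.
  apply: le_trans (modulusD _ _) _; rewrite mulr2n mulrDl mul1r lerD//.
    by rewrite -[leRHS]mul1r; exact: H2.
  exact: ler_modulus_ReIm.
have dw : cexp s' t' - w = w * (cexp h k - 1) by rewrite w'E mulrBr mulr1.
have E3 : modulus (psi (cexp s' t') - psi w) <= e'.
  apply/ltW/H3; rewrite dw modulusM -/W.
  have Nd : N < d4 + d4 by rewrite ltrD.
  apply: (@le_lt_trans _ _ ((2 * W + 1) * N)).
    rewrite mulrDl mul1r; apply: (@le_trans _ _ (W * (2 * N))); first by rewrite ler_wpM2l.
    have -> : W * (2 * N) = 2 * W * N by ring.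
    by rewrite lerDl; exact: N0.
  rewrite mulrC -ltr_pdivlMr//; apply: lt_le_trans Nd _.
  rewrite /d4 le_eqVlt; apply/orP; left; apply/eqP.
  by field; rewrite gt_eqF.
have -> : f (cexp s' t') - f w - psi w * w * (h +i* k) =
   psi w * w * (cexp h k - 1 - (h +i* k)) + (psi (cexp s' t') - psi w) * (w * (cexp h k - 1)).
  rewrite -dw (fE (cexp s' t')) w'E; ring.
apply: le_trans (modulusD _ _) _; rewrite !modulusM -/P -/W.
have T1 : P * W * modulus (cexp h k - 1 - (h +i* k)) <= (P * W + 1) * (e * N).
  apply: (@le_trans _ _ (P * W * (e * N))); first by rewrite ler_wpM2l// mulr_ge0.
  by rewrite mulrDl mul1r lerDl mulr_ge0// ltW.
have T2 : modulus (psi (cexp s' t') - psi w) * (W * modulus (cexp h k - 1)) <=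
    e' * ((2 * W + 1) * N).
  apply: ler_pM; rewrite ?modulus_ge0 ?mulr_ge0 ?modulus_ge0//.
  apply: (@le_trans _ _ (W * (2 * N))); first by rewrite ler_wpM2l.
  have -> : (2 * W + 1) * N = W * (2 * N) + N by ring.
  by rewrite lerDl; exact: N0.
apply: le_trans (lerD T1 T2) _.
rewrite le_eqVlt; apply/orP; left; apply/eqP.
by rewrite /e /e'; field; rewrite !gt_eqF.
Qed.

Lemma continuous_cexp1 s t : {for s, continuous (cexp ^~ t)}.
Proof.
apply: cvgM; last exact: cvg_cst.
by apply: cvg_realC; exact: continuous_expR.
Qed.

Lemma continuous_cexp2 s t : {for t, continuous (cexp s)}.
Proof. by apply: cvgM; [exact: cvg_cst|apply: cvg_expi; exact: cvg_id]. Qed.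

(** Cauchy's theorem on an annulus. In the coordinates z = exp (s + i t) it
    becomes a rectangle on which the integrals along the sides t = 0 and t = 2
    pi cancel, by periodicity; the two circles are the remaining sides. *)
Lemma cmean_const f (r1 r2 l1 l2 : R) :
  (forall z, r1 < modulus z < r2 -> cdiff f z) ->
  0 < l1 -> r1 < l1 < r2 -> 0 < l2 -> r1 < l2 < r2 -> cmean f l1 = cmean f l2.
Proof.
wlog l12 : l1 l2 / l1 <= l2.
  move=> H df l10 h1 l20 h2; have [l12|/ltW l21] := leP l1 l2; first exact: H.
  by apply/esym; exact: H.
move=> df l10 /andP[rl1 l1r] l20 /andP[rl2 l2r].
pose g s t := f (cexp s t).
have ls s : ln l1 <= s <= ln l2 -> r1 < expR s < r2.
  move=> /andP[s1 s2]; apply/andP; split.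
    by apply: lt_le_trans rl1 _; rewrite -[leLHS]lnK ?posrE// ler_expR.
  by apply: le_lt_trans l2r; rewrite -[leRHS]lnK ?posrE// ler_expR.
have dg s t : ln l1 <= s <= ln l2 -> cdiff f (cexp s t).
  by move=> /ls h; apply: df; rewrite modulus_cexp.
have cg : rcont g (ln l1) (ln l2) 0 (pi *+ 2).
  move=> s t sl _; have cf := cdiff_continuous (dg s t sl); split.
    exact: (continuous_comp (@continuous_cexp1 s t) cf).
  exact: (continuous_comp (@continuous_cexp2 s t) cf).
have lnl12 : ln l1 <= ln l2 by rewrite ler_ln ?posrE.
have pi0 := @pi2_gt0 R.
have := @rect_eq0 R g (ln l1) (ln l2) 0 (pi *+ 2) lnl12 (ltW pi0) cg
  (fun s t sl _ => rdiff_cexp (dg s t sl)).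
rewrite /rect (_ : (g ^~ 0) = (g ^~ (pi *+ 2))); last first.
  by apply/funext => s; rewrite /g /cexp /expi cos2pi sin2pi cos0 sin0.
rewrite subrr add0r => /eqP; rewrite mulf_eq0.
have /negbTE -> /= : 'i%C != 0 :> R[i].
  by rewrite -modulus_gt0 modulus_i.
rewrite subr_eq0 => /eqP IE.
have bm l : 0 < l -> r1 < l < r2 -> bmeas setT (fun t : RM => f (l%:C * expi (t : R))).
  move=> l0 rl; apply: circle_bmeas; first exact: ltW.
  by move=> z zl; apply: cdiff_continuous; apply: df; rewrite zl.
rewrite /cmean !avg_itv_int; [|by apply: bm; rewrite ?rl2|by apply: bm; rewrite ?rl1].
congr (_ * _).
have gE l : 0 < l ->
    itv_int 0 (pi *+ 2) (fun t : RM => f (l%:C * expi (t : R))) = itv_int 0 (pi *+ 2) (g (ln l)).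
  by move=> l0; congr (itv_int _ _ _); apply/funext => t; rewrite /g /cexp lnK.
exact: (etrans (gE l1 l10) (etrans (esym IE) (esym (gE l2 l20)))).
Qed.

Lemma cvg_cmean f (rho l : R) (l_ : nat -> R) : rho < 1 ->
  (forall z, modulus z < 1 -> {for z, continuous f}) ->
  (forall k, 0 <= l_ k <= rho) -> 0 <= l <= rho -> l_ @ \oo --> l ->
  (fun k => cmean f (l_ k)) @ \oo --> cmean f l.
Proof.
move=> rho1 cf l_rho lrho l_l.
have cf' z : modulus z <= rho -> {for z, continuous f}.
  by move=> zr; apply: cf; exact: le_lt_trans rho1.
have [M _ FM] := @compact_modulus_bounded _ _ _ f (@compact_disc R rho) cf'.
apply: (@cvg_Cint _ RM R _ setT measurableT (probability_lty _) _ _ M).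
- move=> k; have /andP[l0 l1] := l_rho k; apply: circle_bmeas => // z zl.
  by apply: cf'; rewrite zl.
- have /andP[l0 l1] := lrho; apply: circle_bmeas => // z zl.
  by apply: cf'; rewrite zl.
- have /andP[l0 l1] := lrho => t _.
  apply: continuous_cvg; first by apply: cf'; rewrite modulus_circle.
  by apply: cvgM; [exact: cvg_realC|exact: cvg_cst].
- move=> k t _; have /andP[l0 l1] := l_rho k.
  by apply: FM; rewrite /= modulus_circle.
Qed.

(** By continuity of the mean in the radius, the circles may be boundaries of
    the annulus, and r1 may be 0. *)
Lemma cmean_closed f (r1 r2 l : R) : 0 <= r1 -> r1 <= l <= r2 -> l < 1 ->
  (forall z, modulus z < 1 -> {for z, continuous f}) ->
  (forall z, r1 < modulus z < r2 -> cdiff f z) ->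
  cmean f l = cmean f r1.
Proof.
move=> r10 + + cf df.
have inner x : r1 < x < r2 -> x < 1 -> cmean f x = cmean f r1.
  move=> /andP[r1x xr2] x1.
  pose l_ (k : nat) := r1 + (x - r1) * harmonic k.
  have l_x k : r1 < l_ k <= x.
    rewrite /l_ ltrDl mulr_gt0 ?invr_gt0// ?subr_gt0//=.
    rewrite -lerBrDl ler_piMr// ?subr_ge0 ?(ltW r1x)//.
    by rewrite invf_le1// ler1n.
  have l_cvg : l_ @ \oo --> r1.
    rewrite -[X in _ --> X]addr0 -(mulr0 (x - r1)).
    apply: cvgD; first exact: cvg_cst.
    by apply: cvgM; [exact: cvg_cst|exact: cvg_harmonic].
  have := @cvg_cmean f x r1 l_ x1 cf _ _ l_cvg.
  have -> : (fun k => cmean f (l_ k)) = fun=> cmean f x.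
    apply/funext => k; have /andP[k1 k2] := l_x k.
    apply: (cmean_const df); rewrite ?k1 ?(le_lt_trans k2 xr2) ?r1x ?xr2//.
      exact: le_lt_trans k1.
    exact: le_lt_trans r1x.
  move=> H; apply: cvgC_unique (H _ _); first exact: cvg_cst.
    move=> k; have /andP[k1 ->] := l_x k; rewrite andbT.
    exact: le_trans (ltW k1).
  by rewrite r10 ltW.
move=> /andP[]; rewrite le_eqVlt => /predU1P[<-//|r1l].
rewrite le_eqVlt => /predU1P[lr2|lr2] l1; last by apply: inner; rewrite ?r1l.
pose l_ (k : nat) := l - (l - r1) * harmonic k.+1.
have hk k : 0 < (harmonic k.+1 : R) < 1.
  by rewrite /harmonic/= invr_gt0 ltr0n/= invf_lt1// ltr1n.
have lr1 : 0 < l - r1 by rewrite subr_gt0.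
have l_x k : r1 < l_ k < l.
  have /andP[h1 h2] := hk k.
  rewrite /l_ ltrBlDr ltrDl mulr_gt0// andbT ltrBrDl -ltrBrDr.
  by rewrite -[ltRHS]mulr1 ltr_pM2l.
have l_cvg : l_ @ \oo --> l.
  rewrite -[X in _ --> X]subr0 -(mulr0 (l - r1)).
  apply: cvgB; first exact: cvg_cst.
  apply: cvgM; first exact: cvg_cst.
  by rewrite (@cvg_shiftS R (@harmonic R)); exact: cvg_harmonic.
have := @cvg_cmean f l l l_ l1 cf _ _ l_cvg.
have -> : (fun k => cmean f (l_ k)) = fun=> cmean f r1.
  apply/funext => k; have /andP[k1 k2] := l_x k.
  by apply: inner; [rewrite k1 -lr2|exact: lt_trans k2 l1].
move=> H; apply: cvgC_unique (H _ _) _; last exact: cvg_cst.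
  move=> k; have /andP[k1 k2] := l_x k; rewrite (ltW k2) andbT.
  exact: le_trans (ltW k1).
by rewrite lexx andbT (le_trans r10)// ltW.
Qed.

Lemma modulus_cmean f (r M : R) : 0 <= r ->
  (forall z, modulus z = r -> {for z, continuous f}) ->
  (forall z, modulus z = r -> modulus (f z) <= M) -> modulus (cmean f r) <= 2 * M.
Proof.
move=> r0 cf fM; apply: modulus_Cint_prob; first exact: circle_bmeas.
by move=> t; apply: fM; rewrite modulus_circle.
Qed.

(** The mean does not depend on the radius beyond modulus w, and tends to 0 at
    infinity. *)
Lemma cmean_cauchy_kernel (w : R[i]) (r : R) : modulus w < r ->
  cmean (fun z => w / (z - w)) r = 0.
Proof.
move=> wr; have r0 : 0 < r by exact: le_lt_trans (modulus_ge0 w) wr.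
have neq z : modulus w < modulus z -> z - w != 0.
  by rewrite subr_eq0; apply: contraTneq => ->; rewrite ltxx.
have df z : modulus w < modulus z -> cdiff (fun z => w / (z - w)) z.
  move=> zw; apply: cdiffM; first exact: cdiff_cst.
  apply: (@cdiff_comp _ (fun z => z^-1) (fun z => z - w)).
    by apply: cdiffD; [exact: cdiff_id|exact: cdiff_cst].
  by apply: cdiff_inv; exact: neq.
apply/eqP; rewrite -modulus_eq0 eq_le modulus_ge0 andbT.
apply/ler_addgt0Pl => e e0; rewrite addr0.
(* Chosen so that modulus w / (L - modulus w) <= e / 2. *)
pose L := Num.max (modulus w + 1 + 2 * modulus w / e) r.
have L0 : 0 < L by rewrite lt_max r0 orbT.
have wL : modulus w < L by rewrite lt_max wr orbT.
rewrite (@cmean_const _ (modulus w) (L + 1) r L)//; last 3 first.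
- by move=> z /andP[zw _]; exact: df.
- by rewrite wr ltr_pwDr// le_max lexx orbT.
- by rewrite wL ltr_pwDr.
have -> : e = 2 * (e / 2) by field.
apply: modulus_cmean; first exact: ltW.
  by move=> z zL; apply: cdiff_continuous; apply: df; rewrite zL.
move=> z zL; rewrite modulusM modulusV.
have zw : L - modulus w <= modulus (z - w).
  by rewrite -zL lerBlDr -{1}(subrK w z) modulusD.
have Lw : 1 + 2 * modulus w / e <= L - modulus w.
  by rewrite lerBrDl addrA le_max lexx.
have Lw0 : 0 < modulus (z - w).
  apply: lt_le_trans zw; apply: lt_le_trans Lw.
  by rewrite ltr_pwDl// divr_ge0 ?mulr_ge0 ?modulus_ge0// ltW.
rewrite ler_pdivrMr//.
have : e / 2 * (1 + 2 * modulus w / e) <= e / 2 * modulus (z - w).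
  by rewrite ler_pM2l ?divr_gt0//; exact: le_trans Lw zw.
apply: le_trans; rewrite mulrDr.
have -> : e / 2 * (2 * modulus w / e) = modulus w by field; rewrite gt_eqF.
by rewrite mulr1 lerDr divr_ge0// ltW.
Qed.

(** With psi the difference quotient of f at w, the integrand is f(w) (1 + w /
    (z - w)) + z psi(z). The last term is continuous, and holomorphic except
    at w: its circle mean is constant on either side of modulus w, hence equal
    to its value 0 at the center. *)
Lemma cauchy_disc f (w : R[i]) (r : R) :
  (forall z, modulus z < 1 -> cdiff f z) -> modulus w < r -> r < 1 ->
  f w = cmean (fun z => f z * (z / (z - w))) r.
Proof.
move=> df wr r1; have r0 : 0 < r by exact: le_lt_trans (modulus_ge0 w) wr.
have w1 : modulus w < 1 by exact: lt_trans r1.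
have [psi [cpsi fE]] := df w w1.
pose F z := z * psi z.
have neq z : modulus w != modulus z -> z != w.
  by apply: contraNneq => ->.
have dpsi z : modulus z < 1 -> z != w -> cdiff psi z.
  move=> z1 zw.
  apply: (@cdiff_near _ (fun z => (f z - f w) / (z - w))).
    apply: filterS (near_neqC zw) => z' z'w.
    by rewrite fE addrC addKr mulrC mulKf// subr_eq0.
  apply: cdiffM.
    by apply: cdiffD; [exact: df|exact: cdiff_cst].
  apply: (@cdiff_comp _ (fun z => z^-1) (fun z => z - w)).
    by apply: cdiffD; [exact: cdiff_id|exact: cdiff_cst].
  by apply: cdiff_inv; rewrite subr_eq0.
have cF z : modulus z < 1 -> {for z, continuous F}.
  move=> z1; have cp : {for z, continuous psi}.
    have [->|zw] := eqVneq z w; first exact: cpsi.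
    by apply: cdiff_continuous; exact: dpsi.
  exact: (continuousC_M (@continuousC_id _ z) cp).
have dF z : modulus z < 1 -> z != w -> cdiff F z.
  by move=> z1 zw; apply: cdiffM; [exact: cdiff_id|exact: dpsi].
have F0 : cmean F r = 0.
  have E1 : cmean F r = cmean F (modulus w).
    apply: (@cmean_closed F (modulus w) 1 r (modulus_ge0 w) _ r1 cF).
      by rewrite !ltW.
    by move=> z /andP[wz z1]; apply: dF => //; apply: neq; rewrite lt_eqF.
  have E2 : cmean F (modulus w) = cmean F 0.
    apply: (@cmean_closed F 0 (modulus w) (modulus w) (lexx 0) _ w1 cF).
      by rewrite modulus_ge0 lexx.
    move=> z /andP[wz zw]; apply: dF => //; first exact: lt_trans w1.
    by apply: neq; rewrite gt_eqF.
  rewrite E1 E2.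
  rewrite /cmean (_ : (fun _ => _) = fun=> 0) ?[LHS]Cint_cst_prob//.
  by apply/funext => t; rewrite /F !mul0r.
have zr z : modulus z = r -> z - w != 0.
  by move=> zE; rewrite subr_eq0; apply: neq; rewrite zE lt_eqF.
have E z : modulus z = r -> f z * (z / (z - w)) = f w * (1 + w / (z - w)) + F z.
  by move=> zE; rewrite /F fE; field; exact: zr.
have ck z : modulus z = r -> {for z, continuous (fun z => w / (z - w))}.
  move=> zE; have zw := zr z zE.
  exact: (continuousC_M (@continuousC_cst _ _ w z) (continuousC_V
    (continuousC_B (@continuousC_id _ z) (@continuousC_cst _ _ w z)) zw)).
have bk : bmeas setT (fun t : RM => w / (r%:C * expi (t : R) - w)).
  by apply: (@circle_bmeas (fun z => w / (z - w))); first exact: ltW.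
have bF : bmeas setT (fun t : RM => F (r%:C * expi (t : R))).
  by apply: circle_bmeas; [exact: ltW|move=> z zE; apply: cF; rewrite zE].
have -> : cmean (fun z => f z * (z / (z - w))) r =
    f w * (1 + cmean (fun z => w / (z - w)) r) + cmean F r.
  rewrite /cmean /avg.
  under eq_Cint do rewrite E ?modulus_circle ?(ltW r0)//.
  have P1 := @probability_lty R _ _ (uniform_prob (@pi2_gt0 R)).
  rewrite (Cint_D measurableT P1)//; last first.
    apply: bmeasZ => //; apply: bmeasD => //; exact: bmeas_cst.
  rewrite (Cint_Z measurableT P1); last first.
    apply: bmeasD => //; exact: bmeas_cst.
  rewrite (Cint_D measurableT P1)//; last exact: bmeas_cst.
  by rewrite Cint_cst_prob.
by rewrite F0 cmean_cauchy_kernel// !addr0 mulr1.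
Qed.

Lemma mean_value f (r : R) : (forall z, modulus z < 1 -> cdiff f z) ->
  0 < r < 1 -> cmean f r = f 0.
Proof.
move=> df /andP[r0 r1]; rewrite (@cauchy_disc f 0 r)// ?modulus0//.
apply: eq_Cint => t _; rewrite subr0 divff ?mulr1//.
by rewrite -modulus_gt0 modulus_circle// ltW.
Qed.

End circle_mean.

(** * Cauchy's formula and polynomial approximation on the polydisc *)

Section several_variables.
Context {R : realType}.
Local Notation RM := (measurableTypeR R).
Implicit Types (f g : R[i] -> R[i]).

Definition setc n (z : 'rV[R[i]]_n) (i : 'I_n) (x : R[i]) : 'rV[R[i]]_n :=
  \row_j (if j == i then x else z 0 j).

Lemma setcE n (z : 'rV[R[i]]_n) i x j : setc z i x 0 j = if j == i then x else z 0 j.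
Proof. by rewrite mxE. Qed.

Lemma setc_id n (z : 'rV[R[i]]_n) i : setc z i (z 0 i) = z.
Proof. by apply/rowP => j; rewrite setcE; case: eqP => [->|]. Qed.

Lemma setc_set n (z : 'rV[R[i]]_n) i x y : setc (setc z i x) i y = setc z i y.
Proof. by apply/rowP => j; rewrite !setcE; case: eqVneq. Qed.

Lemma setc_shift n (z : 'rV[R[i]]_n) i x y :
  setc z i y = (y - x) *: delta_mx 0 i + setc z i x.
Proof.
apply/rowP => j; rewrite !mxE eqxx/=; case: eqVneq => _.
  by rewrite mulr1 subrK.
by rewrite mulr0 add0r.
Qed.

Lemma cdiff_slice n (f : 'rV[R[i]]_n -> R[i]) z i x :
  differentiable f (setc z i x) -> cdiff (fun y => f (setc z i y)) x.
Proof.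
move=> df; have := @diff_derivable _ _ _ f _ (delta_mx 0 i) df.
rewrite /derivable; set D := lim _.
move=> FD; exists (fun y => if y == x then D else (f (setc z i y) - f (setc z i x)) / (y - x)).
split; last first.
  move=> y; case: eqVneq => [->|yx]; first by rewrite subrr mul0r addr0.
  by rewrite mulrC divfK ?subr_eq0// addrC subrK.
rewrite /prop_for /continuous_at eqxx.
apply/(@cvgC_modulus _ _ (nbhs x)); apply/cvgrPdist_lt => e e0.
move/cvgC_modulus/cvgrPdist_lt : FD => /(_ _ e0) /nbhs_ballP[d /= d0 H].
apply/nbhs_ballP; exists d => //= y; rewrite -ball_normE/= => yd.
case: eqVneq => [_|yx]; first by rewrite subrr modulus0 subr0 normr0.
have := H (y - x); rewrite -ball_normE/= sub0r normrN distrC => /(_ yd).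
rewrite subr_eq0 => /(_ yx); rewrite /= -setc_shift /GRing.scale/=.
by rewrite [_^-1 * _]mulrC.
Qed.

Lemma polydisc_setc n (z : 'rV[R[i]]_n) i x :
  polydisc z -> modulus x < 1 -> polydisc (setc z i x).
Proof. by move=> zp x1 j; rewrite setcE; case: ifPn. Qed.

Lemma holomorphic_slice n (f : 'rV[R[i]]_n -> R[i]) z i x :
  holomorphic f -> polydisc z -> modulus x < 1 -> cdiff (fun y => f (setc z i y)) x.
Proof. by move=> hf zp x1; apply: cdiff_slice; apply: hf; exact: polydisc_setc. Qed.

Lemma holomorphic_continuous n (f : 'rV[R[i]]_n -> R[i]) :
  holomorphic f -> forall z, polydisc z -> {for z, continuous f}.
Proof. by move=> hf z zp; apply: differentiable_continuous; exact: hf. Qed.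

Lemma rpoint_set_angle n (a : 'I_n -> R) i s (t : n.-tuple RM) :
  rpoint a (set_angle i s t) = setc (rpoint a t) i ((a i)%:C * expi s).
Proof.
apply/rowP => j; rewrite setcE !mxE tnth_set_angle.
by case: eqVneq => [->|].
Qed.

Lemma bmeas_tnth n (i : 'I_n) (F : RM -> R[i]) :
  bmeas setT F -> bmeas setT (fun t : n.-tuple RM => F (tnth t i)).
Proof. exact: (bmeas_comp (measurable_tnth i)). Qed.

(** The Cauchy kernel zeta / (zeta - w) at zeta = r e^(i s). *)
Definition ckern (r : R) (w : R[i]) (s : R) : R[i] := r%:C * expi s / (r%:C * expi s - w).

Lemma circle_sub_neq0 (r : R) (w : R[i]) s : modulus w < r -> r%:C * expi s - w != 0.
Proof.
move=> wr; rewrite subr_eq0; apply: contraTneq wr => <-.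
by rewrite -leNgt modulusM modulus_expi mulr1 modulusR ler_norm.
Qed.

Lemma bmeas_ckern (r : R) (w : R[i]) : modulus w < r ->
  bmeas setT (fun s : RM => ckern r w (s : R)).
Proof.
move=> wr; have r0 : 0 < r by exact: le_lt_trans (modulus_ge0 w) wr.
apply: (@circle_bmeas _ (fun z => z / (z - w))); first exact: ltW.
move=> z zr; have zw : z - w != 0.
  by rewrite subr_eq0; apply: contraTneq wr => <-; rewrite zr ltxx.
exact: (continuousC_M (@continuousC_id _ z) (continuousC_V
    (continuousC_B (@continuousC_id _ z) (@continuousC_cst _ _ w z)) zw)).
Qed.

Lemma slice_cauchy n (f : 'rV[R[i]]_n -> R[i]) z i (r : R) :
  holomorphic f -> polydisc z -> modulus (z 0 i) < r -> r < 1 ->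
  avg (fun s => f (setc z i (r%:C * expi s)) * ckern r (z 0 i) s) = f z.
Proof.
move=> hf zp zr r1; rewrite -[in RHS](setc_id z i).
rewrite (@cauchy_disc _ (fun y => f (setc z i y)) _ r)//.
by move=> y y1; exact: holomorphic_slice.
Qed.

(** Interpolates between the point w, for m = 0, and the torus of radius r,
    for m = n. *)
Definition mix n (m : nat) (r : R) (w : 'rV[R[i]]_n) (t : n.-tuple RM) : 'rV[R[i]]_n :=
  \row_i (if (i < m)%N then r%:C * expi (tnth t i) else w 0 i).

Lemma bmeas_mix n (f : 'rV[R[i]]_n -> R[i]) m (r : R) (w : 'rV[R[i]]_n) :
  holomorphic f -> 0 <= r < 1 -> (forall i, modulus (w 0 i) <= r) ->
  bmeas setT (fun t => f (mix m r w t)).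
Proof.
move=> hf /andP[r0 r1] wr.
apply: (bmeas_polydisc_comp r1) (holomorphic_continuous hf).
  move=> t i; rewrite mxE; case: ifPn => // _.
  by rewrite modulusM modulus_expi mulr1 modulus_real.
move=> t u ut i; rewrite mxE; under eq_fun do rewrite mxE.
case: ifPn => _; last exact: cvg_cst.
by apply: cvgM; [exact: cvg_cst|exact: cvg_expi].
Qed.

Lemma bmeas_ckern_prod n (P : pred 'I_n) (r : R) (w : 'rV[R[i]]_n) :
  (forall i, modulus (w 0 i) < r) ->
  bmeas setT (fun t : n.-tuple RM => \prod_(i < n | P i) ckern r (w 0 i) (tnth t i)).
Proof.
move=> wr; apply: bmeas_prod => i _.
by apply: (bmeas_tnth i (F := fun s : RM => ckern r (w 0 i) (s : R))); exact: bmeas_ckern.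
Qed.

(** One coordinate after the other: averaging in the m-th angle reduces the
    step to the formula on a disc. *)
Lemma cauchy_mix n (f : 'rV[R[i]]_n -> R[i]) (w : 'rV[R[i]]_n) (r : R) m :
  holomorphic f -> (forall i, modulus (w 0 i) < r) -> r < 1 -> 0 < r -> (m <= n)%N ->
  f w = Tint (fun t => f (mix m r w t) *
              \prod_(i < n | (i < m)%N) ckern r (w 0 i) (tnth t i)).
Proof.
move=> hf wr r1 r0; have wr' i : modulus (w 0 i) <= r by exact: ltW.
have r01 : 0 <= r < 1 by rewrite ltW.
elim: m => [|m ih] mn.
  rewrite -[LHS](Cint_cst_prob (torus_measure R n)); apply: eq_Cint => t _.
  rewrite big_pred0// mulr1; congr f; apply/rowP => i; by rewrite mxE.
rewrite ih; last exact: ltnW.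
pose i0 := Ordinal mn.
rewrite [RHS](Tint_avg i0); last first.
  by apply: bmeasM; [exact: bmeas_mix|exact: bmeas_ckern_prod].
apply: eq_Cint => t _.
have mixp : polydisc (mix m r w t).
  move=> i; rewrite mxE; case: ifPn => _; last exact: lt_trans r1.
  by rewrite modulusM modulus_expi mulr1 modulus_real// ltW.
have mixi0 : mix m r w t 0 i0 = w 0 i0 by rewrite mxE /= ltnn.
rewrite -(@slice_cauchy n f (mix m r w t) i0 r hf mixp)//; last by rewrite mixi0.
rewrite /avg mulrC -Cint_Z//; last 2 first.
- exact: probability_lty.
- apply: bmeasM.
    apply: (@circle_bmeas _ (fun y => f (setc (mix m r w t) i0 y))); first exact: ltW.
    by move=> y yr; apply: cdiff_continuous; apply: holomorphic_slice => //; rewrite yr.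
  by rewrite mixi0; exact: bmeas_ckern.
apply: eq_Cint => s _; rewrite mulrC -mulrA; congr (_ * _).
  congr f; apply/rowP => j; rewrite !mxE tnth_set_angle.
  case: eqVneq => [->/=|ji]; first by rewrite ltnSn.
  by rewrite ltnS [in RHS]leq_eqVlt -[(j : nat) == m]/(j == i0) (negbTE ji).
rewrite [in RHS](bigD1 i0) ?ltnSn//= tnth_set_angle eqxx mixi0; congr (_ * _).
apply: eq_big => [j|j ji].
  rewrite ltnS [in RHS]leq_eqVlt -[(j : nat) == m]/(j == i0).
  by case: eqVneq => [->|]; rewrite ?ltnn ?andbT ?andbF.
by rewrite tnth_set_angle; case: eqVneq => // ji0; move: ji; rewrite ji0 ltnn.
Qed.

Lemma cauchy_polydisc n (f : 'rV[R[i]]_n -> R[i]) (w : 'rV[R[i]]_n) (r : R) :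
  holomorphic f -> (forall i, modulus (w 0 i) < r) -> 0 < r < 1 ->
  f w = Tint (fun t => f (rpoint (fun=> r) t) * \prod_(i < n) ckern r (w 0 i) (tnth t i)).
Proof.
move=> hf wr /andP[r0 r1]; rewrite (cauchy_mix hf wr r1 r0 (leqnn n)).
apply: eq_Cint => t _; congr (f _ * _); last by apply: eq_bigl => i; rewrite ltn_ord.
by apply/rowP => i; rewrite !mxE ltn_ord.
Qed.

(** By induction, writing 1 - (1 - x) P as (1 - P) + x P. *)
Lemma prod1B_approx (I : Type) (s : seq I) (x : I -> R[i]) (e : R) :
  0 <= e -> (forall i, modulus (x i) <= e) ->
  modulus (1 - \prod_(i <- s) (1 - x i)) <= (1 + e) ^+ size s - 1.
Proof.
move=> e0 xe; elim: s => [|i s ih].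
  by rewrite big_nil/= subrr modulus0 expr0 subrr.
rewrite big_cons /= exprS; set P := \prod_(_ <- _) _ in ih *.
have -> : 1 - (1 - x i) * P = (1 - P) + x i * (1 - (1 - P)) by ring.
apply: le_trans (modulusD _ _) _; rewrite modulusM.
have h1 : modulus (1 - (1 - P)) <= (1 + e) ^+ size s.
  apply: le_trans (modulusB _ _) _; rewrite modulus1.
  by move: ih; lra.
have h2 : modulus (x i) * modulus (1 - (1 - P)) <= e * (1 + e) ^+ size s.
  by apply: ler_pM; rewrite ?modulus_ge0.
by move: ih h2; lra.
Qed.

Definition polyval n N (c : {ffun 'I_n -> 'I_N.+1} -> R[i]) (z : 'rV[R[i]]_n) : R[i] :=
  \sum_(a : {ffun 'I_n -> 'I_N.+1}) c a * \prod_(i < n) z 0 i ^+ a i.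

(** The coefficients are those of the power series of f, as integrals over a
    torus of radius between rho and 1. Cutting the geometric series of each
    Cauchy kernel at N multiplies the kernel by the product of the 1 - (z_i /
    zeta_i)^(N+1), which is uniformly close to 1. *)
Lemma polynomial_approx n (f : 'rV[R[i]]_n -> R[i]) (rho e : R) :
  holomorphic f -> 0 <= rho < 1 -> 0 < e ->
  exists N (c : {ffun 'I_n -> 'I_N.+1} -> R[i]), forall z : 'rV[R[i]]_n,
    (forall i, modulus (z 0 i) <= rho) -> modulus (f z - polyval c z) <= e.
Proof.
move=> hf /andP[rho0 rho1] e0.
pose r := (1 + rho) / 2.
have r1 : r < 1 by rewrite /r; lra.
have rr : rho < r by rewrite /r; lra.
have r0 : 0 < r by exact: le_lt_trans rr.
pose q := rho / r.
have q0 : 0 <= q by rewrite divr_ge0// ltW.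
have q1 : q < 1 by rewrite ltr_pdivrMr ?mul1r.
have [M M0 fM] := @compact_modulus_bounded _ _ _ f (@compact_polydisc _ n r)
  (fun z Kz => holomorphic_continuous hf (fun i => le_lt_trans (Kz i) r1)).
pose B := M * ((1 - q)^-1) ^+ n.
have B0 : 0 < B by rewrite mulr_gt0// exprn_gt0// invr_gt0 subr_gt0.
have qN : (fun N : nat => 1 + q ^+ N.+1) @ \oo --> (1 + 0 : R).
  apply: cvgD; first exact: cvg_cst.
  rewrite (@cvg_shiftS R (fun N => q ^+ N)); apply: cvg_expr.
  by rewrite ger0_norm.
(* B bounds f times the Cauchy kernels on the torus of radius r; the rest is
   the bound of prod1B_approx for the truncation factors. *)
have [N HN] : exists N : nat, 2 * (B * ((1 + q ^+ N.+1) ^+ n - 1)) <= e.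
  have : (fun N : nat => 2 * (B * ((1 + q ^+ N.+1) ^+ n - 1)) : R) @ \oo -->
         2 * (B * ((1 + 0) ^+ n - 1)).
    apply: cvgM; first exact: cvg_cst.
    apply: cvgM; first exact: cvg_cst.
    apply: cvgB; last exact: cvg_cst.
    exact: (continuous_cvg _ (@exprn_continuous R n (1 + 0)) qN).
  rewrite addr0 expr1n subrr !mulr0 => /cvgrPdist_lt /(_ _ e0) /filter_ex[N].
  by rewrite sub0r normrN => /ltW /(le_trans (ler_norm _)); exists N.
pose zeta (t : n.-tuple RM) i := r%:C * expi (tnth t i).
have zeta0 t i : zeta t i != 0.
  by rewrite -modulus_gt0 modulusM modulus_expi mulr1 modulus_real// ltW.
have mzeta t i : modulus (zeta t i) = r by rewrite /zeta modulus_circle// ltW.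
pose c (a : {ffun 'I_n -> 'I_N.+1}) :=
  Tint (fun t => f (rpoint (fun=> r) t) * \prod_(i < n) (zeta t i)^-1 ^+ a i).
have bf : bmeas setT (fun t => f (rpoint (fun=> r) t)).
  apply: (bmeas_rpoint r1) (holomorphic_continuous hf) => i.
  by rewrite lexx ltW.
have bz a i : bmeas setT (fun t : n.-tuple RM => (zeta t i)^-1 ^+ a).
  apply: (bmeas_tnth i (F := fun s : RM => (r%:C * expi (s : R))^-1 ^+ a)).
  apply: (@circle_bmeas _ (fun z => z^-1 ^+ a)); first exact: ltW.
  move=> z zr; have z0 : z != 0 by rewrite -modulus_gt0 zr.
  exact: (@continuousC_X _ _ _ z a (continuousC_V (@continuousC_id _ z) z0)).
exists N, c => z zrho.
have zr i : modulus (z 0 i) < r by exact: le_lt_trans rr.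
have P1 := @probability_lty R _ _ (torus_measure R n).
have -> : polyval c z = Tint (fun t => f (rpoint (fun=> r) t) *
    \prod_(i < n) \sum_(k < N.+1) (z 0 i / zeta t i) ^+ k).
  rewrite /polyval /c /Tint.
  under eq_bigr => a _.
    rewrite mulrC -(Cint_Z measurableT P1); last first.
      by apply: bmeasM => //; apply: bmeas_prod => i _; exact: bz.
    over.
  rewrite -(Cint_sum measurableT P1); last first.
    move=> a _; apply: bmeasZ; apply: bmeasM => //.
    by apply: bmeas_prod => i _; exact: bz.
  apply: eq_Cint => t _; rewrite bigA_distr_bigA/= mulr_sumr.
  apply: eq_bigr => a _; rewrite mulrCA -big_split/=.
  by congr (_ * _); apply: eq_bigr => i _; rewrite exprMn.
rewrite (cauchy_polydisc hf zr); last by rewrite r0.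
rewrite /Tint -(Cint_B measurableT P1); last 2 first.
- by apply: bmeasM => //; exact: bmeas_ckern_prod.
- apply: bmeasM => //; apply: bmeas_prod => i _; apply: bmeas_sum => k _.
  under eq_fun do rewrite exprMn.
  by apply: bmeasZ; exact: bz.
apply: le_trans HN; apply: modulus_Cint_prob.
  apply: bmeasB.
    by apply: bmeasM => //; exact: bmeas_ckern_prod.
  apply: bmeasM => //; apply: bmeas_prod => i _; apply: bmeas_sum => k _.
  under eq_fun do rewrite exprMn.
  by apply: bmeasZ; exact: bz.
move=> t; pose x i := z 0 i / zeta t i.
have xq i : modulus (x i) <= q.
  by rewrite modulusM modulusV mzeta ler_pM2r ?invr_gt0.
have x1 i : 1 - x i != 0.
  rewrite subr_eq0 eq_sym; apply: contraTneq (xq i) => ->.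
  by rewrite modulus1 -ltNge.
have kE i : ckern r (z 0 i) (tnth t i) = (1 - x i)^-1.
  rewrite /ckern -/(zeta t i) /x.
  have := circle_sub_neq0 (tnth t i) (zr i); rewrite -/(zeta t i) => h.
  by field; rewrite h zeta0.
have sE i : \sum_(k < N.+1) x i ^+ k = (1 - x i)^-1 * (1 - x i ^+ N.+1).
  by apply: (mulfI (x1 i)); rewrite mulVKf// -[1 - x i]opprB mulNr -subrX1 opprB.
have -> : f (rpoint (fun=> r) t) * \prod_(i < n) ckern r (z 0 i) (tnth t i) -
    f (rpoint (fun=> r) t) * \prod_(i < n) \sum_(k < N.+1) (z 0 i / zeta t i) ^+ k =
    f (rpoint (fun=> r) t) * (\prod_(i < n) (1 - x i)^-1) *
    (1 - \prod_(i < n) (1 - x i ^+ N.+1)).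
  under eq_bigr do rewrite kE.
  under [X in _ - _ * X]eq_bigr do rewrite sE.
  by rewrite big_split/=; ring.
rewrite 2!modulusM /B; apply: ler_pM; rewrite ?mulr_ge0 ?modulus_ge0//.
  apply: ler_pM; rewrite ?modulus_ge0//.
    by apply: fM => i; rewrite modulus_rpoint// ltW.
  rewrite modulus_prod -[X in _ ^+ X](card_ord n) -prodr_const.
  apply: ler_prod => i _; rewrite modulus_ge0/= modulusV lef_pV2 ?posrE ?subr_gt0//.
    rewrite lerBlDr -{1}(@modulus1 R) -{1}(subrK (x i) 1).
    by apply: le_trans (modulusD _ _) _; rewrite lerD2l.
  by rewrite modulus_gt0.
have := @prod1B_approx _ (enum 'I_n) (fun i => x i ^+ N.+1) (q ^+ N.+1).
rewrite size_enum_ord big_enum/=; apply; first exact: exprn_ge0.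
by move=> i; rewrite modulusX lerXn2r ?nnegrE// modulus_ge0.
Qed.

End several_variables.

(** * Holomorphy of Cauchy transforms *)

Section quadratic_differentiability.
Context {R : realType}.
Local Notation C := R[i].

Definition dotl n (l : 'I_n -> C) (h : 'rV[C]_n) : C := \sum_(j < n) h 0 j * l j.

Lemma dotl_is_linear n (l : 'I_n -> C) : linear (dotl l).
Proof.
move=> a u v; rewrite /dotl scaler_sumr -big_split/=; apply: eq_bigr => j _.
by rewrite !mxE mulrDl /GRing.scale/= mulrA.
Qed.

HB.instance Definition _ n (l : 'I_n -> C) :=
  GRing.isLinear.Build C 'rV[C]_n C *:%R (dotl l) (dotl_is_linear l).

Lemma continuous_dotl n (l : 'I_n -> C) : continuous (dotl l).
Proof.
move=> h; rewrite /dotl; elim: (index_enum _) => [|j s ih].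
  rewrite (_ : (fun _ => _) = fun=> 0); first exact: continuousC_cst.
  by apply/funext => y; rewrite big_nil.
rewrite (_ : (fun _ => _) = fun y : 'rV[C]_n => y 0 j * l j + \sum_(k <- s) y 0 k * l k).
  apply: (continuousC_D _ ih).
  exact: (continuousC_M (@coord_continuous _ _ _ 0 j h) (@continuousC_cst _ _ _ h)).
by apply/funext => y; rewrite big_cons.
Qed.

(** The l1-norm, for which remainders of products are bounded coordinate by
    coordinate. *)
Definition norm1 n (h : 'rV[C]_n) : R := \sum_(j < n) modulus (h 0 j).

Lemma norm1_ge0 n (h : 'rV[C]_n) : 0 <= norm1 h.
Proof. by apply: sumr_ge0 => j _; exact: modulus_ge0. Qed.

Lemma modulus_coord n (h : 'rV[C]_n) j : modulus (h 0 j) <= norm1 h.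
Proof.
rewrite /norm1 (bigD1 j)//= lerDl; apply: sumr_ge0 => k _; exact: modulus_ge0.
Qed.

Lemma modulus_dotl n (l : 'I_n -> C) (h : 'rV[C]_n) (B : R) : (forall j, modulus (l j) <= B) ->
  modulus (dotl l h) <= B * norm1 h.
Proof.
move=> lB; apply: le_trans (modulus_sum _ _ _) _.
rewrite /norm1 mulr_sumr; apply: ler_sum => j _.
by rewrite modulusM mulrC ler_wpM2r// modulus_ge0.
Qed.

Lemma coord_le_norm n (h : 'rV[C]_n) j : `|h 0 j| <= `|h|.
Proof.
rewrite [leRHS]mx_normE -[leLHS]nngE num_le.
exact: (le_bigmax _ (fun ij : 'I_1 * 'I_n => `|h ij.1 ij.2|%:nng) (0, j)).
Qed.

(** A remainder of order two gives a differential; this is how holomorphy of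
    integrals is proved below. *)
Lemma quadratic_differentiable n (f : 'rV[C]_n -> C) (w : 'rV[C]_n)
    (l : 'I_n -> C) (K delta : R) : 0 < delta ->
  (forall h : 'rV[C]_n, (forall j, modulus (h 0 j) < delta) ->
     modulus (f (w + h) - f w - dotl l h) <= K * norm1 h ^+ 2) ->
  differentiable f w.
Proof.
move=> delta0 fK.
have fE : f \o shift w = cst (f w) + (dotl l : 'rV[C]_n -> C) +o_ (0 : 'rV[C]_n) id.
  apply/eqaddoP => eps eps0.
  have epsE : eps = (Re eps)%:C by rewrite RRe_real// gtr0_real.
  have e0 : 0 < Re eps by rewrite -ltcR -epsE.
  set e := Re eps in epsE e0.
  (* Such that K (n H)^2 <= K' H^2, where H is the sup norm of the increment.
     *)
  pose K' := `|K| * n%:R ^+ 2 + 1.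
  have K'0 : 0 < K' by rewrite ltr_wpDl// mulr_ge0// exprn_ge0.
  pose d := Num.min delta (e / K').
  have d0 : 0 < d by rewrite lt_min delta0/= divr_gt0.
  have d0C : 0 < d%:C by rewrite ltcR.
  have := @nbhs0_lt _ 'rV[C]_n _ d0C; apply: filterS => h hd.
  pose H := Re `|h|.
  have HE : `|h| = H%:C by rewrite RRe_real// ger0_real.
  have H0 : 0 <= H by rewrite -ler0c -HE.
  have hH j : modulus (h 0 j) <= H by rewrite -lecR -normC_modulus -HE coord_le_norm.
  have Hd : H < d by rewrite -ltcR -HE.
  have nH : norm1 h <= n%:R * H.
    rewrite /norm1; apply: le_trans (ler_sum _ (fun j _ => hH j)) _.
    by rewrite sumr_const card_ord mulr_natl.
  have -> : (f \o shift w - (cst (f w) + dotl l)) h = f (w + h) - f w - dotl l h.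
    by rewrite /= !fctE/= opprD addrA [h + w]addrC.
  rewrite normC_modulus HE epsE -rmorphM lecR.
  apply: le_trans (fK _ _) _.
    by move=> j; apply: le_lt_trans (hH j) _; apply: lt_le_trans Hd _; rewrite ge_min lexx.
  apply: (@le_trans _ _ (`|K| * (n%:R * H) ^+ 2)).
    apply: (@le_trans _ _ (`|K| * norm1 h ^+ 2)).
      by apply: ler_wpM2r; [exact: sqr_ge0|exact: ler_norm].
    by apply: ler_wpM2l => //; rewrite lerXn2r ?nnegrE ?norm1_ge0 ?mulr_ge0.
  rewrite exprMn mulrA expr2 mulrA; apply: ler_wpM2r => //.
  apply: (@le_trans _ _ (K' * H)); first by rewrite /K' mulrDl mul1r lerDl.
  rewrite mulrC -ler_pdivlMr//; apply: le_trans (ltW Hd) _.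
  by rewrite ge_min lexx orbT.
apply/diff_locallyP; rewrite (diff_unique (@continuous_dotl n l) fE).
by split => //; exact: continuous_dotl.
Qed.

End quadratic_differentiability.

Section parametric_families.
Context {R : realType}.
Local Notation RM := (measurableTypeR R).
Local Notation C := R[i].

Lemma finite_bmeas_ub n m (L : 'I_m -> n.-tuple RM -> C) :
  (forall j, bmeas setT (L j)) -> exists2 B : R, 0 <= B & forall j t, modulus (L j t) <= B.
Proof.
move=> bL; have /choice[M LM] : forall j, exists M : R, 0 < M /\ forall t, modulus (L j t) <= M.
  by move=> j; have [M M0 LM] := bmeas_ub (bL j); exists M; split => // t; exact: LM.
exists (\sum_j M j); first by apply: sumr_ge0 => j _; exact: ltW (LM j).1.
move=> j t; apply: le_trans ((LM j).2 t) _.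
by rewrite (bigD1 j)//= lerDl; apply: sumr_ge0 => k _; exact: ltW (LM k).1.
Qed.

(** A first order expansion of K at w whose coefficients L and whose remainder
    bound A are uniform in the angles t, so that it can be integrated. *)
Definition unif_diff n (K : 'rV[C]_n -> n.-tuple RM -> C) (w : 'rV[C]_n) :=
  exists (L : 'I_n -> n.-tuple RM -> C) (A delta : R),
  [/\ 0 < delta, 0 <= A, (forall j, bmeas setT (L j)),
      (forall h : 'rV[C]_n, (forall j, modulus (h 0 j) < delta) -> bmeas setT (K (w + h))) &
      forall t (h : 'rV[C]_n), (forall j, modulus (h 0 j) < delta) ->
        modulus (K (w + h) t - K w t - dotl (L ^~ t) h) <= A * norm1 h ^+ 2].

Lemma unif_diff_cst n (c : C) (w : 'rV[C]_n) : unif_diff (fun _ _ => c) w.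
Proof.
exists (fun _ _ => 0), 0, 1; split => //.
- by move=> j; exact: bmeas_cst.
- by move=> h _; exact: bmeas_cst.
- move=> t h _; rewrite /dotl big1 ?subr0 ?subrr ?modulus0 ?mul0r// => j _.
  by rewrite mulr0.
Qed.

Lemma norm1_le n (h : 'rV[C]_n) (d : R) : (forall j, modulus (h 0 j) <= d) ->
  norm1 h <= n%:R * d.
Proof.
move=> hd; apply: le_trans (ler_sum _ (fun j _ => hd j)) _.
by rewrite sumr_const card_ord mulr_natl.
Qed.

Lemma dotlD n (l1 l2 : 'I_n -> C) (a b : C) (h : 'rV[C]_n) :
  dotl (fun j => a * l1 j + l2 j * b) h = a * dotl l1 h + dotl l2 h * b.
Proof.
rewrite /dotl mulr_sumr mulr_suml -big_split/=; apply: eq_bigr => j _; ring.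
Qed.

Lemma unif_diffM n (K1 K2 : 'rV[C]_n -> n.-tuple RM -> C) (w : 'rV[C]_n) :
  unif_diff K1 w -> unif_diff K2 w -> unif_diff (fun z t => K1 z t * K2 z t) w.
Proof.
move=> [L1 [A1 [d1 [d10 A10 bL1 bK1 E1]]]] [L2 [A2 [d2 [d20 A20 bL2 bK2 E2]]]].
have w0 : w = w + 0 by rewrite addr0.
have K1w : bmeas setT (K1 w).
  by rewrite w0; apply: bK1 => j; rewrite mxE modulus0.
have K2w : bmeas setT (K2 w).
  by rewrite w0; apply: bK2 => j; rewrite mxE modulus0.
have [M1 M10 KM1] := bmeas_ub K1w.
have [M2 M20 KM2] := bmeas_ub K2w.
have [B1 B10 LB1] := finite_bmeas_ub bL1.
have [B2 B20 LB2] := finite_bmeas_ub bL2.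
exists (fun j t => K1 w t * L2 j t + L1 j t * K2 w t).
(* Increments of modulus at most 1 have l1-norm at most n, which bounds the
   terms of order more than two by terms of order two. *)
exists (M1 * A2 + A1 * M2 + (B1 + A1 * n%:R) * (B2 + A2 * n%:R)), (Num.min 1 (Num.min d1 d2)).
have n0 : 0 <= n%:R :> R by [].
split.
- by rewrite !lt_min ltr01 d10 d20.
- by rewrite !addr_ge0 ?mulr_ge0 ?addr_ge0 ?mulr_ge0// ltW.
- by move=> j; apply: bmeasD; apply: bmeasM.
- move=> h hd; apply: bmeasM.
    by apply: bK1 => j; have := hd j; rewrite !lt_min => /and3P[].
  by apply: bK2 => j; have := hd j; rewrite !lt_min => /and3P[].
- move=> t h hd; rewrite dotlD.
  have h1 j : modulus (h 0 j) < d1 by have := hd j; rewrite !lt_min => /and3P[].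
  have h2 j : modulus (h 0 j) < d2 by have := hd j; rewrite !lt_min => /and3P[].
  have hn : norm1 h <= n%:R.
    rewrite -[leRHS]mulr1; apply: norm1_le => j.
    by have := hd j; rewrite !lt_min => /and3P[/ltW].
  have N0 := norm1_ge0 h.
  have := E1 t h h1; have := E2 t h h2.
  have := modulus_dotl h (fun j => LB1 j t); have := modulus_dotl h (fun j => LB2 j t).
  have := KM1 t I; have := KM2 t I.
  set k1 := K1 w t; set k2 := K2 w t; set l1 := dotl (L1 ^~ t) h; set l2 := dotl (L2 ^~ t) h.
  set N := norm1 h in hn N0 *.
  move=> kM2 kM1 lB2 lB1.
  set e2 := (X in modulus X <= _ -> _); move=> e2A.
  set e1 := (X in modulus X <= _ -> _); move=> e1A.
  have -> : K1 (w + h) t * K2 (w + h) t - k1 * k2 - (k1 * l2 + l1 * k2) =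
     k1 * e2 + e1 * k2 + (l1 + e1) * (l2 + e2) by rewrite /e1 /e2; ring.
  have le1 : modulus (l1 + e1) <= (B1 + A1 * n%:R) * N.
    apply: le_trans (modulusD _ _) _; rewrite mulrDl lerD//.
    apply: le_trans e1A _; rewrite expr2 mulrA; apply: ler_wpM2r => //.
    by apply: ler_wpM2l.
  have le2 : modulus (l2 + e2) <= (B2 + A2 * n%:R) * N.
    apply: le_trans (modulusD _ _) _; rewrite mulrDl lerD//.
    apply: le_trans e2A _; rewrite expr2 mulrA; apply: ler_wpM2r => //.
    by apply: ler_wpM2l.
  apply: le_trans (modulusD _ _) _; rewrite [leRHS]mulrDl; apply: lerD.
    apply: le_trans (modulusD _ _) _; rewrite [leRHS]mulrDl; apply: lerD; rewrite modulusM.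
      by rewrite -mulrA; apply: ler_pM; rewrite ?modulus_ge0.
    by rewrite mulrAC; apply: ler_pM; rewrite ?modulus_ge0.
  rewrite modulusM expr2 mulrACA.
  by apply: ler_pM; rewrite ?modulus_ge0.
Qed.

Lemma unif_diff_ckern n (i : 'I_n) (r : R) (w : 'rV[C]_n) : modulus (w 0 i) < r ->
  unif_diff (fun z t => ckern r (z 0 i) (tnth t i)) w.
Proof.
move=> wr.
have [d [d0 dE]] : exists d : R, 0 < d /\ 2 * d = r - modulus (w 0 i).
  exists ((r - modulus (w 0 i)) / 2); split; first by rewrite divr_gt0// subr_gt0.
  by rewrite mulrC divfK.
have r0 : 0 < r by exact: le_lt_trans (modulus_ge0 _) wr.
exists (fun j t => if j == i then ckern r (w 0 i) (tnth t i) / (r%:C * expi (tnth t i) - w 0 i) else 0).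
exists (r / d ^+ 3), d; split; first exact: d0.
- by rewrite divr_ge0 ?exprn_ge0// ltW.
- move=> j; case: (j == i); last exact: bmeas_cst.
  apply: (bmeas_tnth i (F := fun s : RM => ckern r (w 0 i) (s : R) / (r%:C * expi (s : R) - w 0 i))).
  apply: bmeasM; first exact: bmeas_ckern.
  apply: (@circle_bmeas _ (fun z => (z - w 0 i)^-1)); first exact: ltW.
  move=> z zr; have zw : z - w 0 i != 0.
    by rewrite subr_eq0; apply: contraTneq wr => <-; rewrite zr ltxx.
  exact: (continuousC_V (continuousC_B (@continuousC_id _ z) (@continuousC_cst _ _ _ z)) zw).
- move=> h hd; apply: (bmeas_tnth i (F := fun s : RM => ckern r ((w + h) 0 i) (s : R))).
  apply: bmeas_ckern; rewrite mxE; apply: le_lt_trans (modulusD _ _) _.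
  by have := hd i; lra.
- move=> t h hd.
  have -> : dotl (fun j => if j == i then ckern r (w 0 i) (tnth t i) /
      (r%:C * expi (tnth t i) - w 0 i) else 0) h =
      h 0 i * (ckern r (w 0 i) (tnth t i) / (r%:C * expi (tnth t i) - w 0 i)).
    rewrite /dotl (bigD1 i)//= eqxx big1 ?addr0// => j /negbTE ->.
    by rewrite mulr0.
  rewrite /ckern mxE; set z := r%:C * _.
  have zr : modulus z = r by rewrite modulus_circle// ltW.
  set x := w 0 i in wr dE *; set y := h 0 i.
  have yd : modulus y < d by exact: hd.
  have zx : 2 * d <= modulus (z - x).
    rewrite dE -zr lerBlDr -{1}(subrK x z); exact: modulusD.
  have zxy : d <= modulus (z - (x + y)).
    have -> : d = 2 * d - d by ring.
    rewrite lerBlDr; apply: le_trans zx _.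
    have -> : z - x = z - (x + y) + y by ring.
    by apply: le_trans (modulusD _ _) _; rewrite lerD2l ltW.
  have zx0 : z - x != 0 by rewrite -modulus_gt0; apply: lt_le_trans zx; rewrite mulr_gt0.
  have zxy0 : z - (x + y) != 0 by rewrite -modulus_gt0; exact: lt_le_trans zxy.
  have -> : z / (z - (x + y)) - z / (z - x) - y * (z / (z - x) / (z - x)) =
     z / ((z - x) * (z - x) * (z - (x + y))) * y ^+ 2.
    by field; rewrite zxy0 zx0.
  rewrite modulusM modulusX; apply: ler_pM; rewrite ?modulus_ge0 ?sqr_ge0//.
    rewrite modulusM modulusV zr; apply: ler_wpM2l; first exact: ltW.
    rewrite lef_pV2 ?posrE ?exprn_gt0// ?modulus_gt0 ?mulf_neq0//.
    have zxd : d <= modulus (z - x) by apply: le_trans zx; lra.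
    rewrite !modulusM !exprS expr0 mulr1 mulrA.
    have dd := ltW d0.
    by apply: ler_pM => //; [exact: mulr_ge0|exact: ler_pM].
  by rewrite lerXn2r ?nnegrE ?norm1_ge0 ?modulus_ge0// modulus_coord.
Qed.

Definition ckern_prod n (r : R) (w : 'rV[C]_n) (t : n.-tuple RM) : C :=
  \prod_(i < n) ckern r (w 0 i) (tnth t i).

Lemma unif_diff_ckern_prod n (r : R) (w : 'rV[C]_n) : (forall i, modulus (w 0 i) < r) ->
  unif_diff (@ckern_prod n r) w.
Proof.
move=> wr; rewrite (_ : @ckern_prod n r = fun z t =>
    \prod_(i <- index_enum 'I_n) ckern r (z 0 i) (tnth t i))//.
elim: (index_enum _) => [|i s ih].
  have -> : (fun (z : 'rV[C]_n) (t : n.-tuple RM) =>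
      \prod_(j <- [::]) ckern r (z 0 j) (tnth t j)) = fun _ _ => 1.
    by apply/funext => z; apply/funext => t; rewrite big_nil.
  exact: unif_diff_cst.
have -> : (fun (z : 'rV[C]_n) (t : n.-tuple RM) =>
    \prod_(j <- i :: s) ckern r (z 0 j) (tnth t j)) =
    fun z t => ckern r (z 0 i) (tnth t i) * \prod_(j <- s) ckern r (z 0 j) (tnth t j).
  by apply/funext => z; apply/funext => t; rewrite big_cons.
by apply: unif_diffM => //; exact: unif_diff_ckern.
Qed.

Definition cauchy_transform n (r : R) (g : n.-tuple RM -> C) (w : 'rV[C]_n) : C :=
  Tint (fun t => g t * ckern_prod r w t).

(** The uniform expansion of the kernel is integrated against g. *)
Lemma cauchy_transform_differentiable n (r : R) (g : n.-tuple RM -> C)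
    (f : 'rV[C]_n -> C) (w : 'rV[C]_n) :
  (forall i, modulus (w 0 i) < r) -> bmeas setT g ->
  (forall z : 'rV[C]_n, (forall i, modulus (z 0 i) < r) -> f z = cauchy_transform r g z) ->
  differentiable f w.
Proof.
move=> wr bg fE.
have [L [A [d [d0 A0 bL bK E]]]] := unif_diff_ckern_prod wr.
have [G G0 gG] := bmeas_ub bg.
have [rho rhod Hrho] : exists2 rho : R, 0 < rho & forall j, modulus (w 0 j) + rho <= r.
  have : forall s : seq 'I_n, exists2 rho : R, 0 < rho &
      forall j, j \in s -> modulus (w 0 j) + rho <= r.
    elim=> [|i s [rho rho0 H]]; first by exists 1.
    exists (Num.min rho (r - modulus (w 0 i))).
      by rewrite lt_min rho0 subr_gt0 wr.
    move=> j; rewrite inE => /predU1P[->|js].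
      by rewrite addrC -lerBrDr ge_min lexx orbT.
    by apply: le_trans (H j js); rewrite lerD2l ge_min lexx.
  move=> /(_ (enum 'I_n))[rho rho0 H]; exists rho => // j.
  by apply: H; rewrite mem_enum.
pose l j := Tint (fun t => g t * L j t).
apply: (@quadratic_differentiable _ _ _ _ l (2 * (G * A)) (Num.min d rho)).
  by rewrite lt_min d0.
move=> h hd.
have hd1 j : modulus (h 0 j) < d by have := hd j; rewrite lt_min => /andP[].
have hd2 j : modulus (h 0 j) < rho by have := hd j; rewrite lt_min => /andP[].
have whr j : modulus ((w + h) 0 j) < r.
  rewrite mxE; apply: le_lt_trans (modulusD _ _) _.
  by apply: lt_le_trans (Hrho j); rewrite ltrD2l.
rewrite !fE// /cauchy_transform /Tint.
have P1 := @probability_lty R _ _ (torus_measure R n).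
have bKw : bmeas setT (ckern_prod r w) by exact: bmeas_ckern_prod.
have bKh : bmeas setT (ckern_prod r (w + h)) by exact: bmeas_ckern_prod.
have bD : bmeas setT (fun t => dotl (L ^~ t) h).
  by apply: bmeas_sum => j _; apply: bmeasZ.
have -> : dotl l h = Cint (torus_measure R n) setT (fun t => g t * dotl (L ^~ t) h).
  rewrite /dotl /l /Tint.
  under eq_bigr => j _.
    rewrite -(Cint_Z measurableT P1); last by apply: bmeasM.
    over.
  rewrite -(Cint_sum measurableT P1); last by move=> j _; apply: bmeasZ; exact: bmeasM.
  apply: eq_Cint => t _; rewrite mulr_sumr; apply: eq_bigr => j _; ring.
rewrite -(Cint_B measurableT P1); [|exact: bmeasM|exact: bmeasM].
rewrite -(Cint_B measurableT P1); [|by apply: bmeasB; exact: bmeasM|exact: bmeasM].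
rewrite -mulrA; apply: modulus_Cint_prob.
  by apply: bmeasB; [apply: bmeasB|]; exact: bmeasM.
move=> t; rewrite -!mulrBr modulusM -mulrA.
by apply: ler_pM; rewrite ?modulus_ge0//; [exact: gG|exact: E].
Qed.

End parametric_families.

(** * The backward shift *)

Section backward_shift.
Context {R : realType} (n : nat).
Local Notation RM := (measurableTypeR R).
Local Notation C := R[i].
Local Notation Cn := 'rV[C]_n.
Implicit Types (q : Cn -> C) (z w : Cn).

Lemma polydisc_radius z : polydisc z ->
  exists2 r : R, 0 < r < 1 & forall i, modulus (z 0 i) < r.
Proof.
move=> zp; pose m := \big[Order.max/(0 : R)]_(i < n) modulus (z 0 i).
have m1 : m < 1 by apply: bigmax_lt => // i _; exact: zp.
have m0 : 0 <= m by apply: bigmax_ge_id.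
exists ((1 + m) / 2); first by apply/andP; split; lra.
move=> i; have : modulus (z 0 i) <= m by exact: (le_bigmax _ (fun i => modulus (z 0 i))).
by lra.
Qed.

(** The Cauchy transform of q (zeta) / zeta_i. By bshift_at_mul it is the
    quotient by z_i of q (z) - q (z with z_i = 0), given by a formula that is
    also meaningful at z_i = 0. *)
Definition bshift_at (r : R) (i : 'I_n) q : Cn -> C :=
  cauchy_transform r (fun t => q (rpoint (fun=> r) t) / (r%:C * expi (tnth t i))).

Lemma bmeas_torus q (r : R) : holomorphic q -> 0 <= r < 1 ->
  bmeas setT (fun t => q (rpoint (fun=> r) t)).
Proof.
move=> hq /andP[r0 r1]; apply: (bmeas_rpoint r1) (holomorphic_continuous hq) => i.
by rewrite lexx r0.
Qed.

Lemma bmeas_bshift (r : R) (i : 'I_n) q : holomorphic q -> 0 < r < 1 ->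
  bmeas setT (fun t => q (rpoint (fun=> r) t) / (r%:C * expi (tnth t i))).
Proof.
move=> hq /andP[r0 r1]; apply: bmeasM; first by apply: bmeas_torus => //; rewrite ltW.
apply: (bmeas_tnth i (F := fun s : RM => (r%:C * expi (s : R))^-1)).
have cV (x : C) : modulus x = r -> {for x, continuous (fun z : C => z^-1)}.
  move=> xr; have x0 : x != 0 by rewrite -modulus_gt0 xr.
  exact: (continuousC_V (@continuousC_id _ x) x0).
exact: (circle_bmeas (ltW r0) cV).
Qed.

Lemma bshift_at_mul (r : R) (i : 'I_n) q z : holomorphic q -> 0 < r < 1 ->
  (forall j, modulus (z 0 j) < r) ->
  z 0 i * bshift_at r i q z = q z - q (setc z i 0).
Proof.
move=> hq r01 zr; have /andP[r0 r1] := r01.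
have z0r j : modulus (setc z i 0 0 j) < r by rewrite setcE; case: ifPn; rewrite ?modulus0.
have r01' : 0 <= r < 1 by rewrite ltW.
have P1 := @probability_lty R _ _ (torus_measure R n).
have bz : bmeas setT (fun t : n.-tuple RM => \prod_(j < n) ckern r (z 0 j) (tnth t j)).
  exact: bmeas_ckern_prod.
have bz0 : bmeas setT (fun t : n.-tuple RM => \prod_(j < n) ckern r (setc z i 0 0 j) (tnth t j)).
  exact: bmeas_ckern_prod.
rewrite (cauchy_polydisc hq zr r01) (cauchy_polydisc hq z0r r01).
rewrite /bshift_at /cauchy_transform /Tint.
rewrite -(Cint_Z measurableT P1); last by apply: bmeasM => //; exact: bmeas_bshift.
rewrite -(Cint_B measurableT P1); [|by apply: bmeasM => //; exact: bmeas_torus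
  |by apply: bmeasM => //; exact: bmeas_torus].
apply: eq_Cint => t _; rewrite -mulrBr /ckern_prod.
rewrite [in LHS](bigD1 i)// [in X in _ = _ * (X - _)](bigD1 i)//.
rewrite [in X in _ = _ * (_ - X)](bigD1 i)//= setcE eqxx.
rewrite [X in _ = _ * (_ - _ * X)](eq_bigr (fun j => ckern r (z 0 j) (tnth t j))); last first.
  by move=> j /negbTE ji; rewrite setcE ji.
have h1 := circle_sub_neq0 (tnth t i) (zr i).
have h0 := @circle_sub_neq0 _ r 0 (tnth t i) _.
rewrite modulus0 in h0; have {}h0 := h0 r0; rewrite subr0 in h0.
rewrite /ckern subr0; set P := \prod_(_ < _ | _) _; set x := r%:C * _ in h0 h1 *.
by field; rewrite h0 h1.
Qed.

Lemma bshift_at_differentiable (r : R) (i : 'I_n) q z : holomorphic q -> 0 < r < 1 ->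
  (forall j, modulus (z 0 j) < r) -> differentiable (bshift_at r i q) z.
Proof.
by move=> hq r01 zr; apply: (cauchy_transform_differentiable zr (bmeas_bshift i hq r01)).
Qed.

(** Where z_i is not 0 both values are determined by bshift_at_mul; the others
    follow by continuity. *)
Lemma bshift_at_indep (r r' : R) (i : 'I_n) q z : holomorphic q ->
  0 < r < 1 -> 0 < r' < 1 -> (forall j, modulus (z 0 j) < r) ->
  (forall j, modulus (z 0 j) < r') -> bshift_at r i q z = bshift_at r' i q z.
Proof.
move=> hq r01 r'01 zr zr'.
have [z0|z0] := eqVneq (z 0 i) 0; last first.
  by apply: (mulfI z0); rewrite !bshift_at_mul.
have sr (s : R) x : (forall j, modulus (z 0 j) < s) -> modulus x < s ->
    forall j, modulus (setc z i x 0 j) < s.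
  by move=> zs xs j; rewrite setcE; case: ifPn.
have cr (s : R) : 0 < s < 1 -> (forall j, modulus (z 0 j) < s) ->
    {for 0, continuous (fun x => bshift_at s i q (setc z i x))}.
  move=> s01 zs; apply: cdiff_continuous; apply: cdiff_slice.
  apply: bshift_at_differentiable => //; apply: sr => //.
  by rewrite modulus0; case/andP: s01.
have -> : z = setc z i 0 by rewrite -[in RHS]z0 setc_id.
have c1 := cr r r01 zr; have c2 := cr r' r'01 zr'.
pose u (k : nat) : C := ((Num.min r r') * harmonic k.+1)%:C.
have m0 : 0 < Num.min r r' by rewrite lt_min; case/andP: r01 => ->; case/andP: r'01.
have u0 : u @ \oo --> (0 : C).
  rewrite -[0]/(0%:C); apply: cvg_realC; rewrite -(mulr0 (Num.min r r')).
  apply: cvgM; first exact: cvg_cst.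
  by rewrite (@cvg_shiftS R (@harmonic R)); exact: cvg_harmonic.
have uk k : u k != 0 /\ modulus (u k) < Num.min r r'.
  have h0 : 0 < (harmonic k.+1 : R) by rewrite /harmonic/= invr_gt0.
  have h1 : (harmonic k.+1 : R) < 1 by rewrite /harmonic/= invf_lt1// ltr1n.
  have p0 : 0 < Num.min r r' * harmonic k.+1 by rewrite mulr_gt0.
  split; first by rewrite -modulus_gt0 modulus_real// ltW.
  by rewrite modulus_real ?(ltW p0)// gtr_pMr.
have l1 := cvg_comp _ _ u0 c1; have l2 := cvg_comp _ _ u0 c2.
have E : (fun x => bshift_at r' i q (setc z i x)) \o u =
    (fun x => bshift_at r i q (setc z i x)) \o u.
  apply/funext => k /=; have [uk0 ukr] := uk k.
  have ur : modulus (u k) < r by apply: lt_le_trans ukr _; rewrite ge_min lexx.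
  have ur' : modulus (u k) < r' by apply: lt_le_trans ukr _; rewrite ge_min lexx orbT.
  have ui : setc z i (u k) 0 i != 0 by rewrite setcE eqxx.
  by apply: (mulfI ui); rewrite !bshift_at_mul//; exact: sr.
rewrite E in l2; exact: (cvgC_unique l1 l2).
Qed.

(** Any radius larger than the moduli of the coordinates gives the same value,
    by bshift_at_indep. *)
Definition bshift (i : 'I_n) q : Cn -> C := fun z =>
  xget 0 [set v | exists r : R, [/\ 0 < r < 1, forall j, modulus (z 0 j) < r
                                  & v = bshift_at r i q z]].

Lemma bshiftE (i : 'I_n) q z (r : R) : holomorphic q -> 0 < r < 1 ->
  (forall j, modulus (z 0 j) < r) -> bshift i q z = bshift_at r i q z.
Proof.
move=> hq r01 zr; rewrite /bshift; case: xgetP => [_ _ [r' [r'01 zr' ->]]|].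
  exact: bshift_at_indep.
by move=> /(_ (bshift_at r i q z)) []; exists r.
Qed.

Lemma bshift_out (i : 'I_n) q z : ~ polydisc z -> bshift i q z = 0.
Proof.
move=> zp; rewrite /bshift; case: xgetP => // x _ [r [/andP[_ r1] zr _]].
by exfalso; apply: zp => j; exact: lt_trans r1.
Qed.

Lemma bshift_mul (i : 'I_n) q z : holomorphic q -> polydisc z ->
  z 0 i * bshift i q z = q z - q (setc z i 0).
Proof.
move=> hq zp; have [r r01 zr] := polydisc_radius zp.
by rewrite (bshiftE i hq r01 zr) bshift_at_mul.
Qed.

Lemma bshift_holomorphic (i : 'I_n) q : holomorphic q -> holomorphic (bshift i q).
Proof.
move=> hq z zp; have [r r01 zr] := polydisc_radius zp.
apply: (cauchy_transform_differentiable zr (bmeas_bshift i hq r01)) => w wr.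
exact: bshiftE.
Qed.

End backward_shift.

(** * Mean squares over tori *)

Section torus_L2.
Context {R : realType}.
Local Notation RM := (measurableTypeR R).
Local Notation C := R[i].
Implicit Types n : nat.

Lemma torus_lty n : (torus_measure R n setT < +oo)%E.
Proof. exact: probability_lty. Qed.

Definition Tint_Z n c (F : n.-tuple RM -> C) (bF : bmeas setT F) :
  Tint (fun t => c * F t) = c * Tint F := Cint_Z measurableT (torus_lty n) c bF.
Definition Tint_D n (F G : n.-tuple RM -> C) (bF : bmeas setT F) (bG : bmeas setT G) :
  Tint (fun t => F t + G t) = Tint F + Tint G := Cint_D measurableT (torus_lty n) bF bG.
Definition Tint_B n (F G : n.-tuple RM -> C) (bF : bmeas setT F) (bG : bmeas setT G) :
  Tint (fun t => F t - G t) = Tint F - Tint G := Cint_B measurableT (torus_lty n) bF bG.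
Definition Tint_conj n (F : n.-tuple RM -> C) (bF : bmeas setT F) :
  Tint (fun t => (F t)^*) = (Tint F)^* := Cint_conj measurableT (torus_lty n) bF.

Lemma eq_Tint n (F G : n.-tuple RM -> C) : (forall t, F t = G t) -> Tint F = Tint G.
Proof. by move=> FG; apply: eq_Cint => t _. Qed.

Definition Tnormsq n (F : n.-tuple RM -> C) : R := \int[torus_measure R n]_t (modulus (F t) ^+ 2).

Lemma Tnormsq_TI n (F : n.-tuple RM -> C) : Tint (fun t => F t * (F t)^*) = (Tnormsq F)%:C.
Proof.
rewrite /Tnormsq -(Cint_real _ measurableT); apply: eq_Cint => t _; exact: mulcc_modulus.
Qed.

Lemma Tnormsq_ge0 n (F : n.-tuple RM -> C) : 0 <= Tnormsq F.
Proof. by apply: Rintegral_ge0 => t _; exact: sqr_ge0. Qed.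

Lemma bmeas_integrable_sqr n (F : n.-tuple RM -> C) : bmeas setT F ->
  (torus_measure R n).-integrable setT (EFin \o (fun t => modulus (F t) ^+ 2)).
Proof.
by move=> bF; exact: (bmeas_integrable_Re measurableT (torus_lty n) (bmeas_modulus2 bF)).
Qed.

Lemma Tnormsq_le n (F : n.-tuple RM -> C) (M : R) : bmeas setT F ->
  (forall t, modulus (F t) ^+ 2 <= M) -> Tnormsq F <= M.
Proof.
move=> bF FM; rewrite /Tnormsq.
have M0 : 0 <= M by exact: le_trans (sqr_ge0 _) (FM [tuple of nseq n 0]).
have [rF _ _] := bmeas_modulus2 bF.
have := @Rintegral_le_bound _ _ _ (torus_measure R n) setT measurableT (torus_lty n) _ M rF _.
rewrite [fine _](congr1 fine (probability_setT _)) mulr1 => H.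
apply: le_trans (ler_norm _) (H _) => t _ /=.
by rewrite ger0_norm ?sqr_ge0.
Qed.

Lemma Tnormsq_mono n (F G : n.-tuple RM -> C) : bmeas setT F -> bmeas setT G ->
  (forall t, modulus (F t) ^+ 2 <= modulus (G t) ^+ 2) -> Tnormsq F <= Tnormsq G.
Proof.
move=> bF bG FG; apply: le_Rintegral => //; exact: bmeas_integrable_sqr.
Qed.

Lemma Tnormsq_Z n c (F : n.-tuple RM -> C) : bmeas setT F ->
  Tnormsq (fun t => c * F t) = modulus c ^+ 2 * Tnormsq F.
Proof.
move=> bF; rewrite /Tnormsq -RintegralZl//; last exact: bmeas_integrable_sqr.
by apply: eq_Rintegral => t _; rewrite modulusM exprMn.
Qed.

Lemma mulcc_sub (x y : C) :
  (x - y) * (x - y)^* = x * x^* + y * y^* - (x * y^* + (x * y^*)^*).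
Proof.
case: x y => [a b] [c d]; apply/eqP; rewrite eq_complex/=.
by apply/andP; split; apply/eqP; ring.
Qed.

Lemma Tnormsq_expand n (F G : n.-tuple RM -> C) : bmeas setT F -> bmeas setT G ->
  Tnormsq (fun t => F t - G t) = Tnormsq F + Tnormsq G - 2 * Re (Tint (fun t => F t * (G t)^*)).
Proof.
move=> bF bG; apply: (@complexI R).
have bFG : bmeas setT (fun t => F t * (G t)^*) by apply: bmeasM => //; exact: bmeasJ.
have bFF : bmeas setT (fun t => F t * (F t)^*) by apply: bmeasM => //; exact: bmeasJ.
have bGG : bmeas setT (fun t => G t * (G t)^*) by apply: bmeasM => //; exact: bmeasJ.
rewrite -Tnormsq_TI rmorphB rmorphD/= rmorphM/= -!Tnormsq_TI.
have -> : 2%:C * (Re (Tint (fun t => F t * (G t)^*)))%:C =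
    Tint (fun t => F t * (G t)^* + (F t * (G t)^*)^*).
  rewrite (Tint_D bFG (bmeasJ bFG)) (Tint_conj bFG).
  have -> : 2%:C = 2 :> C by rewrite rmorphMn/= rmorph1.
  exact: esym (addcJ _).
rewrite -(Tint_D bFF bGG) -Tint_B; last 2 first.
- exact: bmeasD.
- by apply: bmeasD => //; exact: bmeasJ.
apply: eq_Tint => t; exact: mulcc_sub.
Qed.

(** Expand the mean square of c F - G, where c has modulus s and makes the
    integral of c F conj G a nonnegative number. *)
Lemma torus_cauchy_schwarz n (F G : n.-tuple RM -> C) (s : R) : bmeas setT F -> bmeas setT G -> 0 <= s ->
  2 * s * modulus (Tint (fun t => F t * (G t)^*)) <= s ^+ 2 * Tnormsq F + Tnormsq G.
Proof.
move=> bF bG s0; set a := Tint _.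
have [->|a0] := eqVneq a 0.
  by rewrite modulus0 mulr0 addr_ge0 ?mulr_ge0 ?Tnormsq_ge0 ?sqr_ge0.
pose c := s%:C * (a^* / (modulus a)%:C).
have ma0 : (modulus a)%:C != 0 :> C.
  by rewrite -modulus_gt0 modulus_real ?modulus_ge0// modulus_gt0.
have mc : modulus c = s.
  rewrite /c modulusM modulus_real// modulusM modulusV modulusJ modulus_real ?modulus_ge0//.
  by rewrite divff ?mulr1// modulus_eq0.
have ca : Tint (fun t => (c * F t) * (G t)^*) = (s * modulus a)%:C.
  rewrite (@eq_Tint _ _ (fun t => c * (F t * (G t)^*))); last by move=> t; rewrite mulrA.
  rewrite Tint_Z; last by apply: bmeasM => //; exact: bmeasJ.
  rewrite -/a /c -mulrA rmorphM/=; congr (_ * _).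
  by rewrite mulrAC [_ * a]mulrC mulcc_modulus rmorphXn/= expr2 mulfK.
have := Tnormsq_ge0 (fun t => c * F t - G t).
rewrite Tnormsq_expand//; last exact: bmeasZ.
rewrite ca Tnormsq_Z// mc/= subr_ge0; apply: le_trans.
by rewrite mulrA.
Qed.

End torus_L2.

Section hardy_means.
Context {R : realType}.
Local Notation RM := (measurableTypeR R).
Local Notation C := R[i].

Lemma conj_circle (l s : R) : (l%:C * expi s)^* = l%:C * (expi s)^-1.
Proof.
rewrite -expiJ; apply/eqP; rewrite eq_complex/=.
by apply/andP; split; apply/eqP; ring.
Qed.

(** On the circle of radius l one has conj (e^(i t)) = l / z. The integrand is
    thus the restriction of Phi (z) = phi (a z) conj (gam (b / conj z)), which
    is holomorphic on the annulus b < |z| < 1 / a, and its mean on the circle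
    of radius l is the one for the radii a l and b / l. The case a b = 0 is
    the mean value property. *)
Lemma avg_pair (phi gam : C -> C) (a b a' b' : R) :
  (forall z, modulus z < 1 -> cdiff phi z) -> (forall z, modulus z < 1 -> cdiff gam z) ->
  0 <= a < 1 -> 0 <= b < 1 -> 0 <= a' < 1 -> 0 <= b' < 1 -> a * b = a' * b' ->
  avg (fun s => phi (a%:C * expi (s : R)) * (gam (b%:C * expi (s : R)))^*) =
  avg (fun s => phi (a'%:C * expi (s : R)) * (gam (b'%:C * expi (s : R)))^*).
Proof.
move=> dphi dgam a01 b01 a'01 b'01 ab.
have bm (psi : C -> C) x : (forall z, modulus z < 1 -> cdiff psi z) -> 0 <= x < 1 ->
    bmeas setT (fun s : RM => psi (x%:C * expi (s : R))).
  move=> dpsi /andP[x0 x1]; apply: circle_bmeas => // z zx.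
  by apply: cdiff_continuous; apply: dpsi; rewrite zx.
have P1 := @probability_lty R _ _ (uniform_prob (@pi2_gt0 R)).
have mv (psi : C -> C) x : (forall z, modulus z < 1 -> cdiff psi z) -> 0 <= x < 1 ->
    avg (fun s => psi (x%:C * expi (s : R))) = psi 0.
  move=> dpsi /andP[]; rewrite le_eqVlt => /predU1P[<- _|x0 x1].
    rewrite /avg (_ : (fun _ => _) = fun=> psi 0) ?Cint_cst_prob//.
    by apply/funext => s; rewrite mul0r.
  by apply: mean_value => //; rewrite x0.
have zero x y : 0 <= x < 1 -> 0 <= y < 1 -> x * y = 0 ->
    avg (fun s => phi (x%:C * expi (s : R)) * (gam (y%:C * expi (s : R)))^*) =
    phi 0 * (gam 0)^*.
  move=> x01 y01 /eqP; rewrite mulf_eq0 => /orP[|] /eqP xy0; subst.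
    transitivity (avg (fun s => phi 0 * (gam (y%:C * expi (s : R)))^*)).
      by apply: eq_Cint => s _; rewrite mul0r.
    rewrite /avg (Cint_Z measurableT P1 _ (bmeasJ (bm _ _ dgam y01))).
    rewrite (Cint_conj measurableT P1 (bm _ _ dgam y01)).
    exact: (congr1 (fun x => phi 0 * x^*) (mv _ _ dgam y01)).
  transitivity (avg (fun s => (gam 0)^* * phi (x%:C * expi (s : R)))).
    by apply: eq_Cint => s _; rewrite mul0r mulrC.
  rewrite /avg (Cint_Z measurableT P1 _ (bm _ _ dphi x01)) mulrC.
  by congr (_ * _); exact: mv.
have [ab0|ab0] := eqVneq (a * b) 0.
  by rewrite zero// zero// -ab.
have a0 : 0 < a.
  by rewrite lt0r; move: ab0 a01; rewrite mulf_eq0 negb_or => /andP[-> _] /andP[->].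
have b0 : 0 < b.
  by rewrite lt0r; move: ab0 b01; rewrite mulf_eq0 negb_or => /andP[_ ->] /andP[->].
have a'0 : 0 < a'.
  rewrite lt0r; move: ab0 a'01; rewrite ab mulf_eq0 negb_or.
  by move=> /andP[-> _] /andP[->].
have b'0 : 0 < b'.
  rewrite lt0r; move: ab0 b'01; rewrite ab mulf_eq0 negb_or.
  by move=> /andP[_ ->] /andP[->].
have [/andP[_ a1] /andP[_ b1] /andP[_ a'1] /andP[_ b'1]] := And4 a01 b01 a'01 b'01.
pose Phi (z : C) := phi (a%:C * z) * (gam (b%:C * (z^*)^-1))^*.
have PhiE (l s : R) : 0 < l -> Phi (l%:C * expi s) =
    phi ((a * l)%:C * expi s) * (gam ((b / l)%:C * expi s))^*.
  move=> l0; rewrite /Phi; congr (phi _ * (gam _)^*).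
    by rewrite mulrA -rmorphM.
  rewrite conj_circle invfM invrK mulrA; congr (_ * _).
  by rewrite [RHS]rmorphM/= fmorphV.
have dPhi z : b < modulus z < a^-1 -> cdiff Phi z.
  move=> /andP[bz za].
  have z0 : z != 0 by rewrite -modulus_gt0; exact: lt_trans bz.
  apply: cdiffM.
    apply: (@cdiff_comp _ phi (fun z => a%:C * z)).
      by apply: cdiffM; [exact: cdiff_cst|exact: cdiff_id].
    apply: dphi; rewrite modulusM modulus_real; last exact: ltW.
    by rewrite -ltr_pdivlMl// mulr1.
  apply: (@cdiff_conj _ (fun z => gam (b%:C * z^-1))).
  apply: (@cdiff_comp _ gam (fun z => b%:C * z^-1)).
    apply: cdiffM; first exact: cdiff_cst.
    by apply: cdiff_inv; rewrite conjc_eq0.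
  apply: dgam; rewrite modulusM modulusV modulusJ modulus_real; last exact: ltW.
  by rewrite ltr_pdivrMr ?mul1r// modulus_gt0.
have la : 0 < a' / a by rewrite divr_gt0.
have := @cmean_const _ Phi b a^-1 1 (a' / a) dPhi ltr01 _ la _.
rewrite /cmean => H.
have H1 : b < 1 < a^-1 by rewrite b1 invf_gt1.
have H2 : b < a' / a < a^-1.
  rewrite ltr_pdivlMr// mulrC ab gtr_pMr// b'1/=.
  by rewrite gtr_pMl ?invr_gt0.
have {}H := H H1 H2.
transitivity (avg (fun t => Phi (1%:C * expi (t : R)))).
  by apply: eq_Cint => s _; rewrite PhiE// mulr1 divr1.
rewrite H; apply: eq_Cint => s _; rewrite PhiE//.
have -> : a * (a' / a) = a' by rewrite mulrC divfK// gt_eqF.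
have -> : b / (a' / a) = b'.
  apply: (mulfI (lt0r_neq0 a'0)); rewrite -ab.
  by field; rewrite !gt_eqF.
by [].
Qed.

(** The means whose limit for r = s to 1 is the inner product of the Hardy
    space. *)
Definition mdot n (f g : 'rV[C]_n -> C) (r s : R) : C :=
  Tint (fun t => f (rpoint (fun=> r) t) * (g (rpoint (fun=> s) t))^*).

Definition msq n (f : 'rV[C]_n -> C) (r : R) : R := Tnormsq (fun t => f (rpoint (fun=> r) t)).

Lemma mdotff n (f : 'rV[C]_n -> C) (r : R) : mdot f f r r = (msq f r)%:C.
Proof. exact: Tnormsq_TI. Qed.

Lemma msq_ge0 n (f : 'rV[C]_n -> C) r : 0 <= msq f r.
Proof. exact: Tnormsq_ge0. Qed.

(** The radii are changed one coordinate at a time, by avg_pair. *)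
Lemma mdot_eq n (f g : 'rV[C]_n -> C) (r s r' s' : R) : holomorphic f -> holomorphic g ->
  0 <= r < 1 -> 0 <= s < 1 -> 0 <= r' < 1 -> 0 <= s' < 1 -> r * s = r' * s' ->
  mdot f g r s = mdot f g r' s'.
Proof.
move=> hf hg r01 s01 r'01 s'01 rs.
pose mx (x x' : R) (m : nat) (i : 'I_n) := if (i < m)%N then x' else x.
have mx01 x x' m i : 0 <= x < 1 -> 0 <= x' < 1 -> 0 <= mx x x' m i < 1.
  by move=> h h'; rewrite /mx; case: ifPn.
have bm (q : 'rV[C]_n -> C) x x' m : holomorphic q -> 0 <= x < 1 -> 0 <= x' < 1 ->
    bmeas setT (fun t => q (rpoint (mx x x' m) t)).
  move=> hq /andP[x0 x1] /andP[x'0 x'1].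
  apply: (@bmeas_rpoint _ _ _ _ (Num.max x x')) (holomorphic_continuous hq).
    by rewrite gt_max x1.
  by move=> i; rewrite /mx; case: ifPn => _; rewrite ?x0 ?x'0 le_max lexx ?orbT.
have E m : (m <= n)%N -> mdot f g r s =
    Tint (fun t => f (rpoint (mx r r' m) t) * (g (rpoint (mx s s' m) t))^*).
  elim: m => [|m ih] mn; first by [].
  rewrite ih; last exact: ltnW.
  pose i0 := Ordinal mn.
  have bmfg k : bmeas setT (fun t => f (rpoint (mx r r' k) t) * (g (rpoint (mx s s' k) t))^*).
    by apply: bmeasM; [exact: bm|apply: bmeasJ; exact: bm].
  rewrite [LHS](Tint_avg i0 (bmfg m)) [RHS](Tint_avg i0 (bmfg m.+1)); apply: eq_Tint => t.
  have sE x x' y : setc (rpoint (mx x x' m.+1) t) i0 y = setc (rpoint (mx x x' m) t) i0 y.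
    apply/rowP => j; rewrite !mxE; case: eqVneq => // ji.
    by rewrite /mx ltnS leq_eqVlt -[(j : nat) == m]/(j == i0) (negbTE ji).
  have m0 x x' : mx x x' m i0 = x by rewrite /mx /= ltnn.
  have m1 x x' : mx x x' m.+1 i0 = x' by rewrite /mx /= ltnSn.
  have p0 x x' k : 0 <= x < 1 -> 0 <= x' < 1 -> polydisc (rpoint (mx x x' k) t).
    by move=> h h'; apply: polydisc_rpoint => i; exact: mx01.
  transitivity (avg (fun u => f (setc (rpoint (mx r r' m) t) i0 (r%:C * expi (u : R))) *
     (g (setc (rpoint (mx s s' m) t) i0 (s%:C * expi (u : R))))^*)).
    by apply: eq_Cint => u _; rewrite !rpoint_set_angle !m0.
  rewrite (@avg_pair (fun y => f (setc (rpoint (mx r r' m) t) i0 y))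
    (fun y => g (setc (rpoint (mx s s' m) t) i0 y)) r s r' s')//.
  - by apply: eq_Cint => u _; rewrite !rpoint_set_angle !m1 !sE.
  - by move=> z z1; apply: holomorphic_slice => //; exact: p0.
  - by move=> z z1; apply: holomorphic_slice => //; exact: p0.
rewrite (E n (leqnn n)); apply: eq_Tint => t.
by congr (f _ * (g _)^*); apply/rowP => i; rewrite !mxE /mx ltn_ord.
Qed.

(** The mean square of the difference of the dilations by r and by s is
    nonnegative, and by mdot_eq its cross term is the mean square at the
    geometric mean x. *)
Lemma msq_midpoint n (f : 'rV[C]_n -> C) (r s x : R) : holomorphic f ->
  0 <= r < 1 -> 0 <= s < 1 -> 0 <= x < 1 -> r * s = x * x -> 2 * msq f x <= msq f r + msq f s.
Proof.
move=> hf r01 s01 x01 rsx.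
have := Tnormsq_ge0 (fun t => f (rpoint (fun=> r) t) - f (rpoint (fun=> s) t)).
rewrite Tnormsq_expand; [|exact: bmeas_torus|exact: bmeas_torus].
by rewrite -/(mdot f f r s) (mdot_eq hf hf r01 s01 x01 x01 rsx) mdotff/= subr_ge0.
Qed.

(** Suppose that the mean square drops from x to y. By msq_midpoint it is
    convex along the geometric progression y, x, x^2 / y, ... and so grows at
    least linearly toward the center, where it is bounded. *)
Lemma msq_mono n (f : 'rV[C]_n -> C) (x y : R) : holomorphic f ->
  0 <= x -> x <= y -> y < 1 -> msq f x <= msq f y.
Proof.
move=> hf x0 xy y1.
have y0 : 0 <= y by exact: le_trans xy.
have x1 : x < 1 by exact: le_lt_trans y1.
move: x0; rewrite le_eqVlt => /predU1P[<-|x0].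
  have := @msq_midpoint n f y 0 0 hf.
  rewrite y0 y1 lexx ltr01 mulr0 mul0r => /(_ isT isT isT erefl).
  by rewrite mulr2n mulrDl mul1r lerD2r.
rewrite leNgt; apply/negP => Nxy.
have y0' : 0 < y by exact: lt_le_trans xy.
pose q := x / y.
have q0 : 0 < q by rewrite divr_gt0.
have q1 : q <= 1 by rewrite ler_pdivrMr// mul1r.
pose rk (k : nat) := y * q ^+ k.
have rk01 k : 0 <= rk k < 1.
  rewrite mulr_ge0//= ?exprn_ge0 ?(ltW q0)//.
  by apply: le_lt_trans y1; rewrite ler_piMr// exprn_ile1// ltW.
have mid k : 2 * msq f (rk k.+1) <= msq f (rk k) + msq f (rk k.+2).
  apply: msq_midpoint => //; rewrite /rk !exprS; ring.
pose D := msq f x - msq f y.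
have D0 : 0 < D by rewrite subr_gt0.
have step k : D <= msq f (rk k.+1) - msq f (rk k).
  elim: k => [|k ih].
    by rewrite /rk expr1 expr0 mulr1 /q mulrC divfK// gt_eqF.
  have aux (u v w : R) : D <= v - u -> 2 * v <= u + w -> D <= w - v by lra.
  exact: (aux _ _ _ ih (mid k)).
have grow k : msq f y + D *+ k <= msq f (rk k).
  elim: k => [|k ih]; first by rewrite mulr0n addr0 /rk expr0 mulr1.
  have -> : msq f y + D *+ k.+1 = D + (msq f y + D *+ k) by rewrite mulrS addrCA.
  by rewrite -(subrK (msq f (rk k)) (msq f (rk k.+1))) lerD ?step.
have [M M0 fM] := @compact_modulus_bounded _ _ _ f (@compact_polydisc _ n y)
  (fun z Kz => holomorphic_continuous hf (fun i => le_lt_trans (Kz i) y1)).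
have NM k : msq f (rk k) <= M ^+ 2.
  apply: Tnormsq_le; first exact: bmeas_torus.
  have /andP[r0 r1] := rk01 k.
  move=> t; rewrite lerXn2r ?nnegrE ?modulus_ge0 ?(ltW M0)//; apply: fM => i.
  rewrite modulus_rpoint// /rk ler_piMr// exprn_ile1// ltW//.
have [k Hk] : exists k : nat, M ^+ 2 < D *+ k.
  have /andP[_ h] := truncn_itv (divr_ge0 (sqr_ge0 M) (ltW D0)).
  exists (Num.truncn (M ^+ 2 / D)).+1; rewrite -mulr_natr mulrC.
  by rewrite -ltr_pdivrMr.
have := grow k; have := NM k; have := msq_ge0 f y; move: Hk; lra.
Qed.

End hardy_means.

(** * Radii tending to 1 and truncation to the polydisc *)

Section radii.
Context {R : realType}.

(** A sequence increasing to 1, along which limits at the boundary are taken.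
    *)
Definition inc_radius (k : nat) : R := 1 - harmonic k.+1.

Lemma inc_radius_itv k : 0 < inc_radius k < 1.
Proof.
have h0 : 0 < (harmonic k.+1 : R) by rewrite /harmonic/= invr_gt0.
have h1 : (harmonic k.+1 : R) < 1 by rewrite /harmonic/= invf_lt1// ltr1n.
by rewrite /inc_radius subr_gt0 h1/= ltrBlDr ltrDl.
Qed.

Lemma inc_radius_itv0 k : 0 <= inc_radius k < 1.
Proof. by have /andP[h ->] := inc_radius_itv k; rewrite ltW. Qed.

Lemma cvg_inc_radius : inc_radius @ \oo --> (1 : R).
Proof.
rewrite -[X in _ --> X](subr0 1); apply: cvgB; first exact: cvg_cst.
by rewrite (@cvg_shiftS R (@harmonic R)); exact: cvg_harmonic.
Qed.

Lemma near_inc_radius (r : R) : r < 1 -> \forall k \near \oo, r <= inc_radius k.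
Proof.
move=> r1; have r10 : 0 < 1 - r by rewrite subr_gt0.
have := cvg_inc_radius => /cvgrPdist_lt /(_ _ r10); apply: filterS => k.
by move=> /(le_lt_trans (ler_norm _)); lra.
Qed.

End radii.

Section local_differentiability.
Context {R : realType} (n : nat).
Local Notation C := R[i].
Local Notation Cn := 'rV[C]_n.
Implicit Types (f g : Cn -> C).

(** Differentials only depend on germs; needed because elements of H2 are cut
    off outside the polydisc. *)
Lemma differentiable_near f g z : (\forall w \near z, f w = g w) ->
  differentiable f z -> differentiable g z.
Proof.
move=> fg /diff_locallyP[cdf fE].
have fgz := nbhs_singleton fg.
have gE : g \o shift (z : Cn) = cst (g z) + ('d f z : Cn -> C) +o_ (0 : Cn) id.
  apply/eqaddoP => e e0; move/eqaddoP : fE => /(_ e e0) fE.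
  have fg0 : \forall h \near (0 : Cn), f (h + z) = g (h + z).
    have := fg; rewrite (near_shift (0 : Cn)) subr0; exact.
  near=> h.
  have fgh : f (h + z) = g (h + z) by near: h; exact: fg0.
  have : `|(f \o shift z - (cst (f z) + 'd f z)) h| <= e * `|h| by near: h; exact: fE.
  by rewrite !fctE/= fgh fgz.
by apply/diff_locallyP; rewrite (diff_unique cdf gE).
Unshelve. all: by end_near.
Qed.

Lemma polydisc_open z : polydisc z -> \forall w \near z, @polydisc R n w.
Proof.
move=> zp; apply: (@filter_forall Cn _ (fun i w => modulus (w 0 i) < 1) (nbhs z)) => i.
have ci : {for z, continuous (fun w : Cn => w 0 i)} by exact: coord_continuous.
have zi : 0 < 1 - modulus (z 0 i) by rewrite subr_gt0; exact: zp.
have cm : modulus (w 0 i) @[w --> z] --> modulus (z 0 i) by exact: cvg_modulus.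
move/cvgrPdist_lt : cm => /(_ _ zi) H.
near=> w.
have : `|modulus (z 0 i) - modulus (w 0 i)| < 1 - modulus (z 0 i) by near: w; exact: H.
by rewrite distrC => /(le_lt_trans (ler_norm _)); rewrite ltrBlDr subrK.
Unshelve. all: by end_near.
Qed.

Definition trunc f : Cn -> C := fun z => if `[< polydisc z >] then f z else 0.

Lemma truncE f z : polydisc z -> trunc f z = f z.
Proof. by move=> /asboolP zp; rewrite /trunc zp. Qed.

Lemma trunc_out f z : ~ polydisc z -> trunc f z = 0.
Proof. by move=> /asboolPn /negbTE zp; rewrite /trunc zp. Qed.

Lemma holomorphic_near f g : (forall z, polydisc z -> f z = g z) ->
  holomorphic f -> holomorphic g.
Proof.
move=> fg hf z zp; apply: differentiable_near (hf z zp).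
by apply: filterS (polydisc_open zp) => w; exact: fg.
Qed.

Lemma trunc_holomorphic f : holomorphic f -> holomorphic (trunc f).
Proof. by apply: holomorphic_near => z zp; rewrite truncE. Qed.

Lemma holomorphicD f g : holomorphic f -> holomorphic g -> holomorphic (f + g).
Proof. by move=> hf hg z zp; apply: differentiableD; [exact: hf|exact: hg]. Qed.

Lemma holomorphicB f g : holomorphic f -> holomorphic g -> holomorphic (f - g).
Proof. by move=> hf hg z zp; apply: differentiableB; [exact: hf|exact: hg]. Qed.

Lemma holomorphicZ c f : holomorphic f -> holomorphic (c *: f).
Proof. by move=> hf z zp; apply: differentiableZ; exact: hf. Qed.

Lemma holomorphicM f g : holomorphic f -> holomorphic g -> holomorphic (f * g).
Proof.
move=> hf hg z zp; exact: (@differentiableM _ Cn f g z (hf z zp) (hg z zp)).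
Qed.

Lemma holomorphic_cst c : holomorphic (fun _ : Cn => c).
Proof. by move=> z _; exact: differentiable_cst. Qed.

Lemma holomorphic_coord (i : 'I_n) : holomorphic (fun z : Cn => z 0 i).
Proof. move=> z _; exact: differentiable_coord. Qed.

Lemma holomorphic_mulz (i : 'I_n) f : holomorphic f -> holomorphic (mulz i f).
Proof. by move=> hf; apply: (@holomorphicM (fun z => z 0 i) f) => //; exact: holomorphic_coord. Qed.

End local_differentiability.

(** * The inner product of the Hardy space as a limit *)

Section hardy_limits.
Context {R : realType} (n : nat).
Local Notation RM := (measurableTypeR R).
Local Notation C := R[i].
Local Notation Cn := 'rV[C]_n.
Implicit Types (f g u v : Cn -> C).

Lemma cvg_ub (a : nat -> R) (l B : R) : a @ \oo --> l -> (forall k, a k <= B) -> l <= B.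
Proof.
by move=> al aB; apply: (cvgr_to_le al); exact: nearW.
Qed.

Lemma cvgC_sum (I : Type) (s : seq I) (a : I -> nat -> C) (l : I -> C) :
  (forall i, a i @ \oo --> l i) -> (fun k => \sum_(i <- s) a i k) @ \oo --> \sum_(i <- s) l i.
Proof.
move=> al; elim: s => [|i s ih].
  rewrite big_nil; have -> : (fun k => \sum_(i <- [::]) a i k) = fun=> 0.
    by apply/funext => k; rewrite big_nil.
  exact: cvg_cst.
rewrite big_cons.
have -> : (fun k => \sum_(j <- i :: s) a j k) = (fun k => a i k + \sum_(j <- s) a j k).
  by apply/funext => k; rewrite big_cons.
exact: (cvgD (al i) ih).
Qed.

Lemma integral_msq f (r : R) : holomorphic f -> 0 <= r < 1 ->
  (\int[torus_measure R n]_t (modulus (f (torus_point r t)) ^+ 2)%:E)%E = (msq f r)%:E.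
Proof.
move=> hf r01; rewrite /msq /Tnormsq /Rintegral fineK//.
exact: (integrable_fin_num measurableT (bmeas_integrable_sqr (bmeas_torus hf r01))).
Qed.

Lemma hardy_normsq_le f (B : R) : holomorphic f ->
  (forall r, 0 <= r < 1 -> msq f r <= B) -> (hardy_normsq f <= B%:E)%E.
Proof.
move=> hf fB; apply: ge_ereal_sup => _ [r /= r01 <-].
by rewrite integral_msq// lee_fin fB.
Qed.

Lemma msq_le_normsq f (r : R) : holomorphic f -> 0 <= r < 1 -> ((msq f r)%:E <= hardy_normsq f)%E.
Proof.
by move=> hf r01; rewrite -integral_msq//; apply: ereal_sup_ubound; exists r.
Qed.

Lemma hardy_normsqE f : holomorphic f -> (hardy_normsq f < +oo)%E ->
  hardy_normsq f = (hardy_norm f ^+ 2)%:E.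
Proof.
move=> hf foo; have h0 : (0 <= hardy_normsq f)%E.
  apply: (le_trans _ (@msq_le_normsq f 0 hf _)); last by rewrite lexx ltr01.
  by rewrite lee_fin msq_ge0.
rewrite /hardy_norm sqr_sqrtr ?fine_ge0// fineK//.
by rewrite fin_num_abs gee0_abs.
Qed.

Lemma msq_le_norm f (r : R) : H2 f -> 0 <= r < 1 -> msq f r <= hardy_norm f ^+ 2.
Proof.
by move=> [hf foo _] r01; rewrite -lee_fin -hardy_normsqE// msq_le_normsq.
Qed.

(** The way membership in H2 and bounds of norms are proved below. *)
Lemma H2_bound f (B : R) : holomorphic f -> (forall z, ~ polydisc z -> f z = 0) ->
  (forall r, 0 <= r < 1 -> msq f r <= B) -> H2 f /\ hardy_norm f ^+ 2 <= B.
Proof.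
move=> hf f0 fB; have h := hardy_normsq_le hf fB.
have foo : (hardy_normsq f < +oo)%E by exact: le_lt_trans h (ltry _).
by split => //; rewrite -lee_fin -hardy_normsqE.
Qed.

(** The supremum defining the norm is a limit, by monotonicity in the radius.
    *)
Lemma cvg_msq f : H2 f -> (fun k => msq f (inc_radius k)) @ \oo --> hardy_norm f ^+ 2.
Proof.
move=> H2f; have [hf foo _] := H2f; apply/cvgrPdist_lt => e e0.
have [r r01 rN] : exists2 r : R, 0 <= r < 1 & hardy_norm f ^+ 2 - e < msq f r.
  apply/not_exists2P => H.
  have : (hardy_normsq f <= (hardy_norm f ^+ 2 - e)%:E)%E.
    by apply: hardy_normsq_le => // r r01; have [//|/negP] := H r; rewrite -leNgt.
  by rewrite hardy_normsqE// lee_fin; lra.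
have /andP[r0 r1] := r01; have := near_inc_radius r1; apply: filterS => k rk.
rewrite ger0_norm ?subr_ge0 ?msq_le_norm ?inc_radius_itv0//.
have /andP[_ k1] := @inc_radius_itv R k.
have := msq_mono hf r0 rk k1; lra.
Qed.

Lemma bmeasMJ m (F G : m.-tuple RM -> C) : bmeas setT F -> bmeas setT G ->
  bmeas setT (fun t => F t * (G t)^*).
Proof. by move=> bF bG; apply: bmeasM => //; exact: bmeasJ. Qed.

Lemma msqB_le f g (r : R) : holomorphic f -> holomorphic g -> 0 <= r < 1 ->
  msq (f - g) r <= 2 * msq f r + 2 * msq g r.
Proof.
move=> hf hg r01; have bf := bmeas_torus hf r01; have bg := bmeas_torus hg r01.
rewrite /msq (Tnormsq_expand bf bg).
have := torus_cauchy_schwarz bf bg ler01; set a := Tint _; rewrite expr1n !mul1r mulr1 => h.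
have := ler_Re_modulus a; rewrite -normrN => /(le_trans (ler_norm _)); lra.
Qed.

Lemma msqZ (c : C) f (r : R) : holomorphic f -> 0 <= r < 1 ->
  msq (c *: f) r = modulus c ^+ 2 * msq f r.
Proof. by move=> hf r01; rewrite /msq -Tnormsq_Z//; exact: bmeas_torus. Qed.

Lemma H2_B f g : H2 f -> H2 g -> H2 (f - g).
Proof.
move=> H2f H2g; have [[hf _ f0] [hg _ g0]] := (H2f, H2g).
apply: (proj1 (@H2_bound _ (2 * hardy_norm f ^+ 2 + 2 * hardy_norm g ^+ 2) _ _ _)).
- exact: holomorphicB.
- by move=> z zp; rewrite !fctE f0// g0// subrr.
- move=> r r01; apply: le_trans (msqB_le hf hg r01) _.
  by rewrite lerD// ler_pM2l// msq_le_norm.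
Qed.

Lemma H2_Z (c : C) f : H2 f -> H2 (c *: f).
Proof.
move=> H2f; have [hf _ f0] := H2f.
apply: (proj1 (@H2_bound _ (modulus c ^+ 2 * hardy_norm f ^+ 2) _ _ _)).
- exact: holomorphicZ.
- by move=> z zp; rewrite !fctE f0// scaler0.
- by move=> r r01; rewrite msqZ// ler_wpM2l ?sqr_ge0// msq_le_norm.
Qed.

Lemma H2_D f g : H2 f -> H2 g -> H2 (f + g).
Proof.
move=> H2f H2g; have -> : f + g = f - (-1) *: g by rewrite scaleN1r opprK.
exact: (H2_B H2f (H2_Z (-1) H2g)).
Qed.

Lemma H2_0 : H2 (0 : Cn -> C).
Proof.
have h0 : holomorphic (0 : Cn -> C) by exact: (@holomorphic_cst _ _ 0).
apply: (proj1 (@H2_bound _ 0 h0 _ _)) => // r r01.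
by apply: Tnormsq_le; [exact: bmeas_torus|move=> t; rewrite modulus0 expr0n].
Qed.

(** The identity defining hardy_dot, for complex numbers. *)
Lemma polarization (x y : C) :
  x * y^* = 4^-1 * \sum_(k < 4) 'i ^+ k * ((x + 'i ^+ k * y) * (x + 'i ^+ k * y)^*).
Proof.
rewrite !big_ord_recl big_ord0/= expr0 expr1 exprSr expr1.
have i2 : 'i * 'i = -1 :> C by rewrite -expr2 sqr_i.
have cJ1 : (1 : C)^* = 1 by exact: conjc1.
have iJ : ('i : C)^* = - 'i by apply/eqP; rewrite eq_complex/= oppr0 !eqxx.
have -> : ('i : C) ^+ bump 0 (bump 0 (bump 0 0)) = - 'i.
  by rewrite /bump/= exprS sqr_i mulrN1.
have cD (u v : C) : (u + v)^* = u^* + v^* by exact: rmorphD.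
have cM (u v : C) : (u * v)^* = u^* * v^* by exact: rmorphM.
have cN (u : C) : (- u)^* = - u^* by exact: rmorphN.
rewrite i2 !mul1r !cD !cM !cN iJ cJ1.
have i4 : 4 != 0 :> C by rewrite pnatr_eq0.
apply: (mulfI i4); rewrite [RHS]mulrA divff// mul1r.
transitivity (4 * (x * y^*) + ('i * 'i + 1) * (- 2 * (x * y^*) + 2 * (x^* * y) )).
  by rewrite i2 addNr mul0r addr0.
by ring.
Qed.

Lemma mdot_polarization f g (r : R) : holomorphic f -> holomorphic g -> 0 <= r < 1 ->
  mdot f g r r = 4^-1 * \sum_(k < 4) 'i ^+ k * (msq (f + 'i ^+ k *: g) r)%:C.
Proof.
move=> hf hg r01; have bf := bmeas_torus hf r01; have bg := bmeas_torus hg r01.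
have bk (k : 'I_4) : bmeas setT (fun t : n.-tuple RM =>
    f (rpoint (fun=> r) t) + 'i ^+ k * g (rpoint (fun=> r) t)).
  by apply: bmeasD => //; exact: bmeasZ.
have bk2 k := bmeasMJ (bk k) (bk k).
rewrite /mdot (eq_Tint (fun t => polarization _ _)) Tint_Z; last first.
  by apply: bmeas_sum => k _; apply: bmeasZ; exact: bk2.
congr (_ * _); rewrite /Tint (Cint_sum measurableT (torus_lty n)); last first.
  by move=> k _; apply: bmeasZ; exact: bk2.
by apply: eq_bigr => k _; rewrite (Cint_Z measurableT (torus_lty n) _ (bk2 k)) /msq -Tnormsq_TI.
Qed.

(** Polarization commutes with the limit; the algebra of hardy_dot is
    inherited from that of integrals over tori. *)
Lemma cvg_dot f g : H2 f -> H2 g -> (fun k => mdot f g (inc_radius k) (inc_radius k)) @ \oo --> hardy_dot f g.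
Proof.
move=> H2f H2g; have [[hf _ _] [hg _ _]] := (H2f, H2g).
have -> : (fun k => mdot f g (inc_radius k) (inc_radius k)) = (fun k : nat => 4^-1 * \sum_(j < 4)
    'i ^+ j * (msq (f + 'i ^+ j *: g) (inc_radius k))%:C).
  by apply/funext => k; rewrite mdot_polarization// inc_radius_itv0.
apply: (cvgM (cvg_cst _)); apply: cvgC_sum => j.
apply: (cvgM (cvg_cst _)); apply: cvg_realC; apply: cvg_msq.
exact: (H2_D H2f (H2_Z _ H2g)).
Qed.

Lemma hardy_dot_eq f g (l : C) : H2 f -> H2 g ->
  (fun k => mdot f g (inc_radius k) (inc_radius k)) @ \oo --> l -> hardy_dot f g = l.
Proof. by move=> H2f H2g; exact: (cvgC_unique (cvg_dot H2f H2g)). Qed.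

Lemma dotff f : H2 f -> hardy_dot f f = (hardy_norm f ^+ 2)%:C.
Proof.
move=> H2f; apply: (hardy_dot_eq H2f H2f).
have -> : (fun k => mdot f f (inc_radius k) (inc_radius k)) = (fun k => (msq f (inc_radius k))%:C).
  by apply/funext => k; rewrite mdotff.
by apply: cvg_realC; exact: cvg_msq.
Qed.

Lemma mdotBl f g u (r : R) : holomorphic f -> holomorphic g -> holomorphic u -> 0 <= r < 1 ->
  mdot (f - g) u r r = mdot f u r r - mdot g u r r.
Proof.
move=> hf hg hu r01.
have bf := bmeas_torus hf r01; have bg := bmeas_torus hg r01; have bu := bmeas_torus hu r01.
rewrite /mdot -(Tint_B (bmeasMJ bf bu) (bmeasMJ bg bu)); apply: eq_Tint => t.
exact: mulrBl.
Qed.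

Lemma mdotC f g (r : R) : holomorphic f -> holomorphic g -> 0 <= r < 1 ->
  mdot g f r r = (mdot f g r r)^*.
Proof.
move=> hf hg r01; have bf := bmeas_torus hf r01; have bg := bmeas_torus hg r01.
rewrite /mdot -(Tint_conj (bmeasMJ bf bg)); apply: eq_Tint => t.
by rewrite rmorphM/= conjcK mulrC.
Qed.

Lemma mdotZl (c : C) f u (r : R) : holomorphic f -> holomorphic u -> 0 <= r < 1 ->
  mdot (c *: f) u r r = c * mdot f u r r.
Proof.
move=> hf hu r01; have bf := bmeas_torus hf r01; have bu := bmeas_torus hu r01.
rewrite /mdot -(Tint_Z _ (bmeasMJ bf bu)); apply: eq_Tint => t.
by rewrite mulrA.
Qed.

Lemma dotBl f g u : H2 f -> H2 g -> H2 u ->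
  hardy_dot (f - g) u = hardy_dot f u - hardy_dot g u.
Proof.
move=> H2f H2g H2u; have [[hf _ _] [hg _ _] [hu _ _]] := And3 H2f H2g H2u.
apply: (hardy_dot_eq (H2_B H2f H2g) H2u).
have -> : (fun k => mdot (f - g) u (inc_radius k) (inc_radius k)) =
    (fun k => mdot f u (inc_radius k) (inc_radius k) - mdot g u (inc_radius k) (inc_radius k)).
  by apply/funext => k; rewrite mdotBl// inc_radius_itv0.
exact: (cvgB (cvg_dot H2f H2u) (cvg_dot H2g H2u)).
Qed.

Lemma dotZl (c : C) f u : H2 f -> H2 u -> hardy_dot (c *: f) u = c * hardy_dot f u.
Proof.
move=> H2f H2u; have [[hf _ _] [hu _ _]] := (H2f, H2u).
apply: (hardy_dot_eq (H2_Z c H2f) H2u).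
have -> : (fun k => mdot (c *: f) u (inc_radius k) (inc_radius k)) = (fun k => c * mdot f u (inc_radius k) (inc_radius k)).
  by apply/funext => k; rewrite mdotZl// inc_radius_itv0.
exact: (cvgM (cvg_cst _) (cvg_dot H2f H2u)).
Qed.

Lemma dotC f g : H2 f -> H2 g -> hardy_dot g f = (hardy_dot f g)^*.
Proof.
move=> H2f H2g; have [[hf _ _] [hg _ _]] := (H2f, H2g).
apply: (hardy_dot_eq H2g H2f).
have -> : (fun k => mdot g f (inc_radius k) (inc_radius k)) = (fun k => (mdot f g (inc_radius k) (inc_radius k))^*).
  by apply/funext => k; rewrite (mdotC hf)// inc_radius_itv0.
by apply: cvg_conj; exact: (cvg_dot H2f H2g).
Qed.

Lemma dotDl f g u : H2 f -> H2 g -> H2 u ->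
  hardy_dot (f + g) u = hardy_dot f u + hardy_dot g u.
Proof.
move=> H2f H2g H2u; have -> : f + g = f - (-1) *: g by rewrite scaleN1r opprK.
by rewrite (dotBl H2f (H2_Z (-1) H2g) H2u) (dotZl _ H2g H2u) mulN1r opprK.
Qed.

Lemma dot0l u : H2 u -> hardy_dot 0 u = 0.
Proof. by move=> H2u; rewrite -(scale0r (0 : Cn -> C)) (dotZl _ H2_0 H2u) mul0r. Qed.

Lemma dot0r u : H2 u -> hardy_dot u 0 = 0.
Proof. by move=> H2u; rewrite (dotC H2_0 H2u) (dot0l H2u) conjc0. Qed.

(** The Cauchy-Schwarz inequality, with a weight s in place of square roots.
    *)
Lemma dot_le u v (s : R) : H2 u -> H2 v -> 0 <= s ->
  2 * s * modulus (hardy_dot u v) <= s ^+ 2 * hardy_norm u ^+ 2 + hardy_norm v ^+ 2.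
Proof.
move=> H2u H2v s0; have [[hu _ _] [hv _ _]] := (H2u, H2v).
apply: (@cvg_ub (fun k => 2 * s * modulus (mdot u v (inc_radius k) (inc_radius k)))).
  exact: (cvgM (cvg_cst _) (cvg_modulus (cvg_dot H2u H2v))).
move=> k; have r01 := @inc_radius_itv0 R k.
have H := torus_cauchy_schwarz (bmeas_torus hu r01) (bmeas_torus hv r01) s0.
apply: (le_trans H); by rewrite lerD// ?ler_wpM2l ?sqr_ge0// msq_le_norm.
Qed.

End hardy_limits.

(** * The adjoint of multiplication by a coordinate *)

Section shifts.
Context {R : realType} (n : nat).
Local Notation RM := (measurableTypeR R).
Local Notation C := R[i].
Local Notation Cn := 'rV[C]_n.
Implicit Types (f g u v q : Cn -> C) (i : 'I_n).

Lemma bmeas_torus_slice0 i q (r : R) : holomorphic q -> 0 <= r < 1 ->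
  bmeas setT (fun t => q (setc (rpoint (fun=> r) t) i 0)).
Proof.
move=> hq /andP[r0 r1]; pose a (j : 'I_n) := if j == i then 0 else r.
have -> : (fun t => q (setc (rpoint (fun=> r) t) i 0)) = (fun t => q (rpoint a t)).
  apply/funext => t; congr q; apply/rowP => j; rewrite setcE !mxE /a.
  by case: ifPn; rewrite ?mul0r.
apply: (bmeas_rpoint r1) (holomorphic_continuous hq) => j.
by rewrite /a; case: ifPn; rewrite ?r0 ?lexx.
Qed.

Lemma mulz_torus i u (r : R) (t : n.-tuple RM) :
  mulz i u (rpoint (fun=> r) t) = r%:C * expi (tnth t i) * u (rpoint (fun=> r) t).
Proof. by rewrite /mulz mxE. Qed.

(** Only the first factor depends on the i-th angle, and its mean in that
    angle is its value at z_i = 0, which is 0. *)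
Lemma mulz_slice_ortho i u q (r : R) : holomorphic u -> holomorphic q -> 0 <= r < 1 ->
  Tint (fun t => mulz i u (rpoint (fun=> r) t) * (q (setc (rpoint (fun=> r) t) i 0))^*) = 0.
Proof.
move=> hu hq r01; have /andP[r0 r1] := r01.
have hz := holomorphic_mulz i hu.
rewrite (Tint_avg i (bmeasMJ (bmeas_torus hz r01) (bmeas_torus_slice0 i hq r01))).
rewrite -[RHS](Cint_cst_prob (torus_measure R n)); apply: eq_Tint => t.
set z := rpoint (fun=> r) t.
have zp : polydisc z by apply: polydisc_rpoint => j.
pose phi (y : C) := mulz i u (setc z i y).
have dphi y : modulus y < 1 -> cdiff phi y by move=> y1; exact: holomorphic_slice.
have phi0 : phi 0 = 0 by rewrite /phi /mulz setcE eqxx mul0r.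
have mphi : avg (fun s => phi (r%:C * expi (s : R))) = 0.
  move: r0; rewrite le_eqVlt => /predU1P[r0|r0].
    rewrite -[RHS](Cint_cst_prob (uniform_prob (@pi2_gt0 R))).
    by apply: eq_Cint => s _; rewrite -r0 mul0r.
  by rewrite -[RHS]phi0; apply: mean_value => //; rewrite r0.
have bphi : bmeas setT (fun s : RM => phi (r%:C * expi (s : R))).
  apply: circle_bmeas => // y yr; apply: cdiff_continuous; apply: dphi.
  by rewrite yr.
have P1 := @probability_lty R _ _ (uniform_prob (@pi2_gt0 R)).
transitivity (avg (fun s => (q (setc z i 0))^* * phi (r%:C * expi (s : R)))).
  by apply: eq_Cint => s _; rewrite rpoint_set_angle setc_set -/z mulrC.
by rewrite /avg (Cint_Z measurableT P1 _ bphi) -/(avg _) mphi mulr0.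
Qed.

Lemma torus_bshift i q (r : R) (t : n.-tuple RM) : holomorphic q -> 0 <= r < 1 ->
  q (rpoint (fun=> r) t) = mulz i (bshift i q) (rpoint (fun=> r) t)
    + q (setc (rpoint (fun=> r) t) i 0).
Proof.
move=> hq r01; rewrite /mulz bshift_mul ?subrK//.
by apply: polydisc_rpoint => j.
Qed.

(** On the torus q is z_i (bshift i q) plus its restriction to z_i = 0; the
    latter contributes 0 by mulz_slice_ortho, and z_i conj z_i = r^2 in the
    former. *)
Lemma mdot_bshift i u q (r : R) : holomorphic u -> holomorphic q -> 0 <= r < 1 ->
  mdot (mulz i u) q r r = (r ^+ 2)%:C * mdot u (bshift i q) r r.
Proof.
move=> hu hq r01; have /andP[r0 r1] := r01.
have hS := bshift_holomorphic i hq.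
have hzu := holomorphic_mulz i hu; have hzS := holomorphic_mulz i hS.
have b1 := bmeasMJ (bmeas_torus hzu r01) (bmeas_torus hzS r01).
have b2 := bmeasMJ (bmeas_torus hzu r01) (bmeas_torus_slice0 i hq r01).
rewrite /mdot -(Tint_Z _ (bmeasMJ (bmeas_torus hu r01) (bmeas_torus hS r01))).
transitivity (Tint (fun t : n.-tuple RM =>
    mulz i u (rpoint (fun=> r) t) * (mulz i (bshift i q) (rpoint (fun=> r) t))^*
  + mulz i u (rpoint (fun=> r) t) * (q (setc (rpoint (fun=> r) t) i 0))^*)).
  apply: eq_Tint => t; rewrite [in LHS](torus_bshift i t hq r01).
  by rewrite [(_ + _)^*]rmorphD mulrDr.
rewrite (Tint_D b1 b2) (mulz_slice_ortho i hu hq r01) addr0.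
apply: eq_Tint => t; rewrite !mulz_torus.
set e := r%:C * expi _; have <- : e * e^* = (r ^+ 2)%:C.
  by rewrite mulcc_modulus modulusM modulus_expi mulr1 modulus_real.
by rewrite [(e * _)^*]rmorphM/=; ring.
Qed.

(** The two parts of q on the torus are orthogonal. *)
Lemma msq_bshift i q (r : R) : holomorphic q -> 0 <= r < 1 ->
  r ^+ 2 * msq (bshift i q) r <= msq q r.
Proof.
move=> hq r01; have /andP[r0 r1] := r01.
have hS := bshift_holomorphic i hq; have hzS := holomorphic_mulz i hS.
have b0 := bmeas_torus_slice0 i hq r01.
have bq := bmeas_torus hq r01.
have -> : r ^+ 2 * msq (bshift i q) r =
    Tnormsq (fun t => q (rpoint (fun=> r) t) - q (setc (rpoint (fun=> r) t) i 0)).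
  have rE : r ^+ 2 = modulus r%:C ^+ 2 by rewrite modulus_real.
  rewrite rE /msq -(Tnormsq_Z _ (bmeas_torus hS r01)); apply: eq_Rintegral => t _.
  rewrite (torus_bshift i t hq r01) addrK mulz_torus !modulusM modulus_expi.
  by rewrite mulr1.
rewrite (Tnormsq_expand bq b0) -/(msq q r).
have -> : Tint (fun t => q (rpoint (fun=> r) t) * (q (setc (rpoint (fun=> r) t) i 0))^*) =
    (Tnormsq (fun t => q (setc (rpoint (fun=> r) t) i 0)))%:C.
  rewrite -Tnormsq_TI.
  have b1 := bmeasMJ (bmeas_torus hzS r01) b0.
  have := Tint_D b1 (bmeasMJ b0 b0); rewrite /= (mulz_slice_ortho i hS hq r01) add0r => <-.
  by apply: eq_Tint => t; rewrite {1}(torus_bshift i t hq r01) mulrDl.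
have := Tnormsq_ge0 (fun t => q (setc (rpoint (fun=> r) t) i 0)).
by rewrite /=; lra.
Qed.

Lemma msq_mulz i u (r : R) : holomorphic u -> 0 <= r < 1 -> msq (mulz i u) r <= msq u r.
Proof.
move=> hu r01; have /andP[r0 r1] := r01.
apply: (Tnormsq_mono (bmeas_torus (holomorphic_mulz i hu) r01) (bmeas_torus hu r01)) => t.
rewrite mulz_torus !modulusM modulus_expi mulr1 modulus_real// exprMn.
by rewrite ler_piMl ?sqr_ge0// exprn_ile1// ltW.
Qed.

Lemma H2_mulz i u : H2 u -> H2 (mulz i u) /\ hardy_norm (mulz i u) ^+ 2 <= hardy_norm u ^+ 2.
Proof.
move=> H2u; have [hu _ u0] := H2u.
apply: (H2_bound (holomorphic_mulz i hu)).
  by move=> z zp; rewrite /mulz u0// mulr0.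
move=> r r01; exact: (le_trans (msq_mulz i hu r01) (msq_le_norm H2u r01)).
Qed.

Lemma H2_bshift i q : H2 q -> H2 (bshift i q).
Proof.
move=> H2q; have [hq _ _] := H2q; have hS := bshift_holomorphic i hq.
(* msq_bshift loses a factor 1 / r^2, at most 4 for r >= 1/2; monotonicity
   gives the smaller radii. *)
apply: (proj1 (@H2_bound _ _ _ (4 * hardy_norm q ^+ 2) hS (fun z => @bshift_out _ _ i q z) _)).
move=> r /andP[r0 r1].
pose s : R := Num.max r 2^-1.
have s1 : s < 1 by rewrite gt_max r1/=; lra.
have s2 : 2^-1 <= s by rewrite le_max lexx orbT.
have s0 : 0 <= s by apply: le_trans s2; rewrite invr_ge0.
have rs : r <= s by rewrite le_max lexx.
apply: (le_trans (msq_mono hS r0 rs s1)).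
have s01 : 0 <= s < 1 by rewrite s0.
have := le_trans (msq_bshift i hq s01) (msq_le_norm H2q s01).
have : 4^-1 <= s ^+ 2.
  have -> : 4^-1 = 2^-1 ^+ 2 :> R by field.
  by rewrite lerXn2r// nnegrE invr_ge0.
have := msq_ge0 (bshift i q) s; set a := msq _ _; set b := hardy_norm _ ^+ 2.
move=> a0 /(ler_wpM2r a0); lra.
Qed.

(** The factor r^2 of mdot_bshift disappears in the limit. *)
Lemma dot_mulz i u q : H2 u -> H2 q -> hardy_dot (mulz i u) q = hardy_dot u (bshift i q).
Proof.
move=> H2u H2q; have [[hu _ _] [hq _ _]] := (H2u, H2q).
apply: (hardy_dot_eq (H2_mulz i H2u).1 H2q).
have -> : (fun k => mdot (mulz i u) q (inc_radius k) (inc_radius k)) =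
    (fun k => ((inc_radius k : R) ^+ 2)%:C * mdot u (bshift i q) (inc_radius k) (inc_radius k)).
  by apply/funext => k; rewrite (mdot_bshift i hu hq (inc_radius_itv0 k)).
rewrite -[hardy_dot u _]mul1r.
have c1 : (fun k => ((inc_radius k : R) ^+ 2)%:C) @ \oo --> (1 : C).
  have -> : (1 : C) = ((1 : R) ^+ 2)%:C by rewrite expr1n.
  apply: cvg_realC; rewrite expr2; under eq_fun do rewrite expr2.
  exact: (cvgM cvg_inc_radius cvg_inc_radius).
exact: (cvgM c1 (cvg_dot H2u (H2_bshift i H2q))).
Qed.

(** Cauchy's formula bounds point values by mean squares. *)
Lemma hardy_norm_eq0 f : H2 f -> hardy_norm f = 0 -> f = 0.
Proof.
move=> H2f f0; have [hf _ fout] := H2f.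
apply/funext => z; have [zp|zp] := pselect (polydisc z); last exact: fout.
have [r r01 zr] := polydisc_radius zp.
have r01' : 0 <= r < 1 by move: r01 => /andP[/ltW -> ->].
rewrite (cauchy_polydisc hf zr r01).
have bk : bmeas setT (fun t : n.-tuple RM => \prod_(i < n) ckern r (z 0 i) (tnth t i)).
  exact: bmeas_ckern_prod.
have bf := bmeas_torus hf r01'.
have CS s := @torus_cauchy_schwarz _ _ _ _ s bf (bmeasJ bk).
apply/eqP; rewrite -modulus_eq0; apply/eqP.
set a := modulus _.
have aE s : 0 <= s -> 2 * s * a <= Tnormsq (fun t : n.-tuple RM =>
    (\prod_(i < n) ckern r (z 0 i) (tnth t i))^*).
  move=> s0; have := CS s s0.
  have -> : Tint (fun t => f (rpoint (fun=> r) t) *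
    ((\prod_(i < n) ckern r (z 0 i) (tnth t i))^*)^*) =
    Tint (fun t => f (rpoint (fun=> r) t) * \prod_(i < n) ckern r (z 0 i) (tnth t i)).
    by apply: eq_Tint => t; rewrite conjcK.
  rewrite -/a -/(msq f r).
  have -> : msq f r = 0.
    by apply/eqP; rewrite eq_le msq_ge0 andbT (le_trans (msq_le_norm H2f r01'))// f0 expr0n.
  by rewrite mulr0 add0r.
set b := Tnormsq _ in aE; have a0 : 0 <= a by exact: modulus_ge0.
apply/eqP; rewrite eq_le a0 andbT leNgt; apply/negP => a1.
have b0 : 0 <= b by exact: Tnormsq_ge0.
(* A weight contradicting 2 s a <= b. *)
have := aE (b / a + 1) _; rewrite addr_ge0 ?divr_ge0// => /(_ isT).
have -> : 2 * (b / a + 1) * a = 2 * b + 2 * a by field; rewrite gt_eqF.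
lra.
Qed.

Lemma hardy_dotff_eq0 f : H2 f -> hardy_dot f f = 0 -> f = 0.
Proof.
move=> H2f; rewrite (dotff H2f) => /(congr1 (@complex.Re R))/= /eqP.
by rewrite sqrf_eq0 => /eqP; exact: hardy_norm_eq0.
Qed.

End shifts.

(** * Approximation by dilations *)

Section dilation.
Context {R : realType} (n : nat).
Local Notation RM := (measurableTypeR R).
Local Notation C := R[i].
Local Notation Cn := 'rV[C]_n.
Implicit Types (f g u v q : Cn -> C) (i : 'I_n).

(** The dilation of f by s, which is bounded on the polydisc when s < 1. *)
Definition dil (s : R) f : Cn -> C := trunc (fun z => f (s%:C *: z)).

Lemma polydisc_scale (s : R) (z : Cn) : 0 <= s <= 1 -> polydisc z -> polydisc (s%:C *: z).
Proof.
move=> /andP[s0 s1] zp i; rewrite mxE modulusM modulus_real//.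
by apply: le_lt_trans (zp i); rewrite ler_piMl ?modulus_ge0.
Qed.

Lemma dil_holomorphic (s : R) f : 0 <= s <= 1 -> holomorphic f -> holomorphic (dil s f).
Proof.
move=> s01 hf; apply: trunc_holomorphic => z zp.
apply: (@differentiable_comp _ _ _ _ (fun z : Cn => s%:C *: z) f).
  exact: differentiableZ.
by apply: hf; exact: polydisc_scale.
Qed.

Lemma dil_torus (s r : R) f (t : n.-tuple RM) : 0 <= r < 1 ->
  dil s f (rpoint (fun=> r) t) = f (rpoint (fun=> s * r) t).
Proof.
move=> r01; rewrite /dil truncE; last by apply: polydisc_rpoint.
by congr f; apply/rowP => i; rewrite !mxE rmorphM/= mulrA.
Qed.

Lemma dil_bounded (s : R) f : 0 <= s < 1 -> holomorphic f ->
  exists2 P : R, 0 < P & forall z, modulus (dil s f z) <= P.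
Proof.
move=> /andP[s0 s1] hf.
have [P P0 fP] := @compact_modulus_bounded _ _ _ f (@compact_polydisc _ n s)
  (fun z Kz => holomorphic_continuous hf (fun i => le_lt_trans (Kz i) s1)).
exists P => // z; rewrite /dil /trunc; case: asboolP => zp; last by rewrite modulus0 ltW.
by apply: fP => i; rewrite mxE modulusM modulus_real// ler_piMr// ltW// zp.
Qed.

(** By mdot_eq the scalar product of f and its dilation by s^2 on the torus of
    radius r is the mean square of f at radius s r. Dilating by a square
    avoids square roots of radii. *)
Lemma msq_dil_sub (s r : R) f : H2 f -> 0 <= s <= 1 -> 0 <= r < 1 ->
  msq (f - dil (s ^+ 2) f) r <= 2 * (hardy_norm f ^+ 2 - msq f (s * r)).
Proof.
move=> H2f /andP[s0 s1] /andP[r0 r1]; have [hf _ _] := H2f.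
have r01 : 0 <= r < 1 by rewrite r0.
have sr01 : 0 <= s * r < 1.
  by rewrite mulr_ge0//=; apply: le_lt_trans r1; rewrite ler_piMl.
have ssr01 : 0 <= s ^+ 2 * r < 1.
  by rewrite mulr_ge0 ?sqr_ge0//=; apply: le_lt_trans r1; rewrite ler_piMl// exprn_ile1.
have -> : msq (f - dil (s ^+ 2) f) r =
    Tnormsq (fun t => f (rpoint (fun=> r) t) - f (rpoint (fun=> s ^+ 2 * r) t)).
  by rewrite /msq; congr Tnormsq; apply/funext => t; rewrite !fctE dil_torus.
rewrite (Tnormsq_expand (bmeas_torus hf r01) (bmeas_torus hf ssr01)).
rewrite -/(mdot f f r (s ^+ 2 * r)) -/(msq f r) -/(msq f (s ^+ 2 * r)).
have E : r * (s ^+ 2 * r) = (s * r) * (s * r) by ring.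
rewrite (mdot_eq hf hf r01 ssr01 sr01 sr01 E) mdotff/=.
have aux (x y m w : R) : x <= m -> y <= m -> x + y - 2 * w <= 2 * (m - w) by lra.
exact: (aux _ _ _ _ (msq_le_norm H2f r01) (msq_le_norm H2f ssr01)).
Qed.

Lemma H2_dil (s : R) f : H2 f -> 0 <= s <= 1 -> H2 (dil s f).
Proof.
move=> H2f s01; have /andP[s0 s1] := s01; have [hf _ _] := H2f.
apply: (proj1 (H2_bound (dil_holomorphic s01 hf) (fun z => @trunc_out _ _ _ z)
  (B := hardy_norm f ^+ 2) _)) => r /andP[r0 r1].
have sr01 : 0 <= s * r < 1.
  by rewrite mulr_ge0//=; apply: le_lt_trans r1; rewrite ler_piMl.
have -> : msq (dil s f) r = msq f (s * r).
  by rewrite /msq; congr Tnormsq; apply/funext => t; rewrite dil_torus// r0.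
exact: msq_le_norm.
Qed.

(** msq_dil_sub controls the radii r at which f nearly attains its norm at s
    r, and monotonicity the smaller ones. *)
Lemma dil_approx f (e : R) : H2 f -> 0 < e ->
  exists2 s : R, 0 < s < 1 & hardy_norm (f - dil s f) ^+ 2 <= e.
Proof.
move=> H2f e0; have [hf _ _] := H2f.
have e20 : 0 < e / 2 by rewrite divr_gt0.
have /cvgrPdist_lt/(_ _ e20)[k _ kN] := cvg_msq H2f.
have {kN} := kN k (leqnn k); move=> /(le_lt_trans (ler_norm _)) /= kN.
have /andP[k0 k1] := @inc_radius_itv R k; set rho := inc_radius k in kN k0 k1.
pose s := (1 + rho) / 2.
have s0 : 0 < s by rewrite /s; lra.
have s1 : s < 1 by rewrite /s; lra.
have rs : rho < s by rewrite /s; lra.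
have s2 : 0 < s ^+ 2 < 1 by rewrite exprn_gt0//= exprn_ilt1// ltW.
have s2' : 0 <= s ^+ 2 <= 1 by rewrite !ltW//; case/andP: s2.
exists (s ^+ 2) => //.
have H2d := H2_dil H2f s2'.
have hfd : holomorphic (f - dil (s ^+ 2) f).
  by apply: holomorphicB => //; case: H2d.
have H0 z : ~ polydisc z -> (f - dil (s ^+ 2) f) z = 0 by have [_ _ h] := H2_B H2f H2d; exact: h.
apply: (proj2 (H2_bound hfd H0 _)) => r /andP[r0 r1].
pose r' := Num.max r (rho / s).
have r'1 : r' < 1 by rewrite gt_max r1 ltr_pdivrMr// mul1r.
have rr' : r <= r' by rewrite le_max lexx.
have r'0 : 0 <= r' by exact: le_trans rr'.
apply: (le_trans (msq_mono hfd r0 rr' r'1)).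
have r'01 : 0 <= r' < 1 by rewrite r'0.
have s01 : 0 <= s <= 1 by rewrite !ltW.
apply: (le_trans (msq_dil_sub H2f s01 r'01)).
have sr' : rho <= s * r'.
  by rewrite mulrC -ler_pdivrMr// le_max lexx orbT.
have sr'1 : s * r' < 1.
  by apply: le_lt_trans r'1; rewrite ler_piMl// ltW.
have := msq_mono hf (ltW k0) sr' sr'1; lra.
Qed.

End dilation.

(** * Monomial multiples of a function are close to multiples of an inner function *)

Section inner_approximation.
Context {R : realType} (n : nat).
Local Notation RM := (measurableTypeR R).
Local Notation C := R[i].
Local Notation Cn := 'rV[C]_n.
Implicit Types (f g h u v q theta p : Cn -> C) (i : 'I_n) (l : seq 'I_n).

Lemma cvg_inc_radius_left : inc_radius @ \oo --> (1 : R)^'-.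
Proof.
move=> A [e /= e0 Ae]; have := @cvg_inc_radius R => /cvgrPdist_lt /(_ _ e0).
apply: filterS => k /= ke; apply: Ae => //=.
by have /andP[] := @inc_radius_itv R k.
Qed.

Lemma Tnormsq_le_comb (F G H : n.-tuple RM -> C) (a c : R) :
  bmeas setT F -> bmeas setT G -> bmeas setT H ->
  (forall t, modulus (F t) ^+ 2 <= a * (modulus (G t) ^+ 2 + modulus (H t) ^+ 2) + c) ->
  Tnormsq F <= a * (Tnormsq G + Tnormsq H) + c.
Proof.
move=> bF bG bH FGH.
have iF := bmeas_integrable_sqr bF; have iG := bmeas_integrable_sqr bG.
have iH := bmeas_integrable_sqr bH.
have iC : (torus_measure R n).-integrable setT (EFin \o (fun=> c)).
  apply: (@bounded_integrable _ _ _ _ _ measurableT (torus_lty n) _ `|c|) => //.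
have iGH : (torus_measure R n).-integrable setT
    (EFin \o (fun t => modulus (G t) ^+ 2 + modulus (H t) ^+ 2)).
  exact: (integrableD measurableT iG iH).
have iaGH : (torus_measure R n).-integrable setT
    (EFin \o (fun t => a * (modulus (G t) ^+ 2 + modulus (H t) ^+ 2))).
  exact: (integrableZl measurableT a iGH).
have -> : a * (Tnormsq G + Tnormsq H) + c = \int[torus_measure R n]_t
    (a * (modulus (G t) ^+ 2 + modulus (H t) ^+ 2) + c).
  rewrite RintegralD// RintegralZl// RintegralD// Rintegral_cst//.
  by rewrite [fine _](congr1 fine (probability_setT _)) mulr1.
apply: le_Rintegral => //.
exact: (integrableD measurableT iaGH iC).
Qed.

Lemma hardy_normD_le f g : H2 f -> H2 g ->
  hardy_norm (f + g) ^+ 2 <= 2 * hardy_norm f ^+ 2 + 2 * hardy_norm g ^+ 2.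
Proof.
move=> H2f H2g; have H2N := H2_Z (-1) H2g.
have fgE : f + g = f - (-1) *: g by rewrite scaleN1r opprK.
have [[hf _ _] [hg _ _] [hN _ _]] := And3 H2f H2g H2N.
have [hfg _ fg0] := H2_D H2f H2g.
apply: (proj2 (H2_bound hfg fg0 _)) => r r01.
rewrite fgE; apply: (le_trans (msqB_le hf hN r01)).
rewrite (msqZ _ hg r01) modulusN modulus1 expr1n mul1r.
exact: (lerD (ler_wpM2l (ler0n R 2) (msq_le_norm H2f r01))
  (ler_wpM2l (ler0n R 2) (msq_le_norm H2g r01))).
Qed.

Lemma H2_mul theta g (M : R) : holomorphic theta ->
  (forall z, polydisc z -> modulus (theta z) <= M) -> H2 g -> H2 (theta * g).
Proof.
move=> ht tM H2g; have [hg _ g0] := H2g.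
have htg := holomorphicM ht hg.
apply: (proj1 (@H2_bound _ _ _ (M ^+ 2 * hardy_norm g ^+ 2) htg _ _)).
  by move=> z zp; rewrite !fctE g0// mulr0.
move=> r r01; have bg := bmeas_torus hg r01.
have pt (t : n.-tuple RM) : polydisc (rpoint (fun=> r) t) by apply: polydisc_rpoint.
have M0 : 0 <= M.
  by apply: le_trans (tM _ (pt [tuple of nseq n 0])); exact: modulus_ge0.
have mM : modulus M%:C = M by exact: modulus_real.
apply: (@le_trans _ _ (M ^+ 2 * msq g r)); last first.
  by apply: ler_wpM2l (msq_le_norm H2g r01); exact: sqr_ge0.
rewrite -[in leRHS]mM /msq -(Tnormsq_Z _ bg).
apply: (Tnormsq_mono (bmeas_torus htg r01) (bmeasZ _ bg)) => t.
rewrite fctE !modulusM mM !exprMn; apply: ler_wpM2r; first exact: sqr_ge0.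
rewrite lerXn2r ?nnegrE ?modulus_ge0//; exact: tM.
Qed.

Lemma H2_trunc theta (M : R) : holomorphic theta ->
  (forall z, polydisc z -> modulus (theta z) <= M) -> H2 (trunc theta).
Proof.
move=> ht tM; have htt := trunc_holomorphic ht.
apply: (proj1 (@H2_bound _ _ _ (M ^+ 2) htt (fun z => @trunc_out _ _ _ z) _)) => r r01.
have pt (t : n.-tuple RM) : polydisc (rpoint (fun=> r) t) by apply: polydisc_rpoint.
have M0 : 0 <= M.
  by apply: le_trans (tM _ (pt [tuple of nseq n 0])); exact: modulus_ge0.
apply: (Tnormsq_le (bmeas_torus htt r01)) => t; rewrite truncE//.
rewrite lerXn2r ?nnegrE ?modulus_ge0//; exact: tM.
Qed.

Definition mulw l f : Cn -> C := foldr (@mulz R n) f l.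

Lemma mulwE l f z : mulw l f z = (\prod_(i <- l) z 0 i) * f z.
Proof.
elim: l => [|i l ih]; first by rewrite big_nil mul1r.
by rewrite big_cons -mulrA -ih.
Qed.

Lemma H2_mulw l f : H2 f -> H2 (mulw l f) /\ hardy_norm (mulw l f) ^+ 2 <= hardy_norm f ^+ 2.
Proof.
move=> H2f; elim: l => [|i l [H2l nl]]; first by split.
have [h1 h2] := H2_mulz i H2l; exact: (conj h1 (le_trans h2 nl)).
Qed.

Definition full_word (K : nat) : seq 'I_n := flatten (nseq K (enum 'I_n)).

Lemma mulw_full K f z : mulw (full_word K) f z = (\prod_(i < n) z 0 i) ^+ K * f z.
Proof.
rewrite mulwE; congr (_ * _); elim: K => [|K ih]; first by rewrite big_nil.
by rewrite /full_word/= big_cat/= ih exprS big_enum.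
Qed.

(** On the torus of radius 1 this is (z_1 ... z_n)^K times the conjugate of
    polyval c z. *)
Definition reverse_poly K (c : {ffun 'I_n -> 'I_K.+1} -> C) : Cn -> C := fun z =>
  \sum_(a : {ffun 'I_n -> 'I_K.+1}) (c a)^* * \prod_(i < n) z 0 i ^+ (K - a i).

Lemma holomorphic_sum (I : Type) (s : seq I) (F : I -> Cn -> C) :
  (forall j, holomorphic (F j)) -> holomorphic (fun z => \sum_(j <- s) F j z).
Proof.
move=> hF; elim: s => [|j s ih].
  have -> : (fun z : Cn => \sum_(j <- [::]) F j z) = fun=> 0.
    by apply/funext => z; rewrite big_nil.
  exact: holomorphic_cst.
have -> : (fun z : Cn => \sum_(k <- j :: s) F k z) = F j + (fun z => \sum_(k <- s) F k z).
  by apply/funext => z; rewrite big_cons.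
exact: holomorphicD.
Qed.

Lemma holomorphic_prod (I : Type) (s : seq I) (F : I -> Cn -> C) :
  (forall j, holomorphic (F j)) -> holomorphic (fun z => \prod_(j <- s) F j z).
Proof.
move=> hF; elim: s => [|j s ih].
  have -> : (fun z : Cn => \prod_(j <- [::]) F j z) = fun=> 1.
    by apply/funext => z; rewrite big_nil.
  exact: holomorphic_cst.
have -> : (fun z : Cn => \prod_(k <- j :: s) F k z) = F j * (fun z => \prod_(k <- s) F k z).
  by apply/funext => z; rewrite big_cons.
exact: holomorphicM.
Qed.

Lemma reverse_poly_holomorphic K (c : {ffun 'I_n -> 'I_K.+1} -> C) :
  holomorphic (reverse_poly c).
Proof.
apply: holomorphic_sum => a; apply: (@holomorphicM _ _ (fun=> (c a)^*)).
  exact: holomorphic_cst.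
apply: holomorphic_prod => i.
have -> : (fun z : Cn => z 0 i ^+ (K - a i)) = (fun z => \prod_(j <- nseq (K - a i) i) z 0 j).
  by apply/funext => z; rewrite big_nseq -Monoid.iteropE.
apply: holomorphic_prod => j; exact: holomorphic_coord.
Qed.

Lemma reverse_poly_bounded K (c : {ffun 'I_n -> 'I_K.+1} -> C) z : polydisc z ->
  modulus (reverse_poly c z) <= \sum_a modulus (c a).
Proof.
move=> zp; apply: (le_trans (modulus_sum _ _ _)); apply: ler_sum => a _.
rewrite modulusM modulusJ modulus_prod ler_piMr ?modulus_ge0//.
apply: prodr_ile1 => i _; rewrite modulusX exprn_ge0 ?modulus_ge0//=.
by rewrite exprn_ile1 ?modulus_ge0// ltW.
Qed.

(** On the torus of radius r the product of z_i and its conjugate is r^2 in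
    place of 1, which costs a factor tending to 1 with r in each monomial. *)
Lemma reverse_poly_torus K (c : {ffun 'I_n -> 'I_K.+1} -> C) (r : R) (t : n.-tuple RM) :
  0 <= r < 1 ->
  modulus ((\prod_(i < n) rpoint (fun=> r) t 0 i) ^+ K * (polyval c (rpoint (fun=> r) t))^*
     - reverse_poly c (rpoint (fun=> r) t))
  <= (\sum_a modulus (c a)) * (1 - r ^+ (2 * K * n)).
Proof.
move=> /andP[r0 r1]; set z := rpoint _ t.
have zr i : modulus (z 0 i) = r by rewrite modulus_rpoint.
have -> : (polyval c z)^* = \sum_(a : {ffun 'I_n -> 'I_K.+1}) (c a)^* * \prod_(i < n) (z 0 i)^* ^+ a i.
  rewrite /polyval [LHS]rmorph_sum; apply: eq_bigr => a _.
  rewrite [LHS]rmorphM; congr (_ * _); rewrite [LHS]rmorph_prod.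
  by apply: eq_bigr => i _; exact: rmorphXn.
rewrite mulr_sumr -sumrB; apply: (le_trans (modulus_sum _ _ _)).
rewrite mulr_suml; apply: ler_sum => a _.
have -> : (\prod_(i < n) z 0 i) ^+ K * ((c a)^* * \prod_(i < n) (z 0 i)^* ^+ a i) =
    (c a)^* * (\prod_(i < n) z 0 i ^+ (K - a i) * (\prod_(i < n) (r ^+ 2) ^+ a i)%:C).
  rewrite mulrCA; congr (_ * _); rewrite -prodrXl rmorph_prod -!big_split/=.
  apply: eq_bigr => i _; rewrite rmorphXn/= -(zr i) -mulcc_modulus exprMn mulrA.
  by rewrite -exprD subnK// -ltnS.
rewrite -mulrBr -[X in _ - X]mulr1 -mulrBr !modulusM modulusJ.
rewrite ler_wpM2l ?modulus_ge0//.
have -> : (\prod_(i < n) (r ^+ 2) ^+ a i)%:C - 1 = - (1 - \prod_(i < n) (r ^+ 2) ^+ a i)%:C :> C.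
  by rewrite rmorphB/= rmorph1 opprB.
have p1 : \prod_(i < n) (r ^+ 2) ^+ a i <= 1 :> R.
  apply: prodr_ile1 => i _; rewrite !exprn_ge0//= exprn_ile1 ?exprn_ge0//.
  by rewrite exprn_ile1// ltW.
rewrite modulusN modulus_real ?subr_ge0//.
have m1 : modulus (\prod_(i < n) z 0 i ^+ (K - a i)) <= 1.
  rewrite modulus_prod; apply: prodr_ile1 => i _.
  by rewrite modulusX zr exprn_ge0//= exprn_ile1// ltW.
apply: (@le_trans _ _ (1 - \prod_(i < n) (r ^+ 2) ^+ a i)).
  by apply: ler_piMl => //; rewrite subr_ge0.
rewrite lerB//.
have -> : r ^+ (2 * K * n) = \prod_(i < n) (r ^+ 2) ^+ K.
  by rewrite prodr_const card_ord !exprM.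
apply: ler_prod => i _; rewrite !exprn_ge0//=.
apply: ler_wiXn2l; [exact: exprn_ge0|by rewrite exprn_ile1// ltW|].
exact: ltn_ord (a i).
Qed.

Lemma polyval_scale K (c : {ffun 'I_n -> 'I_K.+1} -> C) (s : C) (z : Cn) :
  polyval c (s *: z) = polyval (fun a => c a * \prod_(i < n) s ^+ a i) z.
Proof.
apply: eq_bigr => a _; rewrite -mulrA -big_split/=; congr (_ * _).
by apply: eq_bigr => i _; rewrite mxE exprMn.
Qed.

Lemma sqr_sum4_le (a b c d : R) : (a + b + c + d) ^+ 2 <= 4 * (a ^+ 2 + b ^+ 2) + 4 * (c ^+ 2 + d ^+ 2).
Proof.
rewrite -subr_ge0.
have -> : 4 * (a ^+ 2 + b ^+ 2) + 4 * (c ^+ 2 + d ^+ 2) - (a + b + c + d) ^+ 2 =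
    (a - b) ^+ 2 + (a - c) ^+ 2 + (a - d) ^+ 2 + (b - c) ^+ 2 + (b - d) ^+ 2 + (c - d) ^+ 2.
  by ring.
by rewrite !addr_ge0 ?sqr_ge0.
Qed.

(** Radial limits have modulus 1 almost everywhere and theta is bounded:
    bounded convergence along the radii. *)
Lemma inner_defect theta : inner_function theta ->
  (fun k => Tnormsq (fun t => 1 - theta (rpoint (fun=> inc_radius k) t) * (theta (rpoint (fun=> inc_radius k) t))^*))
    @ \oo --> (0 : R).
Proof.
move=> [[ht [M tM]] ta].
pose F k (t : n.-tuple RM) := 1 - theta (rpoint (fun=> inc_radius k) t) * (theta (rpoint (fun=> inc_radius k) t))^*.
have bF k : bmeas setT (F k).
  apply: (@bmeasB _ _ _ _ (fun=> 1)); first exact: bmeas_cst.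
  by apply: bmeasMJ; exact: (bmeas_torus ht (inc_radius_itv0 k)).
have -> : (0 : R) = \int[torus_measure R n]_(t in setT) 0 by rewrite Rintegral_cst// mul0r.
apply: (@cvg_Rintegral _ _ _ (torus_measure R n) setT measurableT (torus_lty n)
  (fun k t => modulus (F k t) ^+ 2) (fun=> 0) ((1 + M * M) ^+ 2)).
- by move=> k; case: (bmeas_modulus2 (bF k)).
- exact: measurable_cst.
- apply: filterS ta => t [l tl l1] _.
  have cl : (fun k => theta (rpoint (fun=> inc_radius k) t)) @ \oo --> l.
    exact: (cvg_comp _ _ cvg_inc_radius_left tl).
  have c1 : F ^~ t @ \oo --> 1 - l * l^*.
    exact: (cvgB (cvg_cst (1 : C)) (cvgM cl (cvg_conj cl))).
  have c0 : (fun k => modulus (F k t)) @ \oo --> (0 : R).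
    rewrite -[X in _ --> X]modulus0 -[X in modulus X](subrr 1).
    have -> : 1 - 1 = 1 - l * l^* :> C by rewrite mulcc_modulus l1 expr1n.
    exact: (cvg_modulus c1).
  have c2 : (fun k => modulus (F k t) * modulus (F k t)) @ \oo --> (0 : R).
    by rewrite -(mul0r (0 : R)); exact: (cvgM c0 c0).
  by move: c2; under eq_fun do rewrite -expr2.
- move=> k t _; rewrite ger0_norm ?sqr_ge0// lerXn2r ?nnegrE ?modulus_ge0//.
    by rewrite addr_ge0// -expr2 sqr_ge0.
  apply: (le_trans (modulusB _ _)); rewrite modulus1 lerD2l modulusM modulusJ.
  have := tM (rpoint (fun=> inc_radius k) t) (polydisc_rpoint t (fun=> inc_radius_itv0 k)) => h.
  by apply: ler_pM => //; exact: modulus_ge0.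
Qed.

End inner_approximation.

Section vanishing.
Context {R : realType} (n : nat).
Local Notation RM := (measurableTypeR R).
Local Notation C := R[i].
Local Notation Cn := 'rV[C]_n.
Implicit Types (f g h u v q p : Cn -> C) (i : 'I_n) (l : seq 'I_n).

(** Here q stands for the monomial, th and T for theta and a polynomial close
    to it, rv for the reversed polynomial. *)
Lemma defect_bound (q p th T rv : C) (P M b d : R) : 0 <= P ->
  modulus q <= 1 -> modulus p <= P -> modulus th <= M ->
  modulus (th - T) <= b -> modulus (q * T^* - rv) <= d ->
  modulus (q * p - th * (rv * p)) <= P * (modulus (1 - th * th^*) + M * b + M * d).
Proof.
move=> P0 q1 pP thM Tb rd.
have -> : q * p - th * (rv * p) =
    p * (q * (1 - th * th^*) + th * (q * (th - T)^*) + th * (q * T^* - rv)).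
  by rewrite [(th - T)^*]rmorphB/=; ring.
rewrite modulusM; apply: ler_pM => //; try exact: modulus_ge0.
apply: (le_trans (modulusD _ _)); apply: lerD; last first.
  by rewrite modulusM; apply: ler_pM => //; exact: modulus_ge0.
apply: (le_trans (modulusD _ _)); apply: lerD.
  by rewrite modulusM ler_piMl// modulus_ge0.
rewrite modulusM; apply: ler_pM => //; try exact: modulus_ge0.
rewrite modulusM modulusJ; apply: le_trans Tb.
by rewrite ler_piMl// modulus_ge0.
Qed.

Lemma cvg_defect (B : R) (m : nat) :
  (fun k => (B * (1 - inc_radius k ^+ m)) ^+ 2) @ \oo --> (0 : R).
Proof.
have c1 : (fun k => inc_radius k ^+ m) @ \oo --> (1 : R).
  elim: m => [|m ih].
    by under eq_fun do rewrite expr0; exact: cvg_cst.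
  have -> : (fun k => inc_radius k ^+ m.+1) = (fun k => inc_radius k * inc_radius k ^+ m) :> (nat -> R).
    by apply/funext => k; rewrite exprS.
  by rewrite -[X in _ --> X](mulr1 1); exact: (cvgM cvg_inc_radius ih).
have c2 : (fun k => B * (1 - inc_radius k ^+ m)) @ \oo --> (0 : R).
  rewrite -[X in _ --> X](mulr0 B) -[X in _ * X](subrr 1).
  exact: (cvgM (cvg_cst _) (cvgB (cvg_cst _) c1)).
have c3 : (fun k => (B * (1 - inc_radius k ^+ m)) * (B * (1 - inc_radius k ^+ m))) @ \oo --> (0 : R).
  by rewrite -[X in _ --> X](mulr0 0); exact: (cvgM c2 c2).
by move: c3; under eq_fun do rewrite -expr2.
Qed.

Variable theta : Cn -> C.
Hypothesis theta_inner : inner_function theta.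

Lemma inner_holomorphic : holomorphic theta. Proof. by case: theta_inner => -[]. Qed.

Lemma inner_bounded : exists2 M : R, 0 < M & forall z, polydisc z -> modulus (theta z) <= M.
Proof.
have [[_ [M tM]] _] := theta_inner; exists (Num.max M 1).
  by rewrite lt_max ltr01 orbT.
by move=> z zp; rewrite le_max tM.
Qed.

(** The polynomial approximates a dilation of theta uniformly, and the
    dilation approximates theta in H2; the estimate defect_bound is integrated
    over tori and its first and last terms vanish as the radius tends to 1. *)
Lemma word_approx_bounded p (P e : R) : H2 p -> 0 < P -> (forall z, modulus (p z) <= P) ->
  0 < e -> exists l h, H2 h /\ hardy_norm (mulw l p - theta * h) ^+ 2 <= e.
Proof.
move=> H2p P0 pP e0; have [hp _ p0] := H2p.
have ht := inner_holomorphic; have [M M0 tM] := inner_bounded.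
have D0 : 0 < 8 * P ^+ 2 * M ^+ 2 by rewrite !mulr_gt0// exprn_gt0.
(* The bound obtained in the limit is 4 P^2 M^2 (d + d^2). *)
pose d := Num.min 1 (e / (8 * P ^+ 2 * M ^+ 2)).
have d0 : 0 < d by rewrite lt_min ltr01 divr_gt0.
have d1 : d <= 1 by rewrite ge_min lexx.
have de : 8 * P ^+ 2 * M ^+ 2 * d <= e.
  by rewrite mulrC -ler_pdivlMr// ge_min lexx orbT.
have H2t := H2_trunc ht tM.
have [s /andP[s0 s1] sd] := dil_approx H2t d0.
have s01 : 0 <= s < 1 by rewrite ltW.
have s01' : 0 <= s <= 1 by rewrite !ltW.
have H2d := H2_dil H2t s01'.
have [K [c0 c0P]] := polynomial_approx ht s01 d0.
pose c (a : {ffun 'I_n -> 'I_K.+1}) := c0 a * \prod_(i < n) s%:C ^+ a i.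
pose h := reverse_poly c * p.
have H2h : H2 h := H2_mul (reverse_poly_holomorphic c) (reverse_poly_bounded c) H2p.
exists (full_word n K), h; split => //.
have H2l := (H2_mulw (full_word n K) H2p).1.
have H2F := H2_B H2l (H2_mul ht tM H2h).
set F := mulw _ _ - _ in H2F *.
have [hF _ _] := H2F.
pose B := \sum_a modulus (c a).
pose u k := 4 * P ^+ 2 * (Tnormsq (fun t =>
      1 - theta (rpoint (fun=> inc_radius k) t) * (theta (rpoint (fun=> inc_radius k) t))^*) + M ^+ 2 * d)
  + 4 * P ^+ 2 * M ^+ 2 * (d ^+ 2 + (B * (1 - inc_radius k ^+ (2 * K * n))) ^+ 2).
have cu : u @ \oo --> 4 * P ^+ 2 * (0 + M ^+ 2 * d) + 4 * P ^+ 2 * M ^+ 2 * (d ^+ 2 + 0).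
  exact: (cvgD (cvgM (cvg_cst _) (cvgD (inner_defect theta_inner) (cvg_cst _)))
    (cvgM (cvg_cst _) (cvgD (cvg_cst _) (@cvg_defect B (2 * K * n))))).
apply: (@le_trans _ _ (4 * P ^+ 2 * (0 + M ^+ 2 * d) + 4 * P ^+ 2 * M ^+ 2 * (d ^+ 2 + 0))); last first.
  apply: le_trans de; rewrite add0r addr0.
  have : d ^+ 2 <= d by rewrite expr2 ler_piMr// ltW.
  have : 0 <= 4 * P ^+ 2 * M ^+ 2 by rewrite mulr_ge0 ?sqr_ge0// mulr_ge0 ?sqr_ge0.
  move=> h1 /(ler_wpM2l h1); lra.
apply: (ler_cvg_to (cvg_msq H2F) cu); apply: nearW => k.
have r01 := @inc_radius_itv0 R k; set r := inc_radius k in r01 *.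
have /andP[r0 r1] := r01.
have pt (t : n.-tuple RM) : polydisc (rpoint (fun=> r) t) by apply: polydisc_rpoint.
have htd : holomorphic (trunc theta - dil s (trunc theta)).
  by have [h1 _ _] := H2_B H2t H2d.
have btd := bmeas_torus htd r01.
have bD : bmeas setT (fun t : n.-tuple RM =>
    1 - theta (rpoint (fun=> r) t) * (theta (rpoint (fun=> r) t))^*).
  apply: (@bmeasB _ _ _ _ (fun=> 1)); first exact: bmeas_cst.
  by apply: bmeasMJ; exact: (bmeas_torus ht r01).
have mM : modulus M%:C = M by rewrite modulus_real// ltW.
have key := @Tnormsq_le_comb _ _ _ _ _ (4 * P ^+ 2)
  (4 * P ^+ 2 * M ^+ 2 * (d ^+ 2 + (B * (1 - r ^+ (2 * K * n))) ^+ 2))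
  (bmeas_torus hF r01) bD (bmeasZ M%:C btd).
have {key} := key _; rewrite (Tnormsq_Z _ btd) mM => key.
apply: (le_trans (key _)); last first.
  rewrite lerD2r; apply: ler_wpM2l; first by rewrite mulr_ge0 ?sqr_ge0.
  rewrite lerD2l; apply: ler_wpM2l; first exact: sqr_ge0.
  by apply: le_trans sd; exact: (msq_le_norm (H2_B H2t H2d) r01).
move=> t; set z := rpoint _ t; have zp : polydisc z := pt t.
have zr i : modulus (z 0 i) = r by rewrite modulus_rpoint.
have FE : F z = (\prod_(i < n) z 0 i) ^+ K * p z - theta z * (reverse_poly c z * p z).
  by rewrite -mulw_full.
have szs i : modulus ((s%:C *: z) 0 i) <= s.
  rewrite mxE modulusM zr modulus_real; last exact: ltW.
  by rewrite ler_piMr// ltW.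
have q1 : modulus ((\prod_(i < n) z 0 i) ^+ K) <= 1.
  rewrite modulusX modulus_prod exprn_ile1//.
    by apply: prodr_ge0 => i _; exact: modulus_ge0.
  by apply: prodr_ile1 => i _; rewrite zr r0 ltW.
have tT : modulus (theta z - polyval c z) <=
    modulus ((trunc theta - dil s (trunc theta)) z) + d.
  rewrite -polyval_scale.
  have -> : theta z - polyval c0 (s%:C *: z) =
      (trunc theta - dil s (trunc theta)) z + (theta (s%:C *: z) - polyval c0 (s%:C *: z)).
    rewrite !fctE (truncE _ zp) /dil (truncE _ zp) truncE; last exact: polydisc_scale.
    by ring.
  by apply: (le_trans (modulusD _ _)); rewrite lerD2l; exact: c0P.
have := defect_bound (ltW P0) q1 (pP z) (tM z zp) tT (reverse_poly_torus c t r01).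
rewrite -FE -/B; set a := modulus (1 - _); set b := modulus ((_ - dil _ _) z).
set x := B * _ => Fle.
have M0' := ltW M0.
have b0 : 0 <= b by exact: modulus_ge0.
rewrite [modulus (M%:C * _)]modulusM mM -/b.
apply: (@le_trans _ _ ((P * (a + M * (b + d) + M * x)) ^+ 2)).
  have := le_trans (modulus_ge0 _) Fle => Y0.
  by rewrite lerXn2r ?nnegrE ?modulus_ge0.
have -> : (P * (a + M * (b + d) + M * x)) ^+ 2 = P ^+ 2 * (a + M * b + M * d + M * x) ^+ 2.
  by ring.
have -> : 4 * P ^+ 2 * (a ^+ 2 + (M * b) ^+ 2) + 4 * P ^+ 2 * M ^+ 2 * (d ^+ 2 + x ^+ 2) =
  P ^+ 2 * (4 * (a ^+ 2 + (M * b) ^+ 2) + 4 * ((M * d) ^+ 2 + (M * x) ^+ 2)) by ring.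
by apply: ler_wpM2l; [exact: sqr_ge0|exact: sqr_sum4_le].
Qed.

(** Dilations of f are bounded, and multiplication by a monomial does not
    increase norms. *)
Lemma word_approx f (e : R) : H2 f -> 0 < e ->
  exists l h, H2 h /\ hardy_norm (mulw l f - theta * h) ^+ 2 <= e.
Proof.
move=> H2f e0; have [hf _ _] := H2f; have ht := inner_holomorphic; have [M M0 tM] := inner_bounded.
have e40 : 0 < e / 4 by rewrite divr_gt0.
have [s /andP[s0 s1] sf] := dil_approx H2f e40.
have s01 : 0 <= s < 1 by rewrite ltW.
have s01' : 0 <= s <= 1 by rewrite !ltW.
have H2d := H2_dil H2f s01'.
have [P P0 dP] := dil_bounded s01 hf.
have [l [h [H2h lh]]] := word_approx_bounded H2d P0 dP e40.
exists l, h; split => //.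
have -> : mulw l f - theta * h = mulw l (f - dil s f) + (mulw l (dil s f) - theta * h).
  apply/funext => z; rewrite !fctE !mulwE /= ?fctE; ring.
have [H2l nl] := H2_mulw l (H2_B H2f H2d).
have H2r := H2_B (H2_mulw l H2d).1 (H2_mul ht tM H2h).
apply: (le_trans (hardy_normD_le H2l H2r)).
have -> : e = 2 * (e / 4) + 2 * (e / 4) by field.
exact: (lerD (ler_wpM2l (ler0n R 2) (le_trans nl sf)) (ler_wpM2l (ler0n R 2) lh)).
Qed.

End vanishing.

(** * Operators invariant under the compressed shifts *)

Section invariance.
Context {R : realType} (n : nat).
Local Notation C := R[i].
Local Notation Cn := 'rV[C]_n.
Implicit Types (f g h u v q : Cn -> C) (i : 'I_n) (l : seq 'I_n).

Variable theta : Cn -> C.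
Hypothesis theta_inner : inner_function theta.
Local Notation Q := (quotient_module theta).
Local Notation Cz := (compressed_shift theta).

Definition perp u := H2 u /\ forall q, Q q -> hardy_dot u q = 0.

Lemma Q_H2 q : Q q -> H2 q. Proof. by case. Qed.

Lemma H2_theta h : H2 h -> H2 (theta * h).
Proof.
have [M _ tM] := inner_bounded theta_inner.
exact: (H2_mul (inner_holomorphic theta_inner) tM).
Qed.

Lemma Q_dot q h : Q q -> H2 h -> hardy_dot q (theta * h) = 0.
Proof. by move=> [_ q0] H2h; apply: q0; exists h. Qed.

Lemma Q_intro q : H2 q -> (forall h, H2 h -> hardy_dot q (theta * h) = 0) -> Q q.
Proof. by move=> H2q q0; split => // _ [h H2h <-]; exact: q0. Qed.

Lemma Q_0 : Q 0.
Proof. by apply: (Q_intro (H2_0 _)) => h H2h; exact: (dot0l (H2_theta H2h)). Qed.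

(** Dual to the invariance of theta H^2 under multiplication by z_i. *)
Lemma Q_bshift i q : Q q -> Q (bshift i q).
Proof.
move=> Qq; have H2q := Q_H2 Qq; have H2S := H2_bshift i H2q.
apply: (Q_intro H2S) => h H2h; have H2t := H2_theta H2h.
rewrite (dotC H2t H2S) -(dot_mulz i H2t H2q).
have -> : mulz i (theta * h) = theta * mulz i h.
  by apply/funext => z; rewrite !fctE /mulz mulrCA.
have [H2z _] := H2_mulz i H2h.
by rewrite (dotC Qq.1 (H2_theta H2z)) (Q_dot Qq H2z) !conjc0.
Qed.

(** Thanks to this, compressions of words are compositions of compressed
    shifts. *)
Lemma perp_mulz i u : perp u -> perp (mulz i u).
Proof.
move=> [H2u u0]; split; first exact: (H2_mulz i H2u).1.
by move=> q Qq; rewrite (dot_mulz i H2u (Q_H2 Qq)); exact: (u0 _ (Q_bshift i Qq)).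
Qed.

Lemma perpD u v : perp u -> perp v -> perp (u + v).
Proof.
move=> [H2u u0] [H2v v0]; split; first exact: (H2_D H2u H2v).
by move=> q Qq; rewrite (dotDl H2u H2v (Q_H2 Qq)) (u0 _ Qq) (v0 _ Qq) addr0.
Qed.

Lemma perp0 : perp 0.
Proof. by split; [exact: H2_0|move=> q Qq; exact: (dot0l (Q_H2 Qq))]. Qed.

Lemma perp_theta h : H2 h -> perp (theta * h).
Proof.
move=> H2h; split; first exact: H2_theta.
by move=> q Qq; rewrite (dotC (Q_H2 Qq) (H2_theta H2h)) (Q_dot Qq H2h) conjc0.
Qed.

Lemma perp_dot u f q : H2 f -> perp (u - f) -> H2 u -> Q q -> hardy_dot u q = hardy_dot f q.
Proof.
move=> H2f [_ uf0] H2u Qq; apply/eqP; rewrite -subr_eq0.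
by rewrite -(dotBl H2u H2f (Q_H2 Qq)) (uf0 _ Qq).
Qed.

(** By Cauchy-Schwarz, since <u, f> = <f, f>: f is the orthogonal projection
    of u on Q. *)
Lemma perp_norm u f : H2 u -> Q f -> perp (u - f) ->
  hardy_norm f ^+ 2 <= hardy_norm u ^+ 2.
Proof.
move=> H2u Qf uf; have H2f := Q_H2 Qf.
have aux (a b : R) : 2 * a <= b + a -> a <= b by lra.
have := dot_le H2u H2f ler01; rewrite expr1n !mul1r mulr1.
rewrite (perp_dot H2f uf H2u Qf) (dotff H2f) modulus_real; last exact: sqr_ge0.
exact: aux.
Qed.

(** The first case is the default value of the projection. *)
Lemma projection_cases i f : Q f ->
  Cz i f = 0 \/ Q (Cz i f) /\ perp (mulz i f - Cz i f).
Proof.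
move=> Qf; rewrite /compressed_shift /projection.
case: xgetP => [g _ [Qg g0]|_]; last by left.
right; split; first exact: Qg.
split; last exact: g0.
exact: (H2_B (H2_mulz i (Q_H2 Qf)).1 (Q_H2 Qg)).
Qed.

Lemma Q_compressed i f : Q f -> Q (Cz i f).
Proof. by move=> /(projection_cases i)[->|[Qg _]]; [exact: Q_0|exact: Qg]. Qed.

Variable A : (Cn -> C) -> (Cn -> C).
Hypothesis hA : bounded_operator Q A.

Lemma operator0 : A 0 = 0.
Proof.
have [_ lin _] := hA; have := lin (-1) 0 0 Q_0 Q_0.
by rewrite scaler0 addr0 scaleN1r addNr.
Qed.

(** Any value at 0 of the adjoint of C_i is orthogonal to itself. *)
Lemma zero_invariant : (forall f, Q f -> A f = 0) -> forall i f, Q f ->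
  adjoint Q (Cz i) (A (Cz i f)) = A f.
Proof.
move=> A00 i f Qf; rewrite (A00 _ Qf) (A00 _ (Q_compressed i Qf)) /adjoint.
case: xgetP => // h _ [Qh h0]; have H2h := Q_H2 Qh.
by apply: (hardy_dotff_eq0 H2h); rewrite -(h0 _ Qh); exact: (dot0r (Q_H2 (Q_compressed i Qh))).
Qed.

Hypothesis inv : forall i f, Q f -> adjoint Q (Cz i) (A (Cz i f)) = A f.

(** <g, A f> = <g, C_i^* A C_i f> = <C_i g, A C_i f>, unless a default value
    of the adjoint or of a projection makes the scalar product 0. *)
Lemma chain_step i f g : Q f -> Q g -> hardy_dot g (A f) = 0 \/
  exists f' g', [/\ Q f', Q g', hardy_dot g (A f) = hardy_dot g' (A f'),
    perp (mulz i f - f') & hardy_norm g' ^+ 2 <= hardy_norm g ^+ 2].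
Proof.
move=> Qf Qg; have [QA _ _] := hA.
have H2g := Q_H2 Qg.
have := inv i Qf; rewrite /adjoint; case: xgetP => [h _ [Qh hE] hA'|_ A0f]; last first.
  by left; rewrite -A0f (dot0r H2g).
have gE : hardy_dot g (A f) = hardy_dot (Cz i g) (A (Cz i f)) by rewrite -hA' -hE.
have [C0|[Qf' pf]] := projection_cases i Qf.
  by left; rewrite gE C0 operator0 (dot0r (Q_H2 (Q_compressed i Qg))).
have [C0|[Qg' pg]] := projection_cases i Qg.
  by left; rewrite gE C0 (dot0l (Q_H2 (QA _ Qf'))).
right; exists (Cz i f), (Cz i g).
have [H2z nz] := H2_mulz i H2g.
exact: (And5 Qf' Qg' gE pf (le_trans (perp_norm H2z Qg' pg) nz)).
Qed.

Lemma chain l f g : Q f -> Q g -> hardy_dot g (A f) = 0 \/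
  exists f' g', [/\ Q f', Q g', hardy_dot g (A f) = hardy_dot g' (A f'),
    perp (mulw l f - f') & hardy_norm g' ^+ 2 <= hardy_norm g ^+ 2].
Proof.
move=> Qf Qg; elim: l => [|i l [ih|[f1 [g1 [Qf1 Qg1 E1 p1 n1]]]]].
- right; exists f, g; split; [exact: Qf|exact: Qg|by []| |exact: lexx].
  by rewrite /= subrr; exact: perp0.
- by left.
have [E2|[f2 [g2 [Qf2 Qg2 E2 p2 n2]]]] := chain_step i Qf1 Qg1.
  by left; rewrite E1.
have p3 : perp (mulw (i :: l) f - f2).
  have -> : mulw (i :: l) f - f2 = mulz i (mulw l f - f1) + (mulz i f1 - f2).
    by apply/funext => z; rewrite /= ?fctE /mulz ?fctE; ring.
  exact: (perpD (perp_mulz i p1) p2).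
by right; exists f2, g2; exact: (And5 Qf2 Qg2 (etrans E1 E2) p3 (le_trans n2 n1)).
Qed.

(** With the norm of f' at most s, the weighted Cauchy-Schwarz inequality
    bounds the scalar product by a multiple of s, for every s > 0. *)
Lemma invariant_dot0 f g : Q f -> Q g -> hardy_dot g (A f) = 0.
Proof.
move=> Qf Qg; have [QA _ [K AK]] := hA.
pose G := hardy_norm g ^+ 2 + K ^+ 2.
have bound (s : R) : 0 < s -> 2 * s * modulus (hardy_dot g (A f)) <= s ^+ 2 * G.
  move=> s0; have s20 : 0 < s ^+ 2 by rewrite exprn_gt0.
  have [l [h [H2h lh]]] := word_approx theta_inner (Q_H2 Qf) s20.
  have [->|[f' [g' [Qf' Qg' -> pf ng]]]] := chain l Qf Qg.
    by rewrite modulus0 mulr0 mulr_ge0// ?sqr_ge0// addr_ge0 ?sqr_ge0.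
  have H2f' := Q_H2 Qf'.
  have H2u := H2_B (H2_mulw l (Q_H2 Qf)).1 (H2_theta H2h).
  have pu : perp (mulw l f - theta * h - f').
    have -> : mulw l f - theta * h - f' = (mulw l f - f') + theta * (-1 *: h).
      by apply/funext => z; rewrite !fctE /GRing.scale/=; ring.
    exact: (perpD pf (perp_theta (H2_Z (-1) H2h))).
  have nf := le_trans (perp_norm H2u Qf' pu) lh.
  have nA : hardy_norm (A f') ^+ 2 <= K ^+ 2 * s ^+ 2.
    apply: (@le_trans _ _ ((K * hardy_norm f') ^+ 2)).
      have A1 := AK f' Qf'; have A2 : 0 <= hardy_norm (A f') by exact: sqrtr_ge0.
      exact: (lerXn2r 2 A2 (le_trans A2 A1) A1).
    by rewrite exprMn ler_wpM2l ?sqr_ge0.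
  apply: (le_trans (dot_le (Q_H2 Qg') (Q_H2 (QA _ Qf')) (ltW s0))).
  rewrite /G mulrDr; apply: lerD; first by rewrite ler_wpM2l ?sqr_ge0.
  by rewrite mulrC.
apply/eqP; rewrite -modulus_eq0; apply/eqP.
set a := modulus _ in bound *; have a0 : 0 <= a by exact: modulus_ge0.
apply/eqP; rewrite eq_le a0 andbT leNgt; apply/negP => a1.
have G0 : 0 <= G by rewrite addr_ge0 ?sqr_ge0.
have G1 : 0 < G + 1 by rewrite ltr_wpDl.
have s0 : 0 < a / (G + 1) by rewrite divr_gt0.
have := bound _ s0; rewrite expr2 -mulrA mulrCA -mulrA ler_pM2l//.
have : a / (G + 1) * G <= a.
  by rewrite -mulrA ler_piMr// mulrC ler_pdivrMr// mul1r lerDl.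
lra.
Qed.

Lemma invariant_zero f : Q f -> A f = 0.
Proof.
move=> Qf; have [QA _ _] := hA.
by apply: (hardy_dotff_eq0 (Q_H2 (QA _ Qf))); exact: (invariant_dot0 Qf (QA _ Qf)).
Qed.

End invariance.

Theorem theorem4p2 (R : realType) (n : nat) (hn : (1 <= n)%N)
    (theta : 'rV[R[i]]_n -> R[i]) (htheta : inner_function theta)
    (A : ('rV[R[i]]_n -> R[i]) -> ('rV[R[i]]_n -> R[i]))
    (hA : bounded_operator (quotient_module theta) A) :
  (forall i : 'I_n, forall f, quotient_module theta f ->
     adjoint (quotient_module theta) (compressed_shift theta i)
       (A (compressed_shift theta i f)) = A f)
  <-> (forall f, quotient_module theta f -> A f = 0%R).
Proof.
split=> [inv f|A0 i f].
  exact: (invariant_zero htheta hA inv).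
exact: (zero_invariant htheta A0).
Qed.
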